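(* Let $\ell\ge 1$ and let $X(t)$, $0\le t\le 1$, be a zero-mean Green Gaussian process with covariance function $G(t,s)=\mathbb{E}X(t)X(s)$. That is, $G$ is the (generalized) Green function of the boundary value problem $\mathcal{L}u=\lambda u$ on $[0,1]$, where $$\mathcal{L}u=(-1)^{\ell}\big(p_{\ell}u^{(\ell)}\big)^{(\ell)}+\big(p_{\ell-1}u^{(\ell-1)}\big)^{(\ell-1)}+\dots+p_0u ,$$ with boundary conditions $$U_\nu(u):=\alpha_{\nu0}u(0)+\gamma_{\nu0}u(1)+\sum_{j=1}^{2\ell-1}\alpha_{\nu j}u^{(j)}(0)+\sum_{j=1}^{2\ell-1}\gamma_{\nu j}u^{(j)}(1)=0,\qquad \nu=1,\dots,2\ell .$$ Assume that $p_0\equiv 0$. Then the demeaned process $$\overline{X}(t)=X(t)-\int_0^1X(s)\,ds$$ is also a Green Gaussian process. Namely, its covariance function $$\overline{G}(t,s)=G(t,s)-\int_0^1G(t,y)\,dy-\int_0^1G(x,s)\,dx+\int_0^1\!\!\int_0^1G(x,y)\,dy\,dx$$ is the generalized Green function of the boundary value problem $\overline{\mathcal{L}}u:=\mathcal{L}u=\lambda u$ on $[0,1]$ with the following boundary conditions. Since $p_0\equiv0$, write $\mathcal{L}u=(Lu')'$, where $$Lv=(-1)^{\ell}\big(p_{\ell}v^{(\ell-1)}\big)^{(\ell-1)}+\big(p_{\ell-1}v^{(\ell-2)}\big)^{(\ell-2)}+\dots+p_1v .$$ (i) If the constant functions satisfy all the original boundary conditions (equivalently, the covariance operator of $X$ has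 zero eigenvalue with a constant eigenfunction), then the boundary conditions are the original ones, $U_\nu(u)=0$ for $\nu=1,\dots,2\ell$ (and $\overline{G}\equiv G$). (ii) Otherwise, suppose the $2\ell\times2$ matrix with rows $(\alpha_{\nu0},\gamma_{\nu0})$ has rank $2$. Rewrite the original conditions by an invertible linear transformation so that $\alpha_{10}=1$, $\gamma_{10}=0$, $\alpha_{20}=0$, $\gamma_{20}=1$, and $\alpha_{\nu0}=\gamma_{\nu0}=0$ for $\nu>2$. Then the boundary conditions are $$U_\nu(u)=0\ \ (3\le\nu\le2\ell),\qquad U_2(u)-U_1(u)=0,\qquad (Lu')(0)-(Lu')(1)=0 .$$ (iii) Otherwise, suppose that this matrix has rank $1$. Rewrite the original conditions by an invertible linear transformation so that $\alpha_{\nu0}=\gamma_{\nu0}=0$ for $\nu>1$ (in which case $\alpha_{10}+\gamma_{10}\ne0$). Then the boundary conditions are $$U_\nu(u)=0\ \ (2\le\nu\le2\ell),\qquad (Lu')(0)-(Lu')(1)=0 .$$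
   Context: A Green Gaussian process on $[0,1]$ is a Gaussian process whose covariance function is the (generalized) Green function of a boundary value problem $\mathcal{L}u=\lambda u$ on $[0,1]$, where $\mathcal{L}u=(-1)^{\ell}(p_{\ell}u^{(\ell)})^{(\ell)}+(p_{\ell-1}u^{(\ell-1)})^{(\ell-1)}+\dots+p_0u$, with $2\ell$ linearly independent boundary conditions such that the problem is self-adjoint. Standing assumptions: $p_j\in W^j_\infty[0,1]$ for $j=0,\dots,\ell$, and $p_\ell(t)>0$ on $[0,1]$. (Generalized) Green function: let $\varphi_1,\dots,\varphi_m$ ($m\ge0$) be an $L_2(0,1)$-orthonormal basis of the space of solutions of $\mathcal{L}u=0$ satisfying the boundary conditions. The generalized Green function is the symmetric kernel $G(t,s)$ which, as a function of $t$, satisfies the boundary conditions and the equation $\mathcal{L}G(t,s)=\delta(t-s)-\sum_{i=1}^m\varphi_i(t)\varphi_i(s)$ in the sense of distributions, together with $\int_0^1G(t,s)\varphi_i(t)\,dt=0$ for all $i$ and $s$. If $m=0$, it is the conventional Green function, with $\mathcal{L}G(t,s)=\delta(t-s)$. The covariance operator of $X$ is the integral operator on $L_2(0,1)$ with kernel $G$.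
   Formalization: In (ii) and (iii), the claim that the demeaned covariance is the generalized Green function of the new problem assumes that every solution of Lu=0 with the original boundary conditions has mean zero (automatic if m=0); without this it is false, e.g. -u'' with u(0)=0, u(1)-u'(1)=0. *)

(* Defs.v *)
From HB Require Import structures.
From mathcomp Require Import all_boot all_order all_algebra.
From mathcomp Require Import all_classical all_reals all_analysis.

Set Implicit Arguments.
Unset Strict Implicit.
Unset Printing Implicit Defensive.

Import Order.TTheory GRing.Theory Num.Theory.
Import numFieldNormedType.Exports.

Local Open Scope classical_set_scope.
Local Open Scope ring_scope.

Notation leb := lebesgue_measure.

(* Functions on [0,1] are represented by functions R -> R; no definition below
   depends on their values outside [0,1]. *)

Definition ae01 (R : realType) (Q : R -> Prop) : Prop :=
  {ae (@leb R), forall t, 0 <= t <= 1 -> Q t}.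

Definition int01 (R : realType) (f : R -> R) : R :=
  \int[leb]_(t in `[0, 1]) f t.

Definition L01 (R : realType) (q : \bar R) (f : R -> R) : Prop :=
  measurable_fun `[(0 : R), 1] f /\ finite_norm (@leb R) q (f \_ `[0, 1]).

(* W^k_q[0,1]: for k >= 1, f is the continuous representative, recovered by
   integration from its weak derivative g, which lies in W^(k-1)_q. *)
Fixpoint sobolev (R : realType) (q : \bar R) (k : nat) (f : R -> R) : Prop :=
  if k is k'.+1 then
    exists g : R -> R, sobolev q k' g /\
      forall t, 0 <= t <= 1 -> f t = f 0 + \int[leb]_(x in `[0, t]) g x
  else L01 q f.

(* Endpoint values, as one-sided limits from inside the interval: the two-sided
   derivatives [derive1n j u] are meaningful only in ]0,1[. *)
Definition tr0 (R : realType) (f : R -> R) : R := lim (f t @[t --> (0 : R)^'+]).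
Definition tr1 (R : realType) (f : R -> R) : R := lim (f t @[t --> (1 : R)^'-]).

(* For u in W^(2l)_2 the outermost derivatives exist almost everywhere, so
   this is only used up to a.e. equality. *)
Definition Lop (R : realType) (l : nat) (p : nat -> R -> R) (u : R -> R) (t : R)
    : R :=
  (-1) ^+ l * derive1n l (fun x => p l x * derive1n l u x) t
  + \sum_(j < l) derive1n j (fun x => p j x * derive1n j u x) t.

(* The operator L with (L u')' = Lop u when p_0 = 0; it does not involve p_0. *)
Definition Lred (R : realType) (l : nat) (p : nat -> R -> R) (v : R -> R) (t : R)
    : R :=
  (-1) ^+ l * derive1n l.-1 (fun x => p l x * derive1n l.-1 v x) t
  + \sum_(1 <= j < l) derive1n j.-1 (fun x => p j x * derive1n j.-1 v x) t.

Definition admissible_coefs (R : realType) (l : nat) (p : nat -> R -> R) : Prop :=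
  (forall j, (j <= l)%N -> sobolev +oo%E j (p j)) /\
  (forall t, 0 <= t <= 1 -> 0 < p l t).

(* Rows are numbered by nu - 1 in 0 .. 2l-1, columns by the order j of the
   derivative; A holds the alpha_(nu,j) and C the gamma_(nu,j). *)
Definition bform (R : realType) (l : nat) (A C : 'M[R]_(l.*2)) (nu : 'I_(l.*2))
    (u : R -> R) : R :=
  \sum_(j < l.*2) (A nu j * tr0 (derive1n j u) + C nu j * tr1 (derive1n j u)).

Definition satisfies_bc (R : realType) (l : nat) (A C : 'M[R]_(l.*2))
    (u : R -> R) : Prop :=
  forall nu, bform A C nu u = 0.

(* Graph {(u, Lu)} of the operator in L_2(0,1) generated by the expression Lop
   and the boundary conditions. *)
Definition op_graph (R : realType) (l : nat) (p : nat -> R -> R)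
    (A C : 'M[R]_(l.*2)) (u f : R -> R) : Prop :=
  [/\ sobolev 2%:E l.*2 u, satisfies_bc A C u, L01 2%:E f
    & ae01 (fun t => Lop l p u t = f t)].

Definition op_kernel (R : realType) (l : nat) (p : nat -> R -> R)
    (A C : 'M[R]_(l.*2)) (u : R -> R) : Prop :=
  op_graph p A C u (fun=> 0).

(* The pairs (v, g) in the graph of the adjoint are exactly those in the graph
   of the operator (up to the a.e. representative v of an L_2 class). *)
Definition selfadjoint_op (R : realType) (l : nat) (p : nat -> R -> R)
    (A C : 'M[R]_(l.*2)) : Prop :=
  forall v g : R -> R, L01 2%:E v -> L01 2%:E g ->
    (forall u f, op_graph p A C u f ->
       int01 (fun t => f t * v t) = int01 (fun t => u t * g t))
    <->
    (exists2 u, ae01 (fun t => v t = u t) & op_graph p A C u g).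

Definition selfadjoint_bvp (R : realType) (l : nat) (p : nat -> R -> R)
    (A C : 'M[R]_(l.*2)) : Prop :=
  [/\ admissible_coefs l p, row_free (row_mx A C) & selfadjoint_op p A C].

Definition orthonormal_kernel_basis (R : realType) (l : nat) (p : nat -> R -> R)
    (A C : 'M[R]_(l.*2)) (m : nat) (phi : 'I_m -> R -> R) : Prop :=
  [/\ forall i, op_kernel p A C (phi i),
      forall i j, int01 (fun t => phi i t * phi j t) = (i == j)%:R
    & forall u, op_kernel p A C u ->
        exists c : 'I_m -> R,
          forall t, 0 <= t <= 1 -> u t = \sum_i c i * phi i t].

Definition test_function (R : realType) (eta : R -> R) : Prop :=
  (forall n x, derivable (derive1n n eta) x 1) /\
  exists a b : R, [/\ 0 < a, b < 1 & forall x, ~~ (a <= x <= b) -> eta x = 0].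

(* L G(.,s) = delta_s - sum_i phi_i(s) phi_i in the sense of distributions; Lop
   is formally symmetric, hence its transpose acting on eta is Lop again. *)
Definition green_equation (R : realType) (l : nat) (p : nat -> R -> R) (m : nat)
    (phi : 'I_m -> R -> R) (G : R -> R -> R) (s : R) : Prop :=
  forall eta f : R -> R, test_function eta -> L01 2%:E f ->
    ae01 (fun t => Lop l p eta t = f t) ->
    int01 (fun t => G t s * f t)
    = eta s - \sum_i phi i s * int01 (fun t => phi i t * eta t).

(* As usual for Green functions of order 2l >= 2, the kernel is continuous on
   the closed square, and G(.,s) is regular on either side of t = s, so that
   the boundary conditions make sense for it. For s = 0 and s = 1, where the
   derivative of order 2l - 1 jumps at an endpoint, G(.,s) is determined by
   continuity. *)
Definition generalized_green (R : realType) (l : nat) (p : nat -> R -> R)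
    (A C : 'M[R]_(l.*2)) (G : R -> R -> R) : Prop :=
  [/\ {within `[0, 1] `*` `[0, 1], continuous (fun z : R * R => G z.1 z.2)},
      forall t s, 0 <= t <= 1 -> 0 <= s <= 1 -> G t s = G s t,
      forall s, 0 < s < 1 -> exists g0 g1 : R -> R,
        [/\ sobolev 2%:E l.*2 g0, sobolev 2%:E l.*2 g1,
            forall t, 0 <= t <= s -> G t s = g0 t
          & forall t, s <= t <= 1 -> G t s = g1 t],
      forall s, 0 < s < 1 -> satisfies_bc A C (G ^~ s)
    & exists (m : nat) (phi : 'I_m -> R -> R),
        [/\ orthonormal_kernel_basis p A C phi,
            forall s, 0 < s < 1 -> green_equation l p phi G s
          & forall i s, 0 <= s <= 1 -> int01 (fun t => G t s * phi i t) = 0]].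

Definition cov_operator (R : realType) (G : R -> R -> R) (f : R -> R) (t : R)
    : R :=
  int01 (fun s => G t s * f s).

(* [normal_prob m 0] is not the point mass at m in the library, so degenerate
   Gaussian variables are treated separately. *)
Definition gaussian_rv d (T : measurableType d) (R : realType)
    (P : probability T R) (Y : T -> R) : Prop :=
  measurable_fun setT Y /\
  exists m s : R, forall B : set R, measurable B ->
    P (Y @^-1` B) = (if s == 0 then \d_m B else normal_prob m s B).

(* Joint measurability gives a meaning to the pathwise integrals of X. *)
Definition gaussian_process d (T : measurableType d) (R : realType)
    (P : probability T R) (X : R -> T -> R) : Prop :=
  measurable_fun (`[(0 : R), 1] `*` [set: T]) (fun z : R * T => X z.1 z.2) /\
  forall (n : nat) (t c : 'I_n -> R), (forall i, 0 <= t i <= 1) ->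
    gaussian_rv P (fun w => \sum_i c i * X (t i) w).

Definition zero_mean d (T : measurableType d) (R : realType)
    (P : probability T R) (X : R -> T -> R) : Prop :=
  forall t, 0 <= t <= 1 -> ('E_P[X t] = 0)%E.

Definition covariance_function d (T : measurableType d) (R : realType)
    (P : probability T R) (X : R -> T -> R) (G : R -> R -> R) : Prop :=
  forall t s, 0 <= t <= 1 -> 0 <= s <= 1 ->
    covariance P (X t) (X s) = (G t s)%:E.

Definition green_gaussian_process d (T : measurableType d) (R : realType)
    (P : probability T R) (X : R -> T -> R) (l : nat) (p : nat -> R -> R)
    (A C : 'M[R]_(l.*2)) (G : R -> R -> R) : Prop :=
  [/\ gaussian_process P X, covariance_function P X G, selfadjoint_bvp p A C
    & generalized_green p A C G].

Definition demean d (T : measurableType d) (R : realType) (X : R -> T -> R)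
    (t : R) (w : T) : R :=
  X t w - int01 (fun s => X s w).

Definition demean_kernel (R : realType) (G : R -> R -> R) (t s : R) : R :=
  G t s - int01 (fun y => G t y) - int01 (fun x => G x s)
  + int01 (fun x => int01 (fun y => G x y)).

Definition idx0 (l : nat) (hl : (0 < l)%N) : 'I_(l.*2) :=
  Ordinal (etrans (double_gt0 l) hl).

Lemma idx1_subproof (l : nat) : (0 < l)%N -> (1 < l.*2)%N.
Proof. by case: l => // l _; rewrite doubleS. Qed.

Definition idx1 (l : nat) (hl : (0 < l)%N) : 'I_(l.*2) :=
  Ordinal (idx1_subproof hl).

(* The 2l x 2 matrix with rows (alpha_(nu,0), gamma_(nu,0)). *)
Definition value_coefs (R : realType) (l : nat) (hl : (0 < l)%N)
    (A C : 'M[R]_(l.*2)) : 'M[R]_(l.*2, 1 + 1) :=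
  row_mx (col (idx0 hl) A) (col (idx0 hl) C).

Definition normalized2 (R : realType) (l : nat) (hl : (0 < l)%N)
    (A C : 'M[R]_(l.*2)) : Prop :=
  [/\ A (idx0 hl) (idx0 hl) = 1 /\ C (idx0 hl) (idx0 hl) = 0,
      A (idx1 hl) (idx0 hl) = 0 /\ C (idx1 hl) (idx0 hl) = 1
    & forall nu : 'I_(l.*2), (1 < nu)%N ->
        A nu (idx0 hl) = 0 /\ C nu (idx0 hl) = 0].

Definition normalized1 (R : realType) (l : nat) (hl : (0 < l)%N)
    (A C : 'M[R]_(l.*2)) : Prop :=
  forall nu : 'I_(l.*2), (0 < nu)%N ->
    A nu (idx0 hl) = 0 /\ C nu (idx0 hl) = 0.

Definition periodic_flux (R : realType) (l : nat) (p : nat -> R -> R)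
    (u : R -> R) : R :=
  tr0 (Lred l p (derive1 u)) - tr1 (Lred l p (derive1 u)).

(* The forms of the demeaned problem when the rank is 2, resp. 1; the condition
   on L u' is put in the first row. *)
Definition demeaned_forms2 (R : realType) (l : nat) (hl : (0 < l)%N)
    (p : nat -> R -> R) (A C : 'M[R]_(l.*2)) (nu : 'I_(l.*2)) (u : R -> R) : R :=
  if nu == idx0 hl then periodic_flux l p u
  else if nu == idx1 hl then bform A C (idx1 hl) u - bform A C (idx0 hl) u
  else bform A C nu u.

Definition demeaned_forms1 (R : realType) (l : nat) (hl : (0 < l)%N)
    (p : nat -> R -> R) (A C : 'M[R]_(l.*2)) (nu : 'I_(l.*2)) (u : R -> R) : R :=
  if nu == idx0 hl then periodic_flux l p u else bform A C nu u.

(* The functionals U are the boundary forms with coefficients A and C; these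
   coefficients are determined by U. *)
Definition coefs_of_forms (R : realType) (l : nat)
    (U : 'I_(l.*2) -> (R -> R) -> R) (A C : 'M[R]_(l.*2)) : Prop :=
  forall u, sobolev 2%:E l.*2 u -> forall nu, bform A C nu u = U nu u.

(* Automatic for a trivial kernel (conventional Green function). When constants
   are not in the kernel, this is necessary for the demeaned kernel Gbar to be
   the generalized Green function of the demeaned problem, whose kernel is then
   spanned by the original one and the constants. Example: - u'' with u(0) = 0,
   u(1) - u'(1) = 0 has kernel spanned by t, and -(d/dt)^2 Gbar(t,s) =
   delta(t-s) - 1 - 3t(s - 1/2), whose right-hand side is not symmetric. *)
Definition kernel_orthogonal_to_constants (R : realType) (l : nat)
    (p : nat -> R -> R) (A C : 'M[R]_(l.*2)) : Prop :=
  forall u, op_kernel p A C u -> int01 u = 0.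

(* Main.v *)
(* Constants are killed by L when p_0 = 0, and the integral of L u is the flux
   (L u')(1) - (L u')(0). Testing the equation of G(.,s) against the domain of the
   self-adjoint operator gives, for u in the domain,
     int G(t,s) (L u)(t) dt = u(s) - sum_i phi_i(s) <phi_i, u>,
   so that, by self-adjointness, the mean k(t) = int G(t,y) dy belongs to the domain
   and L k = 1 - sum_i <phi_i, 1> phi_i.

   If 1 satisfies the boundary conditions, then it belongs to the kernel and k = 0;
   conversely, k = 0 forces 1 to be a combination of the phi_i. Otherwise the
   demeaned conditions describe the functions u such that u + c is in the original
   domain for some constant c and int L u = 0; this operator is self-adjoint, since
   its domain is obtained from the original one by imposing one condition and adding
   one direction. When the kernel is orthogonal to 1, L k = 1, and
   G(t,s) - k(t) - k(s) + int k is its Green function: near the endpoints it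
   is an element of the new domain, and the kernel is spanned by the phi_i and 1.

   The demeaned process is Gaussian because int X is the L2-limit of its Riemann
   sums (G is uniformly continuous), and L2-limits of centered Gaussian variables
   are Gaussian: their laws are those of multiples s_n (xi - E xi) of one variable,
   and the s_n converge. *)

Require Import Defs.
From HB Require Import structures.
From mathcomp Require Import all_boot all_order all_algebra.
From mathcomp Require Import all_classical all_reals all_analysis.
From mathcomp Require Import measurable_realfun hoelder ess_sup_inf.
From mathcomp Require Import ring lra zify.

Set Implicit Arguments.
Unset Strict Implicit.
Unset Printing Implicit Defensive.

Import Order.TTheory GRing.Theory Num.Theory.
Import numFieldNormedType.Exports.

Local Open Scope classical_set_scope.
Local Open Scope ring_scope.

(** * Integration on the unit interval *)

Section unit_interval.
Context {R : realType}.
Implicit Types (f g h u v : R -> R) (Q : R -> Prop).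

(** The Green equation is tested only on smooth functions of compact support, while the argument
    needs it on the whole domain. No Lagrange identity with boundary terms is proved for this: every
    integration by parts is the symmetry of the self-adjoint operator, applied to functions cut off
    so as to lie in its domain. Terms at s disappear because the jet at s is first made to vanish,
    terms at 0 and 1 by comparing G(.,s) with a glued element of the domain.

    A function of W^(2l)_2 is handled as the list of its weak derivatives, since two-sided
    derivatives have no meaning at the endpoints and the top one exists only almost everywhere;
    locality, conversely, is read off from genuine derivatives.

    Both rank cases are one problem: after a change of rows, all conditions but the first annihilate
    constants, and the first is replaced by the flux condition.

    In the Gaussian limit, the moments of the standard normal law are not computed: square
    integrability and non-degeneracy are transferred from an approximating variable. *)

Definition integrable01 f := (@leb R).-integrable `[0, 1] (EFin \o f).

Lemma ae_mono (U V : set R) : U `<=` V -> {ae (@leb R), forall x, U x} -> {ae (@leb R), forall x, V x}.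
Proof. by move=> UV; apply: (@filterS _ _ (ae_filter_ringOfSetsType _)) => x /UV. Qed.

Lemma ae_mono2 (U V W : set R) : (forall x, U x -> V x -> W x) ->
  {ae (@leb R), forall x, U x} -> {ae (@leb R), forall x, V x} ->
  {ae (@leb R), forall x, W x}.
Proof. by move=> h; apply: (@filterS2 _ _ (ae_filter_ringOfSetsType _)). Qed.

Lemma ae01_mono Q Q' : (forall t, 0 <= t <= 1 -> Q t -> Q' t) -> ae01 Q -> ae01 Q'.
Proof.
by move=> QQ'; apply: ae_mono => t h t01; apply: QQ' => //; exact: h.
Qed.

Lemma ae01W Q : (forall t, 0 <= t <= 1 -> Q t) -> ae01 Q.
Proof. by move=> h; apply/aeW => t; exact: h. Qed.

Lemma ae01_and Q Q' : ae01 Q -> ae01 Q' -> ae01 (fun t => Q t /\ Q' t).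
Proof. by apply: ae_mono2 => t h h' t01; split; [exact: h|exact: h']. Qed.

Lemma ae01_oo Q : (forall t, 0 < t < 1 -> Q t) -> ae01 Q.
Proof.
move=> h; exists ([set (0 : R)] `|` [set (1 : R)]); split.
- exact: measurableU.
- apply/eqP; rewrite -measure_le0.
  by rewrite (le_trans (measureU2 _ _ _)) //= !lebesgue_measure_set1 adde0.
- move=> t /= /not_implyP[/andP[t0 t1] nQ].
  have [->|tn0] := eqVneq t 0; first by left.
  have [->|tn1] := eqVneq t 1; first by right.
  by exfalso; apply/nQ/h; rewrite !lt_neqAle t0 t1 eq_sym tn0 tn1.
Qed.

Lemma ae01_oo_mono Q Q' : (forall t, 0 < t < 1 -> Q t -> Q' t) -> ae01 Q -> ae01 Q'.
Proof.
move=> QQ' aQ; have := ae01_and aQ (@ae01_oo (fun t => 0 < t < 1) (fun t H => H)).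
by apply: ae01_mono => t _ [? ?]; exact: QQ'.
Qed.

Lemma integrable01_meas f : integrable01 f -> measurable_fun `[(0 : R), 1] f.
Proof. by move=> /integrableP[/measurable_EFinP]. Qed.

Lemma eq_int01 f g : (forall t, 0 <= t <= 1 -> f t = g t) -> int01 f = int01 g.
Proof. by move=> fg; apply: eq_Rintegral => t; rewrite inE /= in_itv /=; exact: fg. Qed.

Lemma int01_ae f g : measurable_fun `[(0 : R), 1] f -> measurable_fun `[(0 : R), 1] g ->
  ae01 (fun t => f t = g t) -> int01 f = int01 g.
Proof.
move=> mf mg fg; congr fine; apply: ae_eq_integral => //.
- exact/measurable_EFinP.
- exact/measurable_EFinP.
- by move: fg; apply: ae_mono => t h /=; rewrite in_itv /= => /h ->.
Qed.

Lemma integrable01_ae f g : measurable_fun `[(0 : R), 1] g ->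
  ae01 (fun t => f t = g t) -> integrable01 f -> integrable01 g.
Proof.
move=> mg fg intf; move/integrableP: (intf) => [mf fi].
apply/integrableP; split; first exact/measurable_EFinP.
suff <- : (\int[leb]_(x in `[0%R, 1%R]) `|(EFin \o f) x| =
  \int[leb]_(x in `[0%R, 1%R]) `|(EFin \o g) x|)%E by [].
apply: ae_eq_integral => //.
- exact: measurableT_comp.
- by apply: measurableT_comp => //; exact/measurable_EFinP.
- by move: fg; apply: ae_mono => t h /=; rewrite in_itv /= => /h ->.
Qed.

Lemma eq_integrable01 f g : (forall t, 0 <= t <= 1 -> f t = g t) ->
  integrable01 f -> integrable01 g.
Proof.
move=> fg; apply: eq_integrable => // t; rewrite inE /= in_itv /=.
by move=> /fg ->.
Qed.

Lemma integrable01D f g : integrable01 f -> integrable01 g ->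
  integrable01 (fun t => f t + g t).
Proof. by move=> hf hg; apply: (integrableD _ hf hg). Qed.

Lemma integrable01Z a f : integrable01 f -> integrable01 (fun t => a * f t).
Proof. by move=> hf; apply: (integrableZl _ a hf). Qed.

Lemma integrable01B f g : integrable01 f -> integrable01 g ->
  integrable01 (fun t => f t - g t).
Proof. by move=> hf hg; apply: (integrableB _ hf hg). Qed.

Lemma integrable01_dom f g : measurable_fun `[(0 : R), 1] f -> integrable01 g ->
  (forall t, 0 <= t <= 1 -> `|f t| <= g t) -> integrable01 f.
Proof.
move=> mf intg fg; apply: le_integrable intg => //.
- exact/measurable_EFinP.
- move=> t; rewrite /= in_itv /= => /fg h.
  by rewrite lee_fin (le_trans h) // ler_norm.
Qed.

Lemma int01D f g : integrable01 f -> integrable01 g ->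
  int01 (fun t => f t + g t) = int01 f + int01 g.
Proof. by move=> hf hg; apply: RintegralD. Qed.

Lemma int01B f g : integrable01 f -> integrable01 g ->
  int01 (fun t => f t - g t) = int01 f - int01 g.
Proof. by move=> hf hg; apply: RintegralB. Qed.

Lemma int01Z a f : integrable01 f -> int01 (fun t => a * f t) = a * int01 f.
Proof. by move=> hf; apply: RintegralZl. Qed.

Lemma leb01 : leb `[(0 : R), 1] = 1%E.
Proof. by rewrite lebesgue_measure_itv /= lte_fin ltr01 oppr0 adde0. Qed.

Lemma int01_cst (c : R) : int01 (fun=> c) = c.
Proof.
rewrite /int01 Rintegral_cst //.
rewrite -[RHS]mulr1; congr (_ * _); transitivity (fine (1%E : \bar R)) => //.
by congr fine; exact: leb01.
Qed.

Lemma integrable01_cst (c : R) : integrable01 (fun=> c).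
Proof.
apply: measurable_bounded_integrable => //.
- by apply: (@le_lt_trans _ _ 1%E); [rewrite -leb01|exact: ltry].
- by exists `|c|; split => // x cx t _ /=; exact: ltW.
Qed.

Lemma integrable01_sum n (F : 'I_n -> R -> R) : (forall i, integrable01 (F i)) ->
  integrable01 (fun t => \sum_i F i t).
Proof.
move=> h; rewrite (_ : (fun t => \sum_i F i t) = (fun t => (\sum_(i <- enum 'I_n) F i t))); last first.
  by apply/funext => t; rewrite big_enum.
elim: (enum _) => [|i s ih].
  by under eq_fun do rewrite big_nil; exact: integrable01_cst.
by under eq_fun do rewrite big_cons; exact: integrable01D.
Qed.

Lemma int01_sum n (F : 'I_n -> R -> R) : (forall i, integrable01 (F i)) ->
  int01 (fun t => \sum_i F i t) = \sum_i int01 (F i).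
Proof.
move=> h; suff H s : integrable01 (fun t => \sum_(i <- s) F i t) /\
    int01 (fun t => \sum_(i <- s) F i t) = \sum_(i <- s) int01 (F i).
  rewrite -[RHS]big_enum -(H (enum 'I_n)).2.
  by apply: eq_int01 => t _; rewrite big_enum.
elim: s => [|i s [ih1 ih2]].
  under eq_fun do rewrite big_nil.
  by split; [exact: integrable01_cst|rewrite int01_cst big_nil].
under eq_fun do rewrite big_cons.
by split; [exact: integrable01D|rewrite int01D// big_cons ih2].
Qed.

Lemma L2P f : L01 2%:E f <->
  measurable_fun `[(0 : R), 1] f /\ integrable01 (fun t => f t ^+ 2).
Proof.
have E : (\int[leb]_x (`|(EFin \o (f \_ `[0%R, 1%R])) x| `^ 2) =
          \int[leb]_(x in `[0%R, 1%R]) `|(EFin \o (fun t => f t ^+ 2)%R) x|)%E.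
  rewrite [RHS]integral_mkcond; apply: eq_integral => t _.
  rewrite /= !patchE; case: ifPn => _ /=.
    by rewrite normrX powR_mulrn.
  by rewrite normr0 powR0// pnatr_eq0.
split=> [[mf]|[mf /integrableP[_ i2]]].
- rewrite /finite_norm unlock => fin; split => //; apply/integrableP; split.
    by apply/measurable_EFinP; exact: measurable_funX.
  by rewrite -E; move: fin => /lty_poweRy; apply; rewrite invr_neq0// pnatr_eq0.
- by split => //; rewrite /finite_norm unlock E; exact: poweR_lty.
Qed.

Lemma ae01_restr Q (f : R -> R) : Q 0 ->
  {ae (@leb R), forall t, Q ((f \_ `[(0:R), 1]) t)} <-> ae01 (fun t => Q (f t)).
Proof.
move=> Q0; split; apply: ae_mono => t.
  by move=> + t01; rewrite patchE mem_set //= in_itv.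
rewrite patchE; case: ifPn => [|_ _ //].
by rewrite inE /= in_itv /= => t01; exact.
Qed.

Lemma LooP f : L01 +oo%E f <->
  measurable_fun `[(0 : R), 1] f /\ exists M : R, ae01 (fun t => `|f t| <= M).
Proof.
have mT : (0 < (@leb R) [set: R])%E.
  apply: (@lt_le_trans _ _ 1%E) => //; rewrite -leb01.
  by apply: le_measure => //; rewrite inE.
rewrite /L01 /finite_norm unlock mT; split=> [[mf h]|[mf [M hM]]]; split => //.
- have [M hM] := @ess_supr_bounded _ _ _ (@leb R) (fun t => `|(f \_ `[0%R, 1%R]) t|) h.
  exists M.
  (* The restriction of f vanishes off [0,1], so its bound can be transported only if M is
     nonnegative; for M < 0 every point would be exceptional and the whole line would be a null
     set. *)
  have [M0|M0] := leP 0 M; last first.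
    exfalso; have [A [mA A0 sA]] := hM; move: A0; apply/eqP; rewrite gt_eqF//.
    apply: lt_le_trans mT _; apply: le_measure; rewrite ?inE// => t _.
    by apply: sA => /= /(le_trans (normr_ge0 _)); rewrite leNgt M0.
  by apply/(ae01_restr (Q := fun x => `|x| <= M)) => //=; rewrite normr0.
- have hM' : ae01 (fun t => `|f t| <= `|M|).
    by apply: ae01_mono hM => t _ h; rewrite (le_trans h) ?ler_norm.
  apply: (@le_lt_trans _ _ (`|M|%:E)); last exact: ltry.
  apply/ess_supP; have := ae01_restr (Q := fun x => `|x| <= `|M|) f.
  by rewrite normr0 => /(_ (normr_ge0 _)) [_ /(_ hM')].
Qed.

(** The two exponents in use: 2 for the domain of the operator, infinity for its coefficients. *)
Definition exponent_ok (q : \bar R) := q = 2%:E \/ q = +oo%E.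

Lemma L01_meas q f : L01 q f -> measurable_fun `[(0 : R), 1] f.
Proof. by case. Qed.

Lemma sqr_integrable01_mul f g : measurable_fun `[(0 : R), 1] f ->
  measurable_fun `[(0 : R), 1] g -> integrable01 (fun t => f t ^+ 2) ->
  integrable01 (fun t => g t ^+ 2) -> integrable01 (fun t => f t * g t).
Proof.
move=> mf mg f2 g2; apply: (integrable01_dom _ (integrable01D f2 g2)).
  exact: measurable_funM.
move=> t _; rewrite ler_norml; apply/andP; split; nra.
Qed.

Lemma L2_mul f g : L01 2%:E f -> L01 2%:E g -> integrable01 (fun t => f t * g t).
Proof. by move=> /L2P[mf f2] /L2P[mg g2]; exact: sqr_integrable01_mul. Qed.

(** The essential bound holds only almost everywhere; clipping f at plus and minus max(M, 0) gives a
    representative for which the domination by a multiple of |g| is pointwise. *)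
Lemma Loo_integrable01_mul f g : L01 +oo%E f -> integrable01 g ->
  integrable01 (fun t => f t * g t).
Proof.
move=> /LooP[mf [M hM]] hg; have mg := integrable01_meas hg.
have M0 : 0 <= Num.max M 0 by rewrite le_max lexx orbT.
pose f' t := Num.min (Num.max M 0) (Num.max (- Num.max M 0) (f t)).
have mf' : measurable_fun `[(0:R), 1] f'.
  by apply: measurable_minr => //; exact: measurable_maxr.
have f'b t : `|f' t| <= Num.max M 0.
  rewrite ler_norml /f'; apply/andP; split; last by rewrite ge_min lexx.
  by rewrite le_min ge0_cp //= le_max lexx.
apply: (@integrable01_ae (fun t => f' t * g t)).
- exact: measurable_funM.
- apply: ae01_mono hM => t _ ft; congr (_ * _).
  have : `|f t| <= Num.max M 0 by rewrite (le_trans ft)// le_max lexx.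
  by rewrite ler_norml /f' => /andP[/max_idPr -> /min_idPr].
- apply: (@integrable01_dom _ (fun t => Num.max M 0 * `|g t|)).
  + exact: measurable_funM.
  + by apply: integrable01Z; exact: integrable_norm.
  + by move=> t _; rewrite normrM ler_wpM2r.
Qed.

Lemma LooM q f g : exponent_ok q -> L01 +oo%E f -> L01 q g -> L01 q (fun t => f t * g t).
Proof.
case=> -> /[dup] /LooP[mf [M hM]] Lf.
- move=> /L2P[mg g2]; apply/L2P; split; first exact: measurable_funM.
  apply: (@eq_integrable01 (fun t => f t * (f t * g t ^+ 2))).
    by move=> t _; ring.
  by do 2 apply: Loo_integrable01_mul => //.
- move=> /LooP[mg [N hN]]; apply/LooP; split; first exact: measurable_funM.
  exists (M * N); apply: ae01_mono (ae01_and hM hN) => t _ [h1 h2].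
  by rewrite normrM ler_pM.
Qed.

Lemma L01D q f g : exponent_ok q -> L01 q f -> L01 q g -> L01 q (fun t => f t + g t).
Proof.
case=> ->.
- move=> /[dup] /L2P[mf f2] Lf /[dup] /L2P[mg g2] Lg.
  apply/L2P; split; first exact: measurable_funD.
  apply: (@eq_integrable01 (fun t => f t ^+ 2 + (g t ^+ 2 + 2 * (f t * g t)))).
    by move=> t _; ring.
  by do 2 apply: integrable01D => //; apply: integrable01Z; exact: L2_mul.
- move=> /LooP[mf [M hM]] /LooP[mg [N hN]]; apply/LooP; split.
    exact: measurable_funD.
  exists (M + N); apply: ae01_mono (ae01_and hM hN) => t _ [h1 h2].
  by rewrite (le_trans (ler_normD _ _))// lerD.
Qed.

Lemma L01_bounded q f (M : R) : exponent_ok q -> measurable_fun `[(0 : R), 1] f ->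
  (forall t, 0 <= t <= 1 -> `|f t| <= M) -> L01 q f.
Proof.
case=> -> mf hM; last by apply/LooP; split => //; exists M; exact: ae01W.
apply/L2P; split => //; apply: (@integrable01_dom _ (fun=> M ^+ 2)).
- exact: measurable_funX.
- exact: integrable01_cst.
- move=> t /hM h; rewrite normrX; apply: lerXn2r => //; rewrite nnegrE //.
  exact: le_trans h.
Qed.

Lemma L01_cst q (c : R) : exponent_ok q -> L01 q (fun=> c).
Proof. by move=> hq; apply: (@L01_bounded _ _ `|c|). Qed.

Lemma L01Z q a f : exponent_ok q -> L01 q f -> L01 q (fun t => a * f t).
Proof. by move=> hq; apply: LooM => //; apply: L01_cst; right. Qed.

Lemma L01_ae q f g : exponent_ok q -> measurable_fun `[(0 : R), 1] g ->
  ae01 (fun t => f t = g t) -> L01 q f -> L01 q g.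
Proof.
case=> -> mg fg.
- move=> /L2P[mf f2]; apply/L2P; split => //; apply: integrable01_ae f2.
    exact: measurable_funX.
  by apply: ae01_mono fg => t _ ->.
- move=> /LooP[mf [M hM]]; apply/LooP; split => //; exists M.
  by apply: ae01_mono (ae01_and fg hM) => t _ [<-].
Qed.

Lemma eq_L01 q f g : exponent_ok q ->
  (forall t, 0 <= t <= 1 -> f t = g t) -> L01 q f -> L01 q g.
Proof.
move=> hq fg Lf; apply: (L01_ae hq _ _ Lf); last exact: ae01W.
apply: eq_measurable_fun (L01_meas Lf) => t; rewrite inE /= in_itv /=.
exact: fg.
Qed.

Lemma L01_integrable q f : exponent_ok q -> L01 q f -> integrable01 f.
Proof.
move=> [->|->] Lf.
- apply: (@eq_integrable01 (fun t => f t * 1)); first by move=> t _; rewrite mulr1.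
  by apply: L2_mul => //; apply: L01_cst; left.
- apply: (@eq_integrable01 (fun t => f t * 1)); first by move=> t _; rewrite mulr1.
  by apply: Loo_integrable01_mul => //; exact: integrable01_cst.
Qed.

Lemma L01_continuous q f : exponent_ok q -> {within `[0, 1], continuous f} -> L01 q f.
Proof.
move=> hq cf; have mf : measurable_fun `[(0:R), 1] f.
  exact: subspace_continuous_measurable_fun.
have cnf : {within `[(0:R), 1], continuous (fun x => `|f x|)}.
  by move=> x; apply: continuous_comp; [exact: cf|exact: norm_continuous].
have [x _ hx] := EVT_max ler01 cnf.
by apply: (@L01_bounded _ _ `|f x|).
Qed.

End unit_interval.

(** * Fubini's theorem for real-valued integrals on measurable rectangles *)

Section fubini.
Context d1 d2 (T1 : measurableType d1) (T2 : measurableType d2) (R : realType).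
Variables (m1 : {sigma_finite_measure set T1 -> \bar R}).
Variables (m2 : {sigma_finite_measure set T2 -> \bar R}).
Variables (D1 : set T1) (D2 : set T2) (K : T1 * T2 -> R).
Hypotheses (mD1 : measurable D1) (mD2 : measurable D2).
Hypothesis mK : measurable_fun (D1 `*` D2) K.

Lemma measurable_section1 x : D1 x -> measurable_fun D2 (fun y => K (x, y)).
Proof.
move=> D1x; apply: (measurable_comp (F := D1 `*` D2) (f := K) (g := pair x)) => //.
- exact: measurableX.
- by move=> _ [y D2y <-].
- exact: measurable_funTS (pair1_measurable _).
Qed.

Lemma measurable_section2 y : D2 y -> measurable_fun D1 (fun x => K (x, y)).
Proof.
move=> D2y; apply: (measurable_comp (F := D1 `*` D2) (f := K) (g := pair^~ y)) => //.
- exact: measurableX.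
- by move=> _ [x D1x <-].
- exact: measurable_funTS (pair2_measurable _).
Qed.

Let f := EFin \o (K \_ (D1 `*` D2)).

Let mf : measurable_fun setT f.
Proof.
apply/measurable_EFinP; apply/(measurable_restrictT _ _).1 => //.
exact: measurableX.
Qed.

Let fE1 x y : D1 x -> f (x, y) = (((fun y => K (x, y)) \_ D2) y)%:E.
Proof.
move=> D1x; rewrite /f /= !patchE; congr EFin.
have [D2y|D2y] := pselect (D2 y); last first.
  by rewrite !memNset // => -[].
by rewrite !mem_set.
Qed.

Let fE2 x y : D2 y -> f (x, y) = (((fun x => K (x, y)) \_ D1) x)%:E.
Proof.
move=> D2y; rewrite /f /= !patchE; congr EFin.
have [D1x|D1x] := pselect (D1 x); last first.
  by rewrite !memNset // => -[].
by rewrite !mem_set.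
Qed.

Let F x : (\int[m2]_y f (x, y))%E =
  (((fun x => \int[m2]_(y in D2) (K (x, y))%:E) \_ D1) x)%E.
Proof.
rewrite patchE; case: ifPn => [/set_mem D1x|/negP D1x].
  by rewrite [RHS]integral_mkcond; apply: eq_integral => y _; rewrite fE1// !patchE; case: ifP.
apply: integral0_eq => y _; rewrite /f /= patchE memNset // => -[D1x' _].
by apply: D1x; rewrite inE.
Qed.

Let G y : (\int[m1]_x f (x, y))%E =
  (((fun y => \int[m1]_(x in D1) (K (x, y))%:E) \_ D2) y)%E.
Proof.
rewrite patchE; case: ifPn => [/set_mem D2y|/negP D2y].
  by rewrite [RHS]integral_mkcond; apply: eq_integral => x _; rewrite fE2// !patchE; case: ifP.
apply: integral0_eq => x _; rewrite /f /= patchE memNset // => -[_ D2y'].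
by apply: D2y; rewrite inE.
Qed.

Let Fabs x : (\int[m2]_y `|f (x, y)|)%E =
  (((fun x => \int[m2]_(y in D2) `|K (x, y)|%:E) \_ D1) x)%E.
Proof.
rewrite patchE; case: ifPn => [/set_mem D1x|/negP D1x].
  rewrite [RHS]integral_mkcond; apply: eq_integral => y _; rewrite fE1// !patchE.
  by case: ifPn; rewrite //= normr0.
apply: integral0_eq => y _; rewrite /f /= patchE memNset ?normr0 // => -[D1x' _].
by apply: D1x; rewrite inE.
Qed.

Lemma measurable_abs_fubini1 :
  measurable_fun D1 (fun x => (\int[m2]_(y in D2) `|K (x, y)|%:E)%E).
Proof.
apply/(measurable_restrictT _ mD1).2.
apply: (eq_measurable_fun (fun x => \int[m2]_y `|f (x, y)|)%E).
  by move=> x _; exact: Fabs.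
apply: (measurable_fun_fubini_tonelli_F (abse \o f)).
  by apply: measurableT_comp.
by move=> z; exact: abse_ge0.
Qed.

Let Gabs y : (\int[m1]_x `|f (x, y)|)%E =
  (((fun y => \int[m1]_(x in D1) `|K (x, y)|%:E) \_ D2) y)%E.
Proof.
rewrite patchE; case: ifPn => [/set_mem D2y|/negP D2y].
  rewrite [RHS]integral_mkcond; apply: eq_integral => x _; rewrite fE2// !patchE.
  by case: ifPn; rewrite //= normr0.
apply: integral0_eq => x _; rewrite /f /= patchE memNset ?normr0 // => -[_ D2y'].
by apply: D2y; rewrite inE.
Qed.

Lemma measurable_abs_fubini2 :
  measurable_fun D2 (fun y => (\int[m1]_(x in D1) `|K (x, y)|%:E)%E).
Proof.
apply/(measurable_restrictT _ mD2).2.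
apply: (eq_measurable_fun (fun y => \int[m1]_x `|f (x, y)|)%E).
  by move=> y _; exact: Gabs.
apply: (measurable_fun_fubini_tonelli_G (abse \o f)).
  by apply: measurableT_comp.
by move=> z; exact: abse_ge0.
Qed.

Lemma abs_fubini_tonelli :
  (\int[m1]_(x in D1) \int[m2]_(y in D2) `|K (x, y)|%:E =
   \int[m2]_(y in D2) \int[m1]_(x in D1) `|K (x, y)|%:E)%E.
Proof.
rewrite integral_mkcond [RHS]integral_mkcond.
rewrite -(eq_integral _ _ (fun x _ => Fabs x)) -(eq_integral _ _ (fun y _ => Gabs y)).
by apply: (fubini_tonelli (abse \o f)) => [|z]; [exact: measurableT_comp|exact: abse_ge0].
Qed.

Hypothesis bK : (\int[m1]_(x in D1) \int[m2]_(y in D2) `|K (x, y)|%:E < +oo)%E.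

Let intf : (m1 \x m2)%E.-integrable setT f.
Proof.
apply/integrable12ltyP => //; apply: le_lt_trans bK.
rewrite [leRHS]integral_mkcond.
by rewrite le_eqVlt; apply/orP; left; apply/eqP; apply: eq_integral => x _; exact: Fabs.
Qed.

Let intF : m1.-integrable D1 (fun x => \int[m2]_(y in D2) (K (x, y))%:E)%E.
Proof.
have h := integrable_fubini_F intf.
by apply/integrable_mkcond => //; apply: eq_integrable h => // x _; exact: F.
Qed.

Let intG : m2.-integrable D2 (fun y => \int[m1]_(x in D1) (K (x, y))%:E)%E.
Proof.
have h : m2.-integrable setT (fun y => \int[m1]_x f (x, y))%E.
  apply/integrableP; split; first exact: (measurable_fubini_G intf).
  apply: le_lt_trans ((integrable21ltyP m1 m2 mf).1 intf).
  apply: ge0_le_integral => //.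
  - by apply: measurableT_comp => //; exact: (measurable_fubini_G intf).
  - apply: (measurable_fun_fubini_tonelli_G (abse \o f)).
      by apply: measurableT_comp.
    by move=> z; exact: abse_ge0.
  - by move=> y _; apply: le_abse_integral => //; exact: measurableT_comp.
by apply/integrable_mkcond => //; apply: eq_integrable h => // x _; exact: G.
Qed.

(** An inner integral is finite only almost everywhere; [fine] sends its infinite values to 0 on a
    null set, which alters neither integrability nor the integral. *)
Let fineF d (T : measurableType d) (m : {measure set T -> \bar R}) (D : set T) (g : T -> \bar R) :
  measurable D -> m.-integrable D g ->
  m.-integrable D (EFin \o fine \o g) /\
  (\int[m]_(x in D) (fine (g x))%:E = \int[m]_(x in D) g x)%E.
Proof.
move=> mD ig; have mg : measurable_fun D (EFin \o fine \o g).
  by apply/measurable_EFinP; apply: measurableT_comp => //; exact: measurable_int ig.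
have ae : ae_eq m D g (EFin \o fine \o g).
  apply: filterS (integrable_ae mD ig) => x h Dx /=.
  by rewrite fineK// h.
split; last by symmetry; apply: ae_eq_integral => //; exact: measurable_int ig.
move/integrableP: (ig) => [_ fi]; apply/integrableP; split => //.
suff <- : (\int[m]_(x in D) `|g x| = \int[m]_(x in D) `|(EFin \o fine \o g) x|)%E by [].
apply: ae_eq_integral => //.
- by apply: measurableT_comp => //; exact: measurable_int ig.
- exact: measurableT_comp.
- by apply: filterS ae => x h /h /= {1}->.
Qed.

Lemma Rintegral_integrable1 :
  m1.-integrable D1 (EFin \o fun x => \int[m2]_(y in D2) K (x, y)).
Proof. exact: (fineF mD1 intF).1. Qed.

Lemma Rintegral_integrable2 :
  m2.-integrable D2 (EFin \o fun y => \int[m1]_(x in D1) K (x, y)).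
Proof. exact: (fineF mD2 intG).1. Qed.

Lemma Rintegral_fubini :
  \int[m1]_(x in D1) (\int[m2]_(y in D2) K (x, y)) =
  \int[m2]_(y in D2) (\int[m1]_(x in D1) K (x, y)).
Proof.
congr fine; rewrite (fineF mD1 intF).2 (fineF mD2 intG).2.
have := Fubini intf; rewrite (eq_integral _ _ (fun x _ => F x)).
by rewrite (eq_integral _ _ (fun y _ => G y)) -!integral_mkcond.
Qed.
End fubini.

Section unit_square.
Context {R : realType}.
Implicit Types (K : R -> R -> R) (a b : R -> R).

(** A majorant in product form makes the iterated integral of |K| finite at once. It fits both uses:
    a product of densities cut along the diagonal, and a bounded kernel times an integrable
    function. *)
Lemma fubini01 K a b :
  measurable_fun (`[(0 : R), 1] `*` `[(0 : R), 1]) (fun z : R * R => K z.1 z.2) ->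
  integrable01 a -> integrable01 b ->
  (forall x y, 0 <= x <= 1 -> 0 <= y <= 1 -> `|K x y| <= a x * b y) ->
  [/\ integrable01 (fun x => int01 (K x)), integrable01 (fun y => int01 (K^~ y)) &
  int01 (fun x => int01 (K x)) = int01 (fun y => int01 (K^~ y))].
Proof.
move=> mK ia ib hK.
have fin : (\int[@leb R]_(x in `[0%R, 1%R]) \int[@leb R]_(y in `[0%R, 1%R]) `|K x y|%:E < +oo)%E.
  apply: (@le_lt_trans _ _ (\int[@leb R]_(x in `[0%R, 1%R]) (`|a x| * int01 (fun y => `|b y|))%:E))%E.
    have ib' := integrable_norm ib.
    have a0 x : (0 <= (`|a x| * int01 (fun y => `|b y|))%:E)%E.
      by rewrite lee_fin mulr_ge0 //; exact: Rintegral_ge0.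
    apply: ge0_le_integral => //.
    - by move=> x _; exact: integral_ge0.
    - exact: (@measurable_abs_fubini1 _ _ _ _ _ (@leb R) _ _ (fun z : R * R => K z.1 z.2) _ _ mK).
    - apply/measurable_EFinP; apply: measurable_funM => //.
      by apply: measurableT_comp => //; exact: integrable01_meas.
    - move=> x; rewrite /= in_itv /= => x01.
      apply: (@le_trans _ _ (\int[@leb R]_(y in `[0%R, 1%R]) (`|a x| * `|b y|)%:E)%E).
        apply: ge0_le_integral => //.
        + apply/measurable_EFinP; apply: measurableT_comp => //.
          by apply: (@measurable_section1 _ _ _ _ _ _ _ (fun z : R * R => K z.1 z.2) _ _ mK); rewrite /= ?in_itv.
        + apply/measurable_EFinP; apply: measurable_funM => //.
          by apply: measurableT_comp => //; exact: integrable01_meas.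
        + move=> y; rewrite /= in_itv /= => y01; rewrite lee_fin -normrM.
          exact: le_trans (hK _ _ x01 y01) (ler_norm _).
      rewrite /int01 -RintegralZl // /Rintegral fineK //.
      by apply: integrable_fin_num => //; exact: integrable01Z.
  have /integrableP[_] : integrable01 (fun x => `|a x| * int01 (fun y => `|b y|)).
    apply: (@eq_integrable01 _ (fun x => int01 (fun y => `|b y|) * `|a x|)).
      by move=> t _; rewrite mulrC.
    by apply: integrable01Z; exact: integrable_norm.
  apply: le_lt_trans; rewrite le_eqVlt; apply/orP; left; apply/eqP.
  apply: eq_integral => x _.
  have h0 : 0 <= `|a x| * int01 (fun y => `|b y|).
    by rewrite mulr_ge0 //; exact: Rintegral_ge0.
  by rewrite /= (ger0_norm h0).
split.
- exact: (@Rintegral_integrable1 _ _ _ _ _ (@leb R) (@leb R) _ _ (fun z : R * R => K z.1 z.2) _ _ mK fin).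
- exact: (@Rintegral_integrable2 _ _ _ _ _ (@leb R) (@leb R) _ _ (fun z : R * R => K z.1 z.2) _ _ mK fin).
- exact: (@Rintegral_fubini _ _ _ _ _ (@leb R) (@leb R) _ _ (fun z : R * R => K z.1 z.2) _ _ mK fin).
Qed.
End unit_square.

(** * Absolutely continuous functions and weak derivatives *)

Section primitive.
Context {R : realType}.
Implicit Types (f g h F H : R -> R) (t s : R).

Definition prim g t : R := \int[leb]_(x in `[0, t]) g x.

(** Absolute continuity with a prescribed density, in exactly the integral form that [sobolev]
    demands; pointwise differentiability is derived from it. *)
Definition AC01 f g := forall t, 0 <= t <= 1 -> f t = f 0 + prim g t.

Lemma sub01 t : t <= 1 -> `[0, t] `<=` `[(0 : R), 1].
Proof. by move=> t1; apply: subset_itvl; rewrite bnd_simp. Qed.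

Lemma integrable_prim g t : t <= 1 -> integrable01 g ->
  (@leb R).-integrable `[0, t] (EFin \o g).
Proof. by move=> t1; apply: integrableS => //; exact: sub01. Qed.

Lemma prim0 g : prim g 0 = 0.
Proof. by rewrite /prim set_itv1 Rintegral_set1. Qed.

Lemma prim1 g : prim g 1 = int01 g.
Proof. by []. Qed.

Lemma prim_int01 g t : t <= 1 -> prim g t = int01 (g \_ `[0, t]).
Proof.
by move=> t1; rewrite /int01 -Rintegral_mkcondr setIidr //; exact: sub01.
Qed.

Lemma primD f g t : t <= 1 -> integrable01 f -> integrable01 g ->
  prim (fun x => f x + g x) t = prim f t + prim g t.
Proof. by move=> t1 hf hg; apply: RintegralD => //; exact: integrable_prim. Qed.

Lemma primZ a f t : t <= 1 -> integrable01 f ->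
  prim (fun x => a * f x) t = a * prim f t.
Proof. by move=> t1 hf; apply: RintegralZl => //; exact: integrable_prim. Qed.

Lemma eq_prim f g t : t <= 1 -> (forall x, 0 <= x <= t -> f x = g x) ->
  prim f t = prim g t.
Proof. by move=> t1 fg; apply: eq_Rintegral => x; rewrite inE /= in_itv /=; exact: fg. Qed.

Lemma prim_ae f g t : t <= 1 -> measurable_fun `[(0:R), 1] f ->
  measurable_fun `[(0:R), 1] g ->
  ae01 (fun x => f x = g x) -> prim f t = prim g t.
Proof.
move=> t1 mf mg fg; congr fine; apply: ae_eq_integral => //.
- by apply/measurable_EFinP; apply: measurable_funS mf => //; exact: sub01.
- by apply/measurable_EFinP; apply: measurable_funS mg => //; exact: sub01.
- by apply: ae_mono fg => x h /(sub01 t1) /=; rewrite in_itv /= => /h ->.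
Qed.

Lemma prim_continuous g : integrable01 g -> {within `[0, 1], continuous (prim g)}.
Proof. by move=> ig; exact: (parameterized_integral_continuous ler01). Qed.

Lemma AC_continuous f g : integrable01 g -> AC01 f g -> {within `[0, 1], continuous f}.
Proof.
move=> ig fg; apply: (@subspace_eq_continuous _ _ _ (fun t => f 0 + prim g t)).
  by move=> t; rewrite inE /= in_itv /= => /fg.
move=> x; apply: cvgD; first exact: cvg_cst.
exact: prim_continuous.
Qed.

Lemma AC_near f g t : 0 < t < 1 -> AC01 f g ->
  \forall x \near t, f x = f 0 + prim g x.
Proof.
move=> t01 fg; have : t \in `]0, 1[ by rewrite in_itv.
move/near_in_itvoo; apply: filterS => x; rewrite in_itv /= => /andP[x0 x1].
by apply: fg; rewrite !ltW.
Qed.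

Lemma AC_derivable_lebesgue_pt f g t : 0 < t < 1 -> integrable01 g -> AC01 f g ->
  lebesgue_pt g t -> derivable f t 1 /\ derive1 f t = g t.
Proof.
move=> t01 ig fg gt; have /andP[t0 t1] := t01.
have at0 : (BLeft (0%R : R) < BRight t)%E.
  by rewrite lte_fin.
have [] := @FTC1_lebesgue_pt _ g (BLeft 0) t 1 t1 ig at0 gt.
rewrite -/(prim g) => d e.
have dc : derivable (fun=> f 0 : R) t 1 by exact: derivable_cst.
have d' : derivable (fun x => f 0 + prim g x) t 1 := derivableD dc d.
have nr := AC_near t01 fg; split.
  by apply: near_eq_derivable d'; apply: filterS nr => x ->.
rewrite -e !derive1E (near_eq_derive _ nr).
by have := deriveD dc d; rewrite derive_cst add0r.
Qed.

Lemma AC_derivable f g t : 0 < t < 1 -> integrable01 g -> AC01 f g ->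
  {within `[0, 1], continuous g} -> derivable f t 1 /\ derive1 f t = g t.
Proof.
move=> t01 ig fg cg; apply: (AC_derivable_lebesgue_pt t01 ig fg).
have tin : t \in `]0, 1[ by rewrite in_itv.
have /(continuous_within_itvP _ ltr01)[+ _ _] := cg => /(_ _ tin) cgt.
apply: (@continuous_lebesgue_pt _ g t `]0, 1[) => //.
by apply: measurable_funS (integrable01_meas ig) => // x /=; exact: subset_itv_oo_cc.
Qed.

Lemma AC_derivable_ae f g : integrable01 g -> AC01 f g ->
  ae01 (fun t => derivable f t 1 /\ derive1 f t = g t).
Proof.
move=> ig fg.
(* Extending g by zero makes it locally integrable on the whole line, as the Lebesgue
   differentiation theorem requires. *)
have loc := @integrable_locally_restrict _ g `[0, 1] (measurable_itv _) ig.
have ig' : integrable01 (g \_ `[(0:R), 1]).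
  apply: eq_integrable01 ig => t t01; rewrite patchE mem_set //= in_itv //.
have fg' : AC01 f (g \_ `[(0:R), 1]).
  move=> t t01; rewrite (fg _ t01); congr (_ + _); apply: eq_prim.
    by case/andP: t01.
  move=> x /andP[x0 xt]; rewrite patchE mem_set //= in_itv /= x0 (le_trans xt) //.
  by case/andP: t01.
apply: (@ae01_oo_mono _ (fun t => lebesgue_pt (g \_ `[(0:R), 1]) t)).
  move=> t t01 /(AC_derivable_lebesgue_pt t01 ig' fg') [d ->]; split => //.
  by rewrite patchE mem_set //= in_itv /=; case/andP: t01 => /ltW -> /ltW ->.
by apply: ae_mono (lebesgue_differentiation loc) => t h _.
Qed.

Lemma ACD f g F G : integrable01 g -> integrable01 G -> AC01 f g -> AC01 F G ->
  AC01 (fun t => f t + F t) (fun t => g t + G t).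
Proof.
move=> ig iG fg FG t t01; rewrite (fg _ t01) (FG _ t01) primD //; last by case/andP: t01.
by rewrite addrACA.
Qed.

Lemma ACZ a f g : integrable01 g -> AC01 f g -> AC01 (fun t => a * f t) (fun t => a * g t).
Proof.
move=> ig fg t t01; rewrite (fg _ t01) primZ //; last by case/andP: t01.
by rewrite mulrDr.
Qed.

Lemma eq_AC f g F G : (forall t, 0 <= t <= 1 -> f t = F t) ->
  (forall t, 0 <= t <= 1 -> g t = G t) -> AC01 f g -> AC01 F G.
Proof.
move=> fF gG fg t t01; rewrite -fF // -fF ?lexx ?ler01 // fg //; congr (_ + _).
apply: eq_prim; first by case/andP: t01.
move=> x /andP[x0 xt]; apply: gG; rewrite x0 (le_trans xt) //.
by case/andP: t01.
Qed.

Lemma ae01_neq (c : R) : ae01 (fun t => t != c).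
Proof.
exists [set c]; split => //; first exact: lebesgue_measure_set1.
by move=> t /= /not_implyP[_ /negP/negPn/eqP].
Qed.

Lemma integrable01_restr (a : R -> R) (E : set R) : measurable E -> integrable01 a ->
  integrable01 (a \_ E).
Proof.
move=> mE ia; rewrite /integrable01 -restrict_EFin.
apply/integrable_restrict => //; apply: integrableS ia => //.
exact: measurableI.
Qed.

Lemma restr_in (a : R -> R) (E : set R) x : E x -> (a \_ E) x = a x.
Proof. by move=> Ex; rewrite patchE mem_set. Qed.

Lemma restr_notin (a : R -> R) (E : set R) x : ~ E x -> (a \_ E) x = 0.
Proof. by move=> Ex; rewrite patchE memNset. Qed.

(** The product of the two integrals is the integral of a(x) b(y) over the square, which the
    diagonal splits into two triangles; each term on the left is one of them, integrated by
    slices. *)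
Lemma int01_diagonal a b : integrable01 a -> integrable01 b ->
  int01 (fun x => a x * prim b x) + int01 (fun y => prim a y * b y)
    = int01 a * int01 b.
Proof.
move=> ia ib.
pose K (x y : R) : R := if y <= x then a x * b y else 0.
have mK : measurable_fun (`[(0 : R), 1] `*` `[(0 : R), 1]) (fun z : R * R => K z.1 z.2).
  have m1 : measurable_fun (`[(0 : R), 1] `*` `[(0 : R), 1]) (fun z : R * R => a z.1).
    apply: (measurable_comp (F := `[(0 : R), 1])) (integrable01_meas ia) _ => //.
      by move=> _ [[x y] [/= x01 _] <-].
    exact: measurable_funTS measurable_fst.
  have m2 : measurable_fun (`[(0 : R), 1] `*` `[(0 : R), 1]) (fun z : R * R => b z.2).
    apply: (measurable_comp (F := `[(0 : R), 1])) (integrable01_meas ib) _ => //.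
      by move=> _ [[x y] [/= _ y01] <-].
    exact: measurable_funTS measurable_snd.
  have mX : measurable (`[(0 : R), 1] `*` `[(0 : R), 1]) by exact: measurableX.
  apply: measurable_fun_if => //.
  - apply: measurable_fun_ler; apply: measurable_funTS; [exact: measurable_snd|exact: measurable_fst].
  - apply: (@measurable_funS _ _ _ _ (`[(0 : R), 1] `*` `[(0 : R), 1])) => //.
    exact: measurable_funM.
have hK x y : `|K x y| <= `|a x| * `|b y|.
  by rewrite /K -normrM; case: ifP => // _; rewrite normr0.
have [i1 i2 E] := fubini01 mK (integrable_norm ia) (integrable_norm ib) (fun x y _ _ => hK x y).
have E1 x : 0 <= x <= 1 -> int01 (K x) = a x * prim b x.
  move=> /andP[x0 x1]; rewrite prim_int01 // -int01Z; last exact: integrable01_restr.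
  apply: eq_int01 => y /andP[y0 y1]; rewrite /K; case: ifPn => yx.
    by rewrite restr_in //= in_itv /= y0.
  by rewrite restr_notin ?mulr0 //= in_itv /= y0 /=; apply/negP.
have E2 y : 0 <= y <= 1 -> int01 (K^~ y) = b y * int01 a - prim a y * b y.
  move=> /andP[y0 y1]; have ir := @integrable01_restr a `[0, y] (measurable_itv _) ia.
  rewrite (prim_int01 a y1) [X in _ - X]mulrC -mulrBr -int01B // -int01Z; last first.
    exact: integrable01B.
  apply: int01_ae.
  - have := integrable01_meas ia => ma.
    apply: measurable_fun_if => //.
      by apply: measurable_fun_ler.
    by apply: measurable_funM => //; apply: measurable_funS ma.
  - by apply: measurable_funM => //; apply: measurable_funB; exact: integrable01_meas.
  (* The point x = y belongs to both triangles, so the equality holds only almost everywhere in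
     x. *)
  apply: ae01_mono (ae01_neq y) => x /andP[x0 x1] xy; rewrite /K; case: ifPn => yx.
    rewrite restr_notin ?subr0; first by rewrite mulrC.
    by rewrite /= in_itv /= x0 /=; apply/negP; rewrite -ltNge lt_neqAle eq_sym xy.
  by rewrite restr_in ?subrr ?mulr0 //= in_itv /= x0 /= ltW // ltNge.
rewrite -(eq_int01 E1) E (eq_int01 E2) -int01D.
- rewrite [RHS]mulrC -[RHS]mulrC -int01Z //; apply: eq_int01 => t _.
  by rewrite subrK mulrC.
- exact: eq_integrable01 E2 i2.
- apply: (@eq_integrable01 _ (fun y => b y * int01 a - int01 (K^~ y))).
    by move=> y y01; rewrite E2 // opprB addrC subrK.
  apply: integrable01B => //; apply: (@eq_integrable01 _ (fun y => int01 a * b y)).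
    by move=> y _; rewrite mulrC.
  exact: integrable01Z.
Qed.

(** With f = f(0) + prim g and F = F(0) + prim G inserted, the linear terms are immediate and the
    quadratic one is [int01_diagonal] for the densities cut off at t. *)
Lemma AC_mul f g F G : integrable01 g -> integrable01 G -> AC01 f g -> AC01 F G ->
  AC01 (fun t => f t * F t) (fun t => g t * F t + f t * G t).
Proof.
move=> ig iG fg FG t t01; have /andP[t0 t1] := t01.
have cf := AC_continuous ig fg; have cF := AC_continuous iG FG.
have hoo : exponent_ok (+oo%E : \bar R) by right.
have mulF h : integrable01 h -> integrable01 (fun t => h t * F t).
  move=> ih; apply: (@eq_integrable01 _ (fun t => F t * h t)); first by move=> x _; rewrite mulrC.
  by apply: Loo_integrable01_mul => //; exact: L01_continuous.
have mulf h : integrable01 h -> integrable01 (fun t => f t * h t).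
  by move=> ih; apply: Loo_integrable01_mul => //; exact: L01_continuous.
rewrite primD //; [|exact: mulF|exact: mulf].
pose g' := g \_ `[0, t]; pose G' := G \_ `[0, t].
have ig' : integrable01 g' by exact: integrable01_restr.
have iG' : integrable01 G' by exact: integrable01_restr.
have in1 x : 0 <= x <= t -> `[0, t]%classic x by rewrite /= in_itv.
have out1 x : 0 <= x <= 1 -> ~~ (x <= t) -> ~ (`[0, t]%classic x).
  by move=> /andP[x0 _] xt /=; rewrite in_itv /= x0 /=; apply/negP.
have pE (h : R -> R) x : x <= t -> prim (h \_ `[0, t]) x = prim h x.
  move=> xt; apply: eq_prim => [|y /andP[y0 yx]]; first exact: le_trans t1.
  by rewrite restr_in //; apply: in1; rewrite y0 (le_trans yx).
have cut (h k k' : R -> R) : (forall x, 0 <= x <= t -> k x = k' x) ->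
    prim (fun x => h x * k x) t = int01 (fun x => (h \_ `[0, t]) x * k' x).
  move=> kk; rewrite prim_int01 //; apply: eq_int01 => x x01.
  have [xt|xt] := boolP (x <= t).
    have x0t : 0 <= x <= t by case/andP: x01 => ->.
    by rewrite !restr_in ?kk //; exact: in1.
  by rewrite !restr_notin ?mul0r //; exact: out1.
have cpg := prim_continuous ig'; have cpG := prim_continuous iG'.
have E1 : prim (fun x => g x * F x) t = F 0 * prim g t + int01 (fun x => g' x * prim G' x).
  rewrite (@cut g F (fun x => F 0 + prim G' x)); last first.
    move=> x /andP[x0 xt]; rewrite pE // FG // x0 (le_trans xt) //.
  under eq_int01 do rewrite mulrDr.
  rewrite int01D ?(prim_int01 g t1) -?int01Z //.
  - by congr (_ + _); apply: eq_int01 => x _; rewrite mulrC.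
  - by apply: (@eq_integrable01 _ (fun x => F 0 * g' x)); [move=> x _; rewrite mulrC|exact: integrable01Z].
  - apply: (@eq_integrable01 _ (fun x => prim G' x * g' x)); first by move=> x _; rewrite mulrC.
    by apply: Loo_integrable01_mul => //; exact: L01_continuous.
have E2 : prim (fun x => f x * G x) t = f 0 * prim G t + int01 (fun x => prim g' x * G' x).
  have -> : prim (fun x => f x * G x) t = prim (fun x => G x * f x) t.
    by apply: eq_prim => // x _; rewrite mulrC.
  rewrite (@cut G f (fun x => f 0 + prim g' x)); last first.
    move=> x /andP[x0 xt]; rewrite pE // fg // x0 (le_trans xt) //.
  under eq_int01 do rewrite mulrC mulrDl.
  rewrite int01D ?(prim_int01 G t1) -?int01Z //; first exact: integrable01Z.
  by apply: Loo_integrable01_mul => //; exact: L01_continuous.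
have := int01_diagonal ig' iG'; rewrite -[int01 g']prim1 -[int01 G']prim1.
have -> : prim g' 1 = prim g t by rewrite prim1 prim_int01.
have -> : prim G' 1 = prim G t by rewrite prim1 prim_int01.
rewrite E1 E2 fg // FG //; set x := int01 _; set y := int01 _ => xy.
have -> : y = prim g t * prim G t - x by rewrite -xy addrC addKr.
ring.
Qed.

End primitive.

(** * Lists of weak derivatives and the Leibniz rule *)

Section weak_derivatives.
Context {R : realType}.
Implicit Types (f u : R -> R) (P G g h : nat -> R -> R) (q : \bar R).

(* The i-th derivative of the product P m * G n when P j.+1 and G j.+1 are the
   derivatives of P j and G j. *)
Fixpoint Leib (P G : nat -> R -> R) (i m n : nat) : R -> R :=
  if i is i'.+1 then fun x => Leib P G i' m.+1 n x + Leib P G i' m n.+1 x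
  else fun x => P m x * G n x.

(* g lists the derivatives of a function of class W^k_q: g j is absolutely
   continuous with derivative g j.+1 for j < k. *)
Definition wder (q : \bar R) (k : nat) (g : nat -> R -> R) :=
  (forall j, (j < k)%N -> AC01 (g j) (g j.+1)) /\ (forall j, (j <= k)%N -> L01 q (g j)).

Lemma sobolev_wder q k f : exponent_ok q ->
  sobolev q k f <-> exists2 g, wder q k g & g 0%N = f.
Proof.
move=> hq; elim: k f => [|k ih] f /=.
  split => [Lf|[g [_ h] <-]]; last exact: h.
  by exists (fun=> f) => //; split => // j _.
split=> [[g [/ih [G [h1 h2] E] fg]]|[g [h1 h2] <-]].
- exists (fun j => if j is j'.+1 then G j' else f) => //; split.
    by move=> [|j]; rewrite ?E //= ltnS; exact: h1.
  move=> [_|j]; last by rewrite ltnS; exact: h2.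
  apply: L01_continuous => //; apply: (AC_continuous _ fg).
  by rewrite -E; apply: (L01_integrable hq); exact: h2.
- exists (g 1%N); split; last exact: h1.
  apply/ih; exists (fun j => g j.+1) => //; split => j jk; [exact: h1|exact: h2].
Qed.

Lemma wder_continuous q k g j : exponent_ok q -> wder q k g -> (j < k)%N ->
  {within `[0, 1], continuous (g j)}.
Proof.
move=> hq [h1 h2] jk; apply: (AC_continuous _ (h1 _ jk)).
by apply: (L01_integrable hq); exact: h2.
Qed.

Lemma wder_le q k k' g : (k' <= k)%N -> wder q k g -> wder q k' g.
Proof.
by move=> kk [h1 h2]; split => j jk; [apply: h1|apply: h2]; exact: leq_trans kk.
Qed.

Lemma wderD q k g h : exponent_ok q -> wder q k g -> wder q k h ->
  wder q k (fun j t => g j t + h j t).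
Proof.
move=> hq [g1 g2] [h1 h2]; split => j jk; last by apply: L01D; auto.
apply: ACD; [| |exact: g1|exact: h1]; apply: (L01_integrable hq); auto.
Qed.

Lemma wderZ q k a g : exponent_ok q -> wder q k g -> wder q k (fun j t => a * g j t).
Proof.
move=> hq [g1 g2]; split => j jk; last by apply: L01Z; auto.
by apply: ACZ; [apply: (L01_integrable hq); auto|exact: g1].
Qed.

Lemma eq_wder q k g h : exponent_ok q ->
  (forall j t, (j <= k)%N -> 0 <= t <= 1 -> g j t = h j t) -> wder q k g -> wder q k h.
Proof.
move=> hq gh [g1 g2]; split => j jk.
  by apply: eq_AC (g1 _ jk) => t t01; apply: gh => //; exact: ltnW.
by apply: (eq_L01 hq) (g2 _ jk) => t; exact: gh.
Qed.

Lemma wder_deriv q k g (u : R -> R) : exponent_ok q -> wder q k g ->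
  (forall t, 0 < t < 1 -> u t = g 0%N t) ->
  forall j, (j < k)%N -> forall t, 0 < t < 1 -> derive1n j u t = g j t.
Proof.
move=> hq hg ug; elim=> [//|j ih] jk t t01; rewrite derive1nS.
have [d <-] := AC_derivable t01 (L01_integrable hq (hg.2 _ (ltnW jk))) (hg.1 _ (ltnW jk)) (wder_continuous hq hg jk).
have nr : \forall x \near t, derive1n j u x = g j x.
  have : t \in `]0, 1[ by rewrite in_itv.
  by move/near_in_itvoo; apply: filterS => x; rewrite in_itv /=; exact: ih (ltnW jk) x.
by rewrite !derive1E; apply: (near_eq_derive _ nr).
Qed.

(** At the top order the density is merely integrable: Lebesgue differentiation replaces continuity,
    and the identity holds only almost everywhere. *)
Lemma wder_deriv_ae q k g (u : R -> R) : exponent_ok q -> wder q k g ->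
  (forall t, 0 < t < 1 -> u t = g 0%N t) ->
  ae01 (fun t => derive1n k u t = g k t).
Proof.
move=> hq hg ug; case: k hg => [|k] hg; first exact: ae01_oo.
apply: ae01_oo_mono (AC_derivable_ae (L01_integrable hq (hg.2 _ (leqnn _))) (hg.1 _ (leqnn _))).
move=> t t01 [d <-]; rewrite derive1nS.
have nr : \forall x \near t, derive1n k u x = g k x.
  have : t \in `]0, 1[ by rewrite in_itv.
  by move/near_in_itvoo; apply: filterS => x; rewrite in_itv /=; exact: wder_deriv hq hg ug _ _ _.
by rewrite !derive1E; apply: (near_eq_derive _ nr).
Qed.

Lemma tr0_cont (f g : R -> R) : {within `[0, 1], continuous g} ->
  (\forall t \near (0 : R)^'+, f t = g t) -> tr0 f = g 0.
Proof.
move=> /(continuous_within_itvP _ ltr01)[_ g0 _] fg.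
apply: cvg_lim => //; apply: cvg_trans g0; apply: near_eq_cvg.
by apply: filterS fg => t ->.
Qed.

Lemma tr1_cont (f g : R -> R) : {within `[0, 1], continuous g} ->
  (\forall t \near (1 : R)^'-, f t = g t) -> tr1 f = g 1.
Proof.
move=> /(continuous_within_itvP _ ltr01)[_ _ g0] fg.
apply: cvg_lim => //; apply: cvg_trans g0; apply: near_eq_cvg.
by apply: filterS fg => t ->.
Qed.

Lemma near0_oo (e : R) (Q : R -> Prop) : 0 < e -> (forall t, 0 < t < e -> Q t) ->
  \forall t \near (0 : R)^'+, Q t.
Proof.
move=> e0 h; near=> t; apply: h; apply/andP; split; first by near: t; exact: nbhs_right_gt.
by near: t; exact: nbhs_right_lt.
Unshelve. all: by end_near. Qed.

Lemma near1_oo (e : R) (Q : R -> Prop) : e < 1 -> (forall t, e < t < 1 -> Q t) ->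
  \forall t \near (1 : R)^'-, Q t.
Proof.
move=> e0 h; near=> t; apply: h; apply/andP; split; last by near: t; exact: nbhs_left_lt.
by near: t; exact: nbhs_left_gt.
Unshelve. all: by end_near. Qed.

(** The strict bounds keep one derivative of each factor in reserve: all i + 1 differentiations may
    fall on the same factor. *)
Lemma Leib_AC P G q k n : exponent_ok q -> wder +oo%E k P -> wder q (n + k) G ->
  forall i m, (m + i < k)%N -> forall n', (n' + i < n + k)%N ->
  AC01 (Leib P G i m n') (Leib P G i.+1 m n') /\ integrable01 (Leib P G i.+1 m n').
Proof.
move=> hq [p1 p2] [g1 g2]; have hoo : exponent_ok (+oo%E : \bar R) by right.
elim=> [|i ih] m mi n' ni.
  have ip j : (j <= k)%N -> integrable01 (P j) by move=> jk; apply: (L01_integrable hoo); auto.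
  have ig j : (j <= n + k)%N -> integrable01 (G j) by move=> jk; apply: (L01_integrable hq); auto.
  rewrite !addn0 in mi ni; split.
    by apply: AC_mul; [exact: ip|exact: ig|exact: p1|exact: g1].
  rewrite /=; apply: integrable01D.
    apply: Loo_integrable01_mul; [exact: p2|apply: ig; lia].
  apply: Loo_integrable01_mul; [apply: p2; lia|apply: ig; lia].
have [||a1 i1] := ih m.+1 _ n'; [lia|lia|].
have [||a2 i2] := ih m _ n'.+1; [lia|lia|].
by split; [exact: ACD|exact: integrable01D].
Qed.

Lemma Leib_L01 P G q k n : exponent_ok q -> wder +oo%E k P -> wder q (n + k) G ->
  forall i m, (m + i <= k)%N -> forall n', (n' + i <= n + k)%N -> L01 q (Leib P G i m n').
Proof.
move=> hq [p1 p2] [g1 g2]; elim=> [|i ih] m mi n' ni /=.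
  by apply: LooM => //; [apply: p2; lia|apply: g2; lia].
by apply: L01D => //; apply: ih; lia.
Qed.

Lemma Leib_wder P G q k n : exponent_ok q -> wder +oo%E k P -> wder q (n + k) G ->
  wder q k (fun i => Leib P G i 0 n).
Proof.
move=> hq hP hG; split => i ik.
  by have [||] := Leib_AC hq hP hG (i := i) (m := 0%N) _ (n' := n) _; [lia|lia|].
by apply: (Leib_L01 hq hP hG); lia.
Qed.

(** This is binomial(i, k) P_(m+i-k), generated by Pascal's rule: the coefficient of G_(n+k) in the
    i-th derivative of P_m G_n. Linearity in the jet of G is what turns L u' at an endpoint into a
    boundary form. *)
Fixpoint Lcoef (P : nat -> R -> R) (i m : nat) (x : R) (k : nat) : R :=
  if i is i'.+1 then Lcoef P i' m.+1 x k + (if k is k'.+1 then Lcoef P i' m x k' else 0)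
  else if k is 0%N then P m x else 0.

Lemma LeibE P G i m n x N : (i < N)%N ->
  Leib P G i m n x = \sum_(k < N) Lcoef P i m x k * G (n + k)%N x.
Proof.
elim: i m n N => [|i ih] m n [//|N] iN /=.
  rewrite big_ord_recl /= addn0 big1 ?addr0 // => j _.
  by rewrite /= mul0r.
rewrite (ih m.+1 n N.+1); last by lia.
rewrite (ih m n.+1 N) //.
under [RHS]eq_bigr do rewrite mulrDl.
rewrite big_split /=; congr (_ + _).
rewrite big_ord_recl /= mul0r add0r; apply: eq_bigr => j _.
by rewrite /= /bump /= add1n addSnnS.
Qed.

End weak_derivatives.

(** * Smooth functions *)

Section smooth_functions.
Context {R : realType}.
Implicit Types (f g : R -> R).

(** Differentiability n times, with the derivative carried as a witness, so that closure under the
    operations is an induction on n that never computes an iterated [derive1n]. *)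
Fixpoint Cn n f : Prop :=
  if n is n'.+1 then exists2 f' : R -> R, (forall x : R, is_derive x 1 f (f' x)) & Cn n' f'
  else True.

Definition smooth f := forall n, Cn n f.

Lemma Cn_le m n f : (m <= n)%N -> Cn n f -> Cn m f.
Proof.
elim: m n f => [//|m ih] [//|n] f mn /= [f' ff' h].
by exists f' => //; exact: ih h.
Qed.

Lemma eq_Cn n f g : f =1 g -> Cn n f -> Cn n g.
Proof. by move=> /funext ->. Qed.

Lemma Cn_cst n (c : R) : Cn n (fun=> c).
Proof.
elim: n c => [//|n ih] c; exists (fun=> 0); last exact: ih.
by move=> x; exact: is_derive_cst.
Qed.

Lemma CnD n f g : Cn n f -> Cn n g -> Cn n (fun x => f x + g x).
Proof.
elim: n f g => [//|n ih] f g [f' ff' cf] [g' gg' cg].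
exists (fun x => f' x + g' x); last exact: ih.
by move=> x; exact: is_deriveD.
Qed.

Lemma CnM n f g : Cn n f -> Cn n g -> Cn n (fun x => f x * g x).
Proof.
elim: n f g => [//|n ih] f g hf hg; have := (hf, hg) => -[[f' ff' cf] [g' gg' cg]].
exists (fun x => f x * g' x + g x * f' x).
  by move=> x; exact: is_deriveM.
by apply: CnD; apply: ih => //; [apply: Cn_le hf|apply: Cn_le hg].
Qed.

Lemma CnZ n a f : Cn n f -> Cn n (fun x => a * f x).
Proof. by apply: CnM; exact: Cn_cst. Qed.

Lemma is_derive_inv f (df x : R) : f x != 0 -> is_derive x 1 f df ->
  is_derive x 1 (fun x => (f x)^-1) (- (f x) ^- 2 * df).
Proof.
move=> fx0 [d e]; have [d' e'] : derivable (fun y => (f y)^-1) x 1 /\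
    'D_1 (fun y => (f y)^-1) x = - (f x) ^- 2 * df.
  by split; [exact: derivableV|rewrite deriveV // e].
exact: DeriveDef.
Qed.

Lemma CnV n f : (forall x, f x != 0) -> Cn n f -> Cn n (fun x => (f x)^-1).
Proof.
move=> f0; elim: n => [//|n ih] hf; have [f' ff' cf] := hf.
exists (fun x => - (f x) ^- 2 * f' x); first by move=> x; exact: is_derive_inv.
have hn : Cn n (fun x => (f x)^-1) by apply: ih; exact: Cn_le hf.
apply: CnM => //; apply: (@eq_Cn _ (fun x => -1 * ((f x)^-1 * (f x)^-1))).
  by move=> x; rewrite mulN1r -invfM -expr2.
by apply: CnZ; exact: CnM.
Qed.

Lemma is_derive_affine f (df a b x : R) : is_derive (a * x + b) 1 f df ->
  is_derive x 1 (fun x => f (a * x + b)) (a * df).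
Proof.
move=> h; have h1 : is_derive x 1 (fun x => a * x + b) a.
  have h0 := @is_deriveZ _ _ _ (@id R) a x 1 1 (is_derive_id x 1).
  by have := is_deriveD h0 (is_derive_cst b x 1); rewrite addr0 /GRing.scale /= mulr1.
have := @is_derive1_comp _ f (fun x => a * x + b) x df a h h1.
by rewrite mulrC.
Qed.

Lemma Cn_affine n f (a b : R) : Cn n f -> Cn n (fun x => f (a * x + b)).
Proof.
elim: n f => [//|n ih] f [f' ff' cf].
exists (fun x => a * f' (a * x + b)); last by apply: CnZ; exact: ih.
by move=> x; exact: is_derive_affine.
Qed.

Lemma smooth_horner (p : {poly R}) : smooth (horner p).
Proof.
move=> n; elim: n p => [//|n ih] p; exists (horner p^`()) => //.
by move=> x; exact: is_derive_poly.
Qed.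

Lemma Cn_derive1n n f j : Cn (n + j) f -> Cn n (derive1n j f).
Proof.
elim: j n => [|j ih] n; first by rewrite addn0.
rewrite addnS -addSn => /ih [f' h c]; rewrite derive1nS.
by apply: eq_Cn c => x; rewrite derive1E; have [_ ->] := h x.
Qed.

Lemma smooth_derivable f : smooth f -> forall n x, derivable (derive1n n f) x 1.
Proof.
move=> hf n x; have [f' h _] := Cn_derive1n (hf (1 + n)%N).
by have [] := h x.
Qed.

(** The flat function x^(-k) exp(-1/x), extended by 0. The power k is kept because the family,
    unlike its member k = 0, is stable under differentiation up to linear combinations. *)
Definition expinv k (x : R) : R := if 0 < x then x^-1 ^+ k * expR (- x^-1) else 0.

Lemma expinv_gt0 k x : 0 < x -> 0 < expinv k x.
Proof. by move=> x0; rewrite /expinv x0 mulr_gt0 ?expR_gt0 // exprn_gt0 // invr_gt0. Qed.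

Lemma expinv_le0 k x : x <= 0 -> expinv k x = 0.
Proof. by move=> x0; rewrite /expinv ltNge x0. Qed.

(** The factorial comes from exp(y) >= y^(k+1) / (k+1)! at y = 1/x; one power more than k leaves a
    factor x, hence the limit 0 at the origin. *)
Lemma expinv_bound k x : `|expinv k x| <= k.+1`!%:R * `|x|.
Proof.
have [x0|x0] := leP x 0; first by rewrite expinv_le0 // normr0 mulr_ge0.
rewrite gtr0_norm ?expinv_gt0 // gtr0_norm // /expinv x0 expRN.
have y0 : 0 < x^-1 by rewrite invr_gt0.
rewrite ler_pdivrMr ?expR_gt0 // -ler_pdivrMl ?mulr_gt0 ?ltr0n ?fact_gt0 //.
apply: le_trans (expR_ge1Dxn k (ltW y0)).
have -> : (k.+1`!%:R * x)^-1 * x^-1 ^+ k = x^-1 ^+ k.+1 / k.+1`!%:R.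
  by rewrite invfM exprS; ring.
by rewrite lerDr.
Qed.

Lemma expinv_cvg0 k : expinv k x @[x --> (0 : R)] --> (0 : R).
Proof.
apply/cvgr0Pnorm_lt => e e0.
have C0 : 0 < (k.+1`!%:R : R) by rewrite ltr0n fact_gt0.
near=> x; apply: le_lt_trans (expinv_bound k x) _.
rewrite -ltr_pdivlMl //; near: x; exists (k.+1`!%:R^-1 * e) => /=.
  by rewrite mulr_gt0 // invr_gt0.
by move=> y /=; rewrite sub0r normrN.
Unshelve. all: by end_near. Qed.

Lemma expinv_derive k (x : R) :
  is_derive x 1 (expinv k) (expinv k.+2 x - k%:R * expinv k.+1 x).
Proof.
have [x0|x0|->] := ltgtP x 0.
- have nr : \forall y \near x, cst 0 y = expinv k y.
    by near=> y; rewrite expinv_le0 // ltW //; near: y; exact: lt_nbhsl.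
  rewrite !expinv_le0 ?ltW // mulr0 subrr.
  by apply: near_eq_is_derive nr _; exact: is_derive_cst.
- have nr : \forall y \near x, y^-1 ^+ k * expR (- y^-1) = expinv k y.
    near=> y; have y0 : 0 < y by near: y; exact: lt_nbhsr.
    by rewrite /expinv y0.
  apply: near_eq_is_derive nr _; rewrite /expinv x0.
  have xn0 : x != 0 by rewrite gt_eqF.
  have d1 : is_derive x 1 (fun y : R => y^-1) (- x ^- 2).
    by have := @is_derive_inv id 1 x xn0 (is_derive_id _ _); rewrite mulr1.
  have d2 : is_derive x 1 (fun y : R => expR (- y^-1)) (expR (- x^-1) * x ^- 2).
    apply: (@is_derive1_comp _ expR (fun y : R => - y^-1)).
    by have := is_deriveN d1; rewrite opprK.
  have d3 : is_derive x 1 (fun y : R => y^-1 ^+ k) (- k%:R * x^-1 ^+ k.+1).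
    have -> : (fun y : R => y^-1 ^+ k) = (fun y : R => y^-1) ^+ k.
      by apply/funext => y; rewrite exprfctE.
    apply: is_derive_eq (is_deriveX k d1) _; rewrite /GRing.scale /= -!exprVn.
    by case: k => [|k]; [ring|rewrite /= !exprS expr0; ring].
  apply: is_derive_eq (is_deriveM d3 d2) _.
  by rewrite /GRing.scale /= -!exprVn !exprS expr0; ring.
- rewrite !expinv_le0 // mulr0 subrr.
  (* At 0 the difference quotient of [expinv k] is [expinv k.+1] itself, whose limit is already
     known. *)
  have E : (fun h : R => h^-1 *: ((expinv k \o shift 0) (h *: 1) - expinv k 0)) = expinv k.+1.
    apply/funext => h; rewrite /= addr0 (expinv_le0 k (lexx 0)) subr0 /GRing.scale /= mulr1.
    have [h0|h0] := leP h 0; first by rewrite !expinv_le0 // mulr0.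
    by rewrite /expinv h0 exprS mulrA.
  have c : (fun h : R => h^-1 *: ((expinv k \o shift 0) (h *: 1) - expinv k 0)) h @[h --> 0^'] --> (0 : R).
    by rewrite E; apply: cvg_within_filter; exact: expinv_cvg0.
  apply: DeriveDef; first by apply/cvg_ex; exists 0.
  by apply: cvg_lim.
Unshelve. all: by end_near. Qed.

Lemma Cn_expinv n k : Cn n (expinv k).
Proof.
elim: n k => [//|n ih] k; exists (fun x => expinv k.+2 x - k%:R * expinv k.+1 x).
  by move=> x; exact: expinv_derive.
apply: (@eq_Cn _ (fun x => expinv k.+2 x + (- k%:R) * expinv k.+1 x)).
  by move=> x; rewrite mulNr.
by apply: CnD => //; exact: CnZ.
Qed.

Lemma smooth_step (a b : R) : a < b -> exists th : R -> R,
  [/\ smooth th, forall x, 0 <= th x <= 1, forall x, x <= a -> th x = 0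
    & forall x, b <= x -> th x = 1].
Proof.
move=> ab; pose u x := (b - a)^-1 * x + - (a / (b - a)).
have ba0 : 0 < b - a by rewrite subr_gt0.
have uE x : u x = (x - a) / (b - a) by rewrite /u -mulNr mulrC mulrDl.
(* The transition is e(x) / (e(x) + e(1 - x)) with e(x) = exp(-1/x) for x > 0, rescaled from [0,1]
   to [a,b]; the denominator is positive because x and 1 - x are never both nonpositive. *)
pose D x := expinv 0 x + expinv 0 (-1 * x + 1).
have D0 x : 0 < D x.
  rewrite /D; have [x0|x0] := leP x 0.
    by rewrite expinv_le0 // add0r expinv_gt0 //; lra.
  rewrite ltr_pwDl ?expinv_gt0 //; have [h|h] := leP (-1 * x + 1) 0.
    by rewrite expinv_le0.
  by rewrite ltW // expinv_gt0.
pose sg x := expinv 0 x * (D x)^-1.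
have e0 x : 0 <= expinv 0 x.
  by have [h|h] := leP x 0; [rewrite expinv_le0|rewrite ltW // expinv_gt0].
exists (fun x => sg (u x)); split.
- move=> n; apply: Cn_affine; apply: CnM; first exact: Cn_expinv.
  apply: CnV => [x|]; first by rewrite gt_eqF.
  by apply: CnD; [exact: Cn_expinv|apply: Cn_affine; exact: Cn_expinv].
- move=> x; rewrite /sg mulr_ge0 ?invr_ge0 ?(ltW (D0 _)) //=.
  by rewrite ler_pdivrMr // mul1r /D lerDl.
- move=> x xa; rewrite /sg expinv_le0 ?mul0r // uE pmulr_lle0 ?invr_gt0 //.
  by rewrite subr_le0.
- move=> x xb; rewrite /sg /D.
  have u1 : 1 <= u x by rewrite uE ler_pdivlMr // mul1r lerD2r.
  rewrite [expinv 0 (_ + 1)]expinv_le0 ?addr0; last by lra.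
  by rewrite divff // gt_eqF // expinv_gt0 // (lt_le_trans ltr01).
Qed.

(** A rising step times the mirror image of a rising step. *)
Lemma smooth_plateau (a b c d : R) : a < b -> c < d -> exists th : R -> R,
  [/\ smooth th, forall x, 0 <= th x <= 1, forall x, ~~ (a < x < d) -> th x = 0
    & forall x, b <= x <= c -> th x = 1].
Proof.
move=> ab cd; have [t1 [s1 b1 l1 r1]] := smooth_step ab.
have [|t2 [s2 b2 l2 r2]] := @smooth_step (- d) (- c); first by rewrite ltrN2.
exists (fun x => t1 x * t2 (-1 * x + 0)); split.
- by move=> n; apply: CnM; [exact: s1|apply: Cn_affine; exact: s2].
- move=> x; have /andP[? ?] := b1 x; have /andP[? ?] := b2 (-1 * x + 0).
  by rewrite mulr_ge0 // mulr_ile1.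
- move=> x; rewrite negb_and -!leNgt => /orP[xa|dx].
    by rewrite l1 ?mul0r.
  by rewrite l2 ?mulr0 // addr0 mulN1r lerN2.
- move=> x /andP[bx xc]; rewrite r1 // r2 ?mulr1 //.
  by rewrite addr0 mulN1r lerN2.
Qed.

Lemma derive1n_eq_oo (a b : R) f g : (forall x, a < x < b -> f x = g x) ->
  forall j x, a < x < b -> derive1n j f x = derive1n j g x.
Proof.
move=> fg; elim=> [//|j ih] x xab.
rewrite !derive1nS !derive1E; apply: near_eq_derive.
have : x \in `]a, b[ by rewrite in_itv.
by move/near_in_itvoo; apply: filterS => y; rewrite in_itv; exact: ih.
Qed.

(** The Taylor polynomial at s. Writing it as a polynomial composed with X - s makes iterated
    derivatives commute with the shift, so that only coefficients at 0 have to be computed. *)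
Lemma smooth_jet (s : R) (c : nat -> R) N : exists2 q : R -> R, smooth q &
  forall j, (j < N)%N -> derive1n j q s = c j.
Proof.
pose p := (\poly_(i < N) (c i / i`!%:R)) \Po ('X - s%:P).
have dp (r : {poly R}) j : (r \Po ('X - s%:P))^`(j) = r^`(j) \Po ('X - s%:P).
  elim: j => [//|j ih]; rewrite !derivnS ih deriv_comp derivB derivX derivC.
  by rewrite subr0 mulr1.
have dh (r : {poly R}) j : derive1n j (horner r) = horner r^`(j).
  by elim: j => [//|j ih]; rewrite derive1nS ih derivnS -derivE.
exists (horner p); first exact: smooth_horner.
move=> j jN; rewrite dh dp horner_comp !hornerE subrr horner_coef0 coef_derivn.
rewrite addn0 coef_poly jN ffactnn -[LHS]mulr_natr divfK // pnatr_eq0 -lt0n fact_gt0.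
Qed.

Lemma smooth_wder q k f : exponent_ok q -> smooth f -> wder q k (fun j => derive1n j f).
Proof.
move=> hq sf; have df := smooth_derivable sf.
have cf n : continuous (derive1n n f).
  by move=> x; apply: differentiable_continuous; apply/derivable1_diffP.
have cw n (a b : R) : {within `[a, b], continuous (derive1n n f)}.
  by apply: continuous_subspaceT => x; exact: cf.
split=> [j _ t /andP[t0 t1]|j _]; last exact: L01_continuous.
move: t0; rewrite le_eqVlt => /predU1P[<-|t0]; first by rewrite prim0 addr0.
rewrite /prim /Rintegral (@continuous_FTC2 _ _ (derive1n j f)) //.
- by rewrite -EFinB /= addrC subrK.
- split; first by move=> x _; exact: df.
  + by apply: cvg_at_right_filter; exact: cf.
  + by apply: cvg_at_left_filter; exact: cf.
Qed.

End smooth_functions.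

(** * The operator and its boundary forms *)

Section operator.
Context {R : realType}.
Implicit Types (f u v : R -> R) (g h : nat -> R -> R).

Lemma ae01_forall n (Q : nat -> R -> Prop) : (forall j, (j < n)%N -> ae01 (Q j)) ->
  ae01 (fun t => forall j, (j < n)%N -> Q j t).
Proof.
elim: n => [|n ih] h; first by apply: ae01W => t _ j.
have h1 := ih (fun j jn => h j (ltnW jn)).
apply: ae01_mono (ae01_and h1 (h n (ltnSn n))) => t _ [H1 H2] j.
by rewrite ltnS leq_eqVlt => /predU1P[->|]; auto.
Qed.

Lemma derive1nSr n f : derive1n n (derive1 f) = derive1n n.+1 f.
Proof. by rewrite /derive1n iterSr. Qed.

(** A choice, made once, of the weak derivatives of the coefficients: p_j comes with j of them, just
    as many as the j-fold derivative of p_j u^(j) consumes. *)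
Definition coef_chain (l : nat) (p : nat -> R -> R) (P : nat -> nat -> R -> R) :=
  forall j, (j <= l)%N -> wder +oo%E j (P j) /\ P j 0%N = p j.

Lemma coef_chain_ex l p : admissible_coefs l p -> exists P, coef_chain l p P.
Proof.
move=> [hp _]; have hoo : exponent_ok (+oo%E : \bar R) by right.
have H j : exists Pj, (j <= l)%N -> wder +oo%E j Pj /\ Pj 0%N = p j.
  have [jl|_] := boolP (j <= l)%N; last by exists (fun=> cst 0).
  by have /(sobolev_wder _ _ hoo) [g hg e] := hp _ jl; exists g.
by have [P hP] := choice H; exists P => j jl; exact: hP.
Qed.

Lemma LeibD (P : nat -> R -> R) g h i m n t :
  Leib P (fun j t => g j t + h j t) i m n t = Leib P g i m n t + Leib P h i m n t.
Proof.
elim: i m n => [|i ih] m n /=; first by rewrite mulrDr.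
by rewrite !ih addrACA.
Qed.

Lemma LeibZ (P : nat -> R -> R) a g i m n t :
  Leib P (fun j t => a * g j t) i m n t = a * Leib P g i m n t.
Proof.
elim: i m n => [|i ih] m n /=; first by rewrite mulrCA.
by rewrite !ih mulrDr.
Qed.

Lemma AC_sum n (F G : nat -> R -> R) : (forall j, (j < n)%N -> AC01 (F j) (G j) /\ integrable01 (G j)) ->
  AC01 (fun t => \sum_(j < n) F j t) (fun t => \sum_(j < n) G j t) /\
  integrable01 (fun t => \sum_(j < n) G j t).
Proof.
move=> h; split; last by apply: integrable01_sum => i; exact: (h i (ltn_ord i)).2.
elim: n h => [|n ih] h.
  apply: (@eq_AC _ (fun=> 0) (fun=> 0)); try by move=> t _; rewrite big_ord0.
  by move=> t /andP[t0 t1]; rewrite /prim Rintegral_cst // mul0r addr0.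
have h' j : (j < n)%N -> AC01 (F j) (G j) /\ integrable01 (G j) by move=> jn; apply: h; lia.
apply: (@eq_AC _ (fun t => \sum_(j < n) F j t + F n t) (fun t => \sum_(j < n) G j t + G n t)).
- by move=> t _; rewrite big_ord_recr.
- by move=> t _; rewrite big_ord_recr.
- apply: ACD; [|by case: (h n (ltnSn n))|exact: ih|by case: (h n (ltnSn n))].
  by apply: integrable01_sum => i; exact: (h' i (ltn_ord i)).2.
Qed.

Lemma L01_sum q n (F : nat -> R -> R) : exponent_ok q -> (forall j, (j < n)%N -> L01 q (F j)) ->
  L01 q (fun t => \sum_(j < n) F j t).
Proof.
move=> hq; elim: n => [|n ih] h.
  by under eq_fun do rewrite big_ord0; exact: L01_cst.
under eq_fun do rewrite big_ord_recr /=.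
by apply: L01D => //; [apply: ih => j jn; apply: h; lia|exact: h].
Qed.

Section expr.
Variables (l : nat) (p : nat -> R -> R) (P : nat -> nat -> R -> R).
Hypotheses (hl : (0 < l)%N) (hP : coef_chain l p P).
Hypothesis hp0 : forall t, 0 <= t <= 1 -> p 0%N t = 0.

Let q2 : exponent_ok (2%:E : \bar R). Proof. by left. Qed.

Definition W2 g := wder (2%:E : \bar R) l.*2 g.

(* If g lists the derivatives of u, then fd g = L u and qd g = L u'. *)
Definition fd g (t : R) : R :=
  (-1) ^+ l * Leib (P l) g l 0 l t + \sum_(j < l) Leib (P j) g j 0 j t.

Definition qd g (t : R) : R :=
  (-1) ^+ l * Leib (P l) g l.-1 0 l t + \sum_(j < l.-1) Leib (P j.+1) g j 0 j.+1 t.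

Lemma fdE g t : fd g t = (-1) ^+ l * Leib (P l) g l 0 l t + \sum_(j < l) Leib (P j) g j 0 j t.
Proof. by []. Qed.

Lemma fdD g h t : fd (fun j t => g j t + h j t) t = fd g t + fd h t.
Proof.
rewrite /fd LeibD mulrDr -!addrA; congr (_ + _); rewrite [RHS]addrCA; congr (_ + _).
by rewrite -big_split; apply: eq_bigr => j _; exact: LeibD.
Qed.

Lemma fdZ a g t : fd (fun j t => a * g j t) t = a * fd g t.
Proof.
rewrite /fd LeibZ mulrCA mulrDr; congr (_ + _).
by rewrite mulr_sumr; apply: eq_bigr => j _; exact: LeibZ.
Qed.

Lemma W2_Leib g j : (j <= l)%N -> W2 g -> wder (2%:E : \bar R) j (fun i => Leib (P j) g i 0 j).
Proof.
move=> jl hg; apply: Leib_wder => //; first exact: (hP jl).1.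
by apply: wder_le hg; lia.
Qed.

Lemma fd_L2 g : W2 g -> L01 2%:E (fd g).
Proof.
move=> hg; apply: L01D => //.
  by apply: L01Z => //; exact: (W2_Leib (leqnn _) hg).2.
apply: (@L01_sum _ _ (fun j => Leib (P j) g j 0 j)) => // j jl.
by apply: (W2_Leib (ltnW jl) hg).2.
Qed.

Lemma W2_L2 g j : W2 g -> (j <= l.*2)%N -> L01 2%:E (g j).
Proof. by move=> [_]; apply. Qed.

Lemma W2_deriv g u j t : W2 g -> (forall t, 0 < t < 1 -> u t = g 0%N t) ->
  (j < l.*2)%N -> 0 < t < 1 -> derive1n j u t = g j t.
Proof. by move=> hg ug jl t01; apply: (wder_deriv q2 hg ug). Qed.

Lemma W2_pderiv g u j : W2 g -> (forall t, 0 < t < 1 -> u t = g 0%N t) -> (j <= l)%N ->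
  forall t, 0 < t < 1 -> p j t * derive1n j u t = Leib (P j) g 0 0 j t.
Proof.
move=> hg ug jl t t01; rewrite (W2_deriv hg ug) //; last by lia.
by rewrite /= (hP jl).2.
Qed.

Lemma Lop_fd g u : W2 g -> (forall t, 0 < t < 1 -> u t = g 0%N t) ->
  ae01 (fun t => Lop l p u t = fd g t).
Proof.
move=> hg ug.
have H j : (j < l.+1)%N -> ae01 (fun t => derive1n j (fun x => p j x * derive1n j u x) t = Leib (P j) g j 0 j t).
  move=> jl; apply: (wder_deriv_ae q2 (W2_Leib jl hg)).
  exact: W2_pderiv.
apply: ae01_mono (ae01_forall H) => t _ Ht; rewrite /Lop /fd Ht //.
congr (_ + _); apply: eq_bigr => j _; apply: Ht.
by rewrite ltnS ltnW.
Qed.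

Lemma Lred_qd g u t : W2 g -> (forall t, 0 < t < 1 -> u t = g 0%N t) -> 0 < t < 1 ->
  Lred l p (derive1 u) t = qd g t.
Proof.
move=> hg ug t01; rewrite /Lred /qd.
have H j : (0 < j)%N -> (j <= l)%N ->
    derive1n j.-1 (fun x => p j x * derive1n j.-1 (derive1 u) x) t = Leib (P j) g j.-1 0 j t.
  case: j => // j _ jl; rewrite derive1nSr /=.
  apply: (wder_deriv q2 (W2_Leib jl hg)) => //.
  exact: W2_pderiv.
rewrite H //; congr (_ + _).
case: l hl H => // l' _ H; rewrite big_add1 /= big_mkord; apply: eq_bigr => j _.
by apply: (H j.+1) => //; exact: leqW (ltn_ord j).
Qed.

Lemma qd_AC g : W2 g -> AC01 (qd g) (fd g).
Proof.
move=> hg.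
have H j : (0 < j)%N -> (j <= l)%N ->
    AC01 (Leib (P j) g j.-1 0 j) (Leib (P j) g j 0 j) /\ integrable01 (Leib (P j) g j 0 j).
  case: j => // j _ jl; have [h1 h2] := W2_Leib jl hg; split; first exact: h1.
  by apply: (L01_integrable q2); exact: h2.
have [a1 i1] := H l hl (leqnn _).
have [|a2 i2] := @AC_sum l.-1 (fun j => Leib (P j.+1) g j 0 j.+1) (fun j => Leib (P j.+1) g j.+1 0 j.+1).
  by move=> j jl; apply: (H j.+1) => //; lia.
have := ACD (integrable01Z ((-1) ^+ l) i1) i2 (ACZ ((-1) ^+ l) i1 a1) a2.
apply: eq_AC => // t t01; rewrite /fd; congr (_ + _).
(* The term j = 0 of L u has no counterpart in L u'; it is zero because p_0 = 0. *)
case: l hl => // l' _; rewrite big_ord_recl /= (hP (leq0n _)).2 hp0 // mul0r add0r.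
by apply: eq_bigr.
Qed.

Lemma qd_continuous g : W2 g -> {within `[0, 1], continuous (qd g)}.
Proof.
by move=> hg; apply: (AC_continuous _ (qd_AC hg)); apply: (L01_integrable q2); exact: fd_L2.
Qed.

Lemma Lop_Lred g u : W2 g -> (forall t, 0 < t < 1 -> u t = g 0%N t) ->
  ae01 (fun t => Lop l p u t = derive1 (Lred l p (derive1 u)) t).
Proof.
move=> hg ug; have := AC_derivable_ae (L01_integrable q2 (fd_L2 hg)) (qd_AC hg).
move=> /(ae01_and (Lop_fd hg ug)); apply: ae01_oo_mono => t t01 [-> [_ <-]].
rewrite !derive1E; apply: near_eq_derive.
have : t \in `]0, 1[ by rewrite in_itv.
by move/near_in_itvoo; apply: filterS => y; rewrite in_itv /= => y01; rewrite (Lred_qd hg ug).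
Qed.

Lemma flux_qd g u : W2 g -> (forall t, 0 < t < 1 -> u t = g 0%N t) ->
  periodic_flux l p u = qd g 0 - qd g 1.
Proof.
move=> hg ug; rewrite /periodic_flux.
rewrite (tr0_cont (qd_continuous hg)) ?(tr1_cont (qd_continuous hg)) //.
- by apply: (near1_oo ltr01) => t t01; exact: Lred_qd.
- by apply: (near0_oo ltr01) => t t01; exact: Lred_qd.
Qed.

Lemma W2_continuous g j : W2 g -> (j < l.*2)%N -> {within `[0, 1], continuous (g j)}.
Proof. by move=> hg; exact: (wder_continuous q2 hg). Qed.

Lemma tr0_W2 g u e j : W2 g -> 0 < e -> e <= 1 -> (forall t, 0 < t < e -> u t = g 0%N t) ->
  (j < l.*2)%N -> tr0 (derive1n j u) = g j 0.
Proof.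
move=> hg e0 e1 ug jl; apply: (tr0_cont (W2_continuous hg jl)).
apply: (near0_oo e0) => t t0e; rewrite (derive1n_eq_oo ug) //.
rewrite (@W2_deriv g (g 0%N)) //; case/andP: t0e => -> te.
exact: lt_le_trans te e1.
Qed.

Lemma tr1_W2 g u e j : W2 g -> 0 <= e -> e < 1 -> (forall t, e < t < 1 -> u t = g 0%N t) ->
  (j < l.*2)%N -> tr1 (derive1n j u) = g j 1.
Proof.
move=> hg e0 e1 ug jl; apply: (tr1_cont (W2_continuous hg jl)).
apply: (near1_oo e1) => t t0e; rewrite (derive1n_eq_oo ug) //.
rewrite (@W2_deriv g (g 0%N)) //; case/andP: t0e => te ->.
by rewrite (le_lt_trans e0).
Qed.

(* Two lists of derivatives, because G(.,s) is smooth only on either side of s. *)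
Definition jform (A C : 'M[R]_(l.*2)) (nu : 'I_(l.*2)) g h : R :=
  \sum_(j < l.*2) (A nu j * g j 0 + C nu j * h j 1).

Lemma bform_jform A C nu u g h e e' : W2 g -> W2 h -> 0 < e -> e <= 1 -> 0 <= e' -> e' < 1 ->
  (forall t, 0 < t < e -> u t = g 0%N t) -> (forall t, e' < t < 1 -> u t = h 0%N t) ->
  bform A C nu u = jform A C nu g h.
Proof.
move=> hg hh e0 e1 e0' e1' ug uh; apply: eq_bigr => j _.
by rewrite (tr0_W2 hg e0 e1 ug) // (tr1_W2 hh e0' e1' uh).
Qed.

Lemma bform_W2 A C nu u g : W2 g -> (forall t, 0 < t < 1 -> u t = g 0%N t) ->
  bform A C nu u = jform A C nu g g.
Proof. by move=> hg ug; apply: (bform_jform _ _ _ hg hg ltr01 (lexx _) (lexx _) ltr01 ug ug). Qed.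

Lemma W2D g h : W2 g -> W2 h -> W2 (fun j t => g j t + h j t).
Proof. exact: wderD. Qed.

Lemma W2Z a g : W2 g -> W2 (fun j t => a * g j t).
Proof. exact: wderZ. Qed.

Lemma jformD A C nu g h g' h' :
  jform A C nu (fun j t => g j t + g' j t) (fun j t => h j t + h' j t) =
  jform A C nu g h + jform A C nu g' h'.
Proof. by rewrite -big_split; apply: eq_bigr => j _ /=; ring. Qed.

Lemma jformZ A C nu a g h :
  jform A C nu (fun j t => a * g j t) (fun j t => a * h j t) = a * jform A C nu g h.
Proof. by rewrite mulr_sumr; apply: eq_bigr => j _ /=; ring. Qed.

Definition dom (A C : 'M[R]_(l.*2)) g := W2 g /\ forall nu, jform A C nu g g = 0.

Lemma domD A C g h : dom A C g -> dom A C h -> dom A C (fun j t => g j t + h j t).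
Proof.
by move=> [g1 g2] [h1 h2]; split => [|nu]; [exact: W2D|rewrite jformD g2 h2 addr0].
Qed.

Lemma domZ A C a g : dom A C g -> dom A C (fun j t => a * g j t).
Proof. by move=> [g1 g2]; split => [|nu]; [exact: W2Z|rewrite jformZ g2 mulr0]. Qed.

Lemma sobolev_W2 u : sobolev 2%:E l.*2 u <->
  exists2 g, W2 g & forall t, 0 <= t <= 1 -> u t = g 0%N t.
Proof.
split=> [/(sobolev_wder _ _ q2)[g hg <-]|[g hg ug]]; first by exists g.
apply/(sobolev_wder _ _ q2); exists (fun j => if j is 0%N then u else g j) => //.
apply: eq_wder hg => // -[|j] t _ t01 //.
by rewrite ug.
Qed.

(** The dictionary between the graph, stated with iterated derivatives and one-sided limits, and
    lists of weak derivatives, on which the later computations take place. *)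
Lemma op_graphP A C u f : op_graph p A C u f <->
  exists g, [/\ dom A C g, forall t, 0 <= t <= 1 -> u t = g 0%N t, L01 2%:E f
             & ae01 (fun t => fd g t = f t)].
Proof.
have oo g t : (forall t, 0 <= t <= 1 -> u t = g 0%N t) -> 0 < t < 1 -> u t = g 0%N t.
  by move=> h /andP[t0 t1]; rewrite h // !ltW.
split=> [[/sobolev_W2[g hg ug] bc Lf Lu]|[g [[hg bc] ug Lf Lu]]].
- exists g; split => //.
    by split => // nu; rewrite -(bform_W2 _ _ nu hg (oo g ^~ ug)).
  by apply: ae01_mono (ae01_and Lu (Lop_fd hg (oo g ^~ ug))) => t _ [<- <-].
- split => //; first by apply/sobolev_W2; exists g.
    by move=> nu; rewrite (bform_W2 _ _ nu hg (oo g ^~ ug)).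
  by apply: ae01_mono (ae01_and Lu (Lop_fd hg (oo g ^~ ug))) => t _ [<- <-].
Qed.

Lemma op_graph_dom A C g : dom A C g -> op_graph p A C (g 0%N) (fd g).
Proof.
move=> hg; apply/op_graphP; exists g; split => //; first exact: fd_L2 hg.1.
exact: ae01W.
Qed.

End expr.
End operator.

(** * The domain of the self-adjoint operator *)

Section fundamental_lemma.
Context {R : realType}.
Implicit Types (h : R -> R).

Lemma primB h : integrable01 h ->
  forall x y, 0 <= x -> x <= y -> y <= 1 ->
  prim h y - prim h x = int01 (h \_ `]x, y]).
Proof.
move=> ih x y x0 xy y1.
have ir E : measurable E -> integrable01 (h \_ E) by move=> mE; exact: integrable01_restr.
rewrite prim_int01 // prim_int01 ?(le_trans xy) // -int01B; [|exact: ir|exact: ir].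
apply: eq_int01 => t /andP[t0 t1].
have E1 z : (h \_ `[0, z]) t = if t <= z then h t else 0.
  case: ifPn => tz; first by rewrite restr_in //= in_itv /= t0.
  by rewrite restr_notin //= in_itv /= t0 /=; apply/negP.
have -> : (h \_ `]x, y]) t = if x < t <= y then h t else 0.
  case: ifPn => tz; first by rewrite restr_in //= in_itv.
  by rewrite restr_notin //= in_itv /=; apply/negP.
rewrite !E1; have [ty|ty] := leP t y; have [tx|tx] := leP t x => /=.
- by rewrite subrr.
- by rewrite subr0.
- by exfalso; lra.
- by rewrite subrr.
Qed.

(** Testing with plateaus that approximate the indicator of ]x, y] shows that the primitive of h is
    constant on ]a, b[, and h is its derivative almost everywhere. The error is at most the integral
    of |h| over the two flanks, small by continuity of [N]. *)
Lemma fundamental_lemma (a b : R) h : 0 <= a -> b <= 1 -> integrable01 h ->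
  (forall (eta : R -> R) a' b', smooth eta -> a < a' -> b' < b ->
     (forall x, ~~ (a' <= x <= b') -> eta x = 0) ->
     int01 (fun t => h t * eta t) = 0) ->
  ae01 (fun t => a < t < b -> h t = 0).
Proof.
move=> a0 b1 ih H.
pose N := prim (fun t => `|h t|).
have ih' : integrable01 (fun t => `|h t|) by exact: integrable_norm.
have cN := prim_continuous ih'.
have key x y : a < x -> x < y -> y < b -> prim h y = prim h x.
  move=> ax xy yb; apply/eqP; rewrite -subr_eq0 -normr_eq0 eq_le normr_ge0 andbT.
  apply/ler_addgt0Pl => e e0; rewrite addr0.
  have xin : x \in `]0, 1[ by rewrite in_itv /=; lra.
  have yin : y \in `]0, 1[ by rewrite in_itv /=; lra.
  have /(continuous_within_itvP _ ltr01)[cN' _ _] := cN.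
  have e2 : 0 < e / 2 by lra.
  have /cvgrPdist_lt /(_ _ e2) [dx /= dx0 hx] := cN' _ xin.
  have /cvgrPdist_lt /(_ _ e2) [dy /= dy0 hy] := cN' _ yin.
  (* Half of each radius puts x + d and y - d strictly inside the balls of continuity; a third of y
     - x keeps the two flanks disjoint. *)
  pose d := Num.min (Num.min (dx / 2) (dy / 2)) ((y - x) / 3).
  have d0 : 0 < d by rewrite !lt_min; lra.
  have ddx : d <= dx / 2 by rewrite !ge_min lexx.
  have ddy : d <= dy / 2 by rewrite !ge_min lexx orbT.
  have dxy : d <= (y - x) / 3 by rewrite !ge_min lexx !orbT.
  have [||th [s1 s2 s3 s4]] := @smooth_plateau R x (x + d) (y - d) y; [lra|lra|].
  have ithh : integrable01 (fun t => h t * th t).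
    apply: (@integrable01_dom _ _ (fun t => `|h t|)) => //.
      apply: measurable_funM; first exact: integrable01_meas.
      apply: L01_meas; apply: ((@smooth_wder _ +oo%E 0 th _ s1).2 0%N) => //.
      by right.
    move=> t _; rewrite normrM ler_piMr // ger0_norm; by have /andP[] := s2 t.
  have e1 : int01 (fun t => h t * th t) = 0.
    apply: (H th x y) => // t; rewrite negb_and -!ltNge => txy.
    apply: s3; apply/negP => /andP[? ?]; case/orP: txy; lra.
  rewrite (primB ih) ?(ltW xy) //; try lra.
  rewrite -[int01 _]subr0 -e1 -int01B //; last exact: integrable01_restr.
  apply: le_trans (le_normr_Rintegral _ _) _ => //.
    by apply: integrable01B => //; exact: integrable01_restr.
  have E1 := primB ih'; rewrite -/N in E1.
  have Hx : `|N x - N (x + d)| < e / 2.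
    by apply: hx; rewrite /ball_ /= distrC addrC addKr gtr0_norm //; lra.
  have Hy : `|N y - N (y - d)| < e / 2.
    by apply: hy; rewrite /ball_ /= opprB addrC subrK gtr0_norm //; lra.
  apply: (@le_trans _ _ ((N (x + d) - N x) + (N y - N (y - d)))); last first.
    rewrite distrC in Hx; have := ler_norm (N (x + d) - N x).
    by have := ler_norm (N y - N (y - d)); lra.
  rewrite E1; [|lra|lra|lra]; rewrite E1; [|lra|lra|lra].
  have ir E : measurable E -> integrable01 ((fun t => `|h t|) \_ E).
    by move=> mE; exact: integrable01_restr.
  rewrite -int01D; [|exact: ir|exact: ir].
  apply: le_Rintegral => //.
  - apply: integrable_norm; apply: integrable01B => //; exact: integrable01_restr.
  - by apply: integrable01D; exact: ir.
  move=> t; rewrite /= in_itv /= => t01.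
  have p0 E : 0 <= ((fun t => `|h t|) \_ E) t by rewrite patchE; case: ifP.
  have thle : `|h t - h t * th t| <= `|h t|.
    have /andP[? ?] := s2 t.
    rewrite -{1}[h t]mulr1 -mulrBr normrM ler_piMr // ger0_norm; lra.
  have [/= txy|/= txy] := pselect (`]x, y]%classic t); last first.
    rewrite restr_notin // s3 ?mulr0 ?subrr ?normr0 ?addr_ge0 //.
    apply/negP => /andP[? ?]; apply: txy; rewrite /= in_itv /=; lra.
  rewrite restr_in //; move: txy; rewrite /= in_itv /= => /andP[xt ty].
  have [tx|tx] := leP t (x + d).
    rewrite [X in _ <= X + _]restr_in; last by rewrite /= in_itv /= xt.
    by rewrite -[leLHS]addr0 lerD.
  have [ty'|ty'] := leP t (y - d); last first.
    rewrite [X in _ <= _ + X]restr_in; last by rewrite /= in_itv /= ty'.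
    by rewrite -[leLHS]add0r lerD.
  by rewrite s4 ?mulr1 ?subrr ?normr0 ?addr_ge0 //; lra.
have acH : AC01 (prim h) h by move=> t _; rewrite prim0 add0r.
apply: ae01_oo_mono (AC_derivable_ae ih acH) => t t01 [_ <-] tab.
have nr : \forall y \near t, cst (prim h t) y = prim h y.
  have : t \in `]a, b[ by rewrite in_itv.
  move/near_in_itvoo; apply: filterS => y; rewrite in_itv /= => yab.
  have [ty|ty|->//] := ltgtP t y; first by rewrite /= -(key t y) //; lra.
  by rewrite /= -(key y t) //; lra.
by rewrite derive1E -(near_eq_derive _ nr) derive_cst.
Qed.
End fundamental_lemma.

(** * Locality of the expression and symmetry on cut-off functions *)

Section locality.
Context {R : realType}.
Implicit Types (f u v : R -> R) (g h : nat -> R -> R).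
Variables (l : nat) (p : nat -> R -> R) (P : nat -> nat -> R -> R).
Hypotheses (hl : (0 < l)%N) (hP : coef_chain l p P).
Let q2 : exponent_ok (2%:E : \bar R). Proof. by left. Qed.
Local Notation W2 := (W2 l).
Local Notation fd := (fd l P).

(** A list of weak derivatives is a system of integral formulas started at 0, hence not visibly
    local; passing through [Lop], made of genuine derivatives, gives locality. *)
Lemma fd_local (a b : R) g h : W2 g -> W2 h ->
  (forall t, a < t < b -> g 0%N t = h 0%N t) -> ae01 (fun t => a < t < b -> fd g t = fd h t).
Proof.
move=> hg hh gh.
have e1 := Lop_fd hl hP hg (fun t _ => erefl); have e2 := Lop_fd hl hP hh (fun t _ => erefl).
apply: ae01_mono (ae01_and e1 e2) => t _ [<- <-] tab.
have E j : derive1n j (fun x => p j x * derive1n j (g 0%N) x) t =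
           derive1n j (fun x => p j x * derive1n j (h 0%N) x) t.
  apply: (derive1n_eq_oo (a := a) (b := b)) => // x xab.
  by rewrite (derive1n_eq_oo gh).
by rewrite /Lop E; congr (_ + _); apply: eq_bigr => j _; exact: E.
Qed.

Lemma jet0_local (e : R) g h j : W2 g -> W2 h -> 0 < e -> e <= 1 ->
  (forall t, 0 < t < e -> g 0%N t = h 0%N t) -> (j < l.*2)%N -> g j 0 = h j 0.
Proof.
move=> hg hh e0 e1 gh jl.
by rewrite -(tr0_W2 hg e0 e1 (u := g 0%N)) // (tr0_W2 hh e0 e1 gh).
Qed.

Lemma jet1_local (e : R) g h j : W2 g -> W2 h -> 0 <= e -> e < 1 ->
  (forall t, e < t < 1 -> g 0%N t = h 0%N t) -> (j < l.*2)%N -> g j 1 = h j 1.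
Proof.
move=> hg hh e0 e1 gh jl.
by rewrite -(tr1_W2 hg e0 e1 (u := g 0%N)) // (tr1_W2 hh e0 e1 gh).
Qed.

Definition zchain : nat -> R -> R := fun _ _ => 0.

Lemma W2_0 : W2 zchain.
Proof.
split=> [j _ t /andP[t0 t1]|j _]; last exact: L01_cst.
by rewrite /prim Rintegral_cst // mul0r addr0.
Qed.

Lemma fd0 t : fd zchain t = 0.
Proof.
have := fdZ l P 0 zchain t; rewrite mul0r => <-; congr (fd _ t).
by apply/funext => j; apply/funext => x; rewrite /zchain mulr0.
Qed.

Definition onec : nat -> R -> R := fun j _ => (j == 0%N)%:R.

Lemma W2_1 : W2 onec.
Proof.
split=> [j _ t /andP[t0 t1]|j _]; last exact: L01_cst.
by rewrite /prim /onec Rintegral_cst // mul0r addr0.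
Qed.

Lemma Leib1 (Q : nat -> R -> R) i k n t : (0 < n)%N -> Leib Q onec i k n t = 0.
Proof.
elim: i k n => [|i ih] k [//|n] _ /=; first by rewrite /onec mulr0.
by rewrite !ih // addr0.
Qed.

Lemma fd1 t : (forall t, 0 <= t <= 1 -> p 0%N t = 0) -> 0 <= t <= 1 -> fd onec t = 0.
Proof.
move=> hp0 t01; rewrite fdE Leib1 // mulr0 add0r big1 // => -[[|j] jl] _; last by rewrite Leib1.
rewrite /=.
by rewrite (hP (leq0n _)).2 hp0 // mul0r.
Qed.

Lemma fd_zero (a b : R) g : W2 g -> (forall t, a < t < b -> g 0%N t = 0) ->
  ae01 (fun t => a < t < b -> fd g t = 0).
Proof.
move=> hg g0; have := fd_local hg W2_0 g0; apply: ae01_mono => t _ h tab.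
by rewrite h // fd0.
Qed.

Lemma dom_compact (A C : 'M[R]_(l.*2)) (a b : R) g : W2 g -> 0 < a -> a <= 1 -> 0 <= b -> b < 1 ->
  (forall t, 0 < t < a -> g 0%N t = 0) -> (forall t, b < t < 1 -> g 0%N t = 0) ->
  dom A C g.
Proof.
move=> hg a0 a1 b0 b1 ga gb; split => // nu; rewrite /jform big1 // => j _.
by rewrite (jet0_local hg W2_0 a0 a1 ga) // (jet1_local hg W2_0 b0 b1 gb) // !mulr0 addr0.
Qed.

(** The Leibniz list of the product th u, when g lists the derivatives of u. *)
Definition mulc (th : R -> R) g : nat -> R -> R := fun i => Leib (fun j => derive1n j th) g i 0 0.

Lemma W2_mulc th g : smooth th -> W2 g -> W2 (mulc th g).
Proof.
move=> sth hg; apply: (@Leib_wder _ _ _ _ l.*2 0) => //.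
by apply: smooth_wder => //; right.
Qed.

Lemma mulc0 th g t : mulc th g 0%N t = th t * g 0%N t. Proof. by []. Qed.

Definition lpart (s : R) g : nat -> R -> R := fun j => g j \_ `[0, s].

(** Cutting at s creates no jump, because all derivatives of order below 2l vanish there; the top
    one is only square integrable and may be cut freely. *)
Lemma W2_lpart s g : 0 <= s -> s <= 1 -> W2 g -> (forall j, (j < l.*2)%N -> g j s = 0) ->
  W2 (lpart s g).
Proof.
move=> s0 s1 [g1 g2] gs.
have ig j : (j <= l.*2)%N -> integrable01 (g j) by move=> jl; apply: (L01_integrable q2); exact: g2.
split=> [j jl t /andP[t0 t1]|j jl].
  have z0 : lpart s g j 0 = g j 0 by rewrite /lpart restr_in //= in_itv /= lexx.
  rewrite z0; have [ts|ts] := leP t s.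
    rewrite {1}/lpart restr_in ?(g1 j jl t) ?t0 //=; last by rewrite in_itv /= t0.
    congr (_ + _); apply: eq_prim => // x /andP[x0 xt].
    by rewrite /lpart restr_in //= in_itv /= x0 (le_trans xt).
  rewrite {1}/lpart restr_notin; last by rewrite /= in_itv /= t0 /=; apply/negP; rewrite -ltNge.
  have -> : prim (lpart s g j.+1) t = prim (g j.+1) s.
    rewrite !prim_int01 //; apply: eq_int01 => x /andP[x0 x1].
    have [xs|xs] := leP x s.
      rewrite restr_in ?restr_in //= ?in_itv /= ?x0 ?xs ?(le_trans xs (ltW ts)) //.
      by rewrite /lpart restr_in //= in_itv /= x0.
    rewrite [RHS]restr_notin; last by rewrite /= in_itv /= x0 /=; apply/negP; rewrite -ltNge.
    rewrite patchE; case: ifP => // _.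
    by rewrite /lpart restr_notin // /= in_itv /= x0 /=; apply/negP; rewrite -ltNge.
  by rewrite -(g1 j jl s) ?s0 // gs.
apply/L2P; have /L2P[mg ig2] := g2 _ jl; split.
  by apply: integrable01_meas; apply: integrable01_restr => //; exact: ig.
apply: (@eq_integrable01 _ ((fun t => g j t ^+ 2) \_ `[0, s])).
  by move=> t _; rewrite /lpart !patchE; case: ifP => // _; rewrite expr0n.
exact: integrable01_restr.
Qed.

Variables (A C : 'M[R]_(l.*2)).
Hypothesis hsa : selfadjoint_op p A C.
Local Notation dom := (@dom R l A C).

Lemma dom_sym g h : dom g -> dom h ->
  int01 (fun t => fd g t * h 0%N t) = int01 (fun t => g 0%N t * fd h t).
Proof.
move=> hg hh; have := hsa (W2_L2 hh.1 (leq0n _)) (fd_L2 hl hP hh.1).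
move=> [_ /(_ _)]; apply; last exact: op_graph_dom.
by exists (h 0%N); [exact: ae01W|exact: op_graph_dom].
Qed.

(** The maximality half of self-adjointness: a pair of L2 functions satisfying the adjoint relation
    comes from the domain. All regularity obtained from weak information enters through it. *)
Lemma dom_adjoint v f : L01 2%:E v -> L01 2%:E f ->
  (forall g, dom g -> int01 (fun t => fd g t * v t) = int01 (fun t => g 0%N t * f t)) ->
  exists h, [/\ dom h, ae01 (fun t => v t = h 0%N t) & ae01 (fun t => fd h t = f t)].
Proof.
move=> Lv Lf H; have [+ _] := hsa Lv Lf; case.
  move=> u f' /(op_graphP hl hP)[g [hg ug Lf' gf]].
  have -> : int01 (fun t => u t * f t) = int01 (fun t => g 0%N t * f t).
    by apply: eq_int01 => t /ug ->.
  rewrite -H //; apply: int01_ae.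
  - by apply: measurable_funM; [exact: L01_meas Lf'|exact: L01_meas Lv].
  - by apply: measurable_funM; [exact: L01_meas (fd_L2 hl hP hg.1)|exact: L01_meas Lv].
  - by apply: ae01_mono gf => t _ ->.
move=> u vu /(op_graphP hl hP)[g [hg ug _ gf]]; exists g; split => //.
by apply: ae01_mono vu => t t01 ->; exact: ug.
Qed.

(** Integration by parts for functions outside the domain. Cutting g off near 1, where h vanishes,
    and h off near 0, where g vanishes, changes neither integral, and the cut functions vanish near
    both endpoints, hence satisfy every boundary condition. *)
Lemma dom_sym_support (a b : R) g h : 0 < a -> a <= b -> b < 1 -> W2 g -> W2 h ->
  (forall t, 0 < t < a -> g 0%N t = 0) -> (forall t, b < t < 1 -> h 0%N t = 0) ->
  int01 (fun t => fd g t * h 0%N t) = int01 (fun t => g 0%N t * fd h t).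
Proof.
move=> a0 ab b1 hg hh g0 h0.
have [th1 [s1 _ l1 r1]] := @smooth_step R (a / 3) (a / 2) ltac:(lra).
have [th2 [s2 _ l2 r2]] := @smooth_step R ((1 + b) / 2) ((2 + b) / 3) ltac:(lra).
have [th3 [s3 _ r3 l3]] : exists th : R -> R, [/\ smooth th, True,
      (forall x, x <= (1 + b) / 2 -> th x = 1) & forall x, (2 + b) / 3 <= x -> th x = 0].
  exists (fun x => 1 + (-1) * th2 x); split => //.
  - by move=> n; apply: CnD; [exact: Cn_cst|apply: CnZ; exact: s2].
  - by move=> x hx; rewrite l2 // mulr0 addr0.
  - by move=> x hx; rewrite r2 // mulr1 subrr.
pose g' := mulc th3 g; pose h' := mulc th1 h.
have hg' : W2 g' by exact: W2_mulc.
have hh' : W2 h' by exact: W2_mulc.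
have dg' : dom g'.
  apply: (@dom_compact A C a ((2 + b) / 3)) => //; try lra.
  - by move=> t ta; rewrite /g' mulc0 g0 // mulr0.
  - by move=> t ta; rewrite /g' mulc0 l3 ?mul0r //; lra.
have dh' : dom h'.
  apply: (@dom_compact A C (a / 3) b) => //; try lra.
  - by move=> t ta; rewrite /h' mulc0 l1 ?mul0r //; lra.
  - by move=> t ta; rewrite /h' mulc0 h0 // mulr0.
have m W W' : W2 W -> W2 W' -> measurable_fun `[(0:R), 1] (fun t => fd W t * W' 0%N t).
  move=> hW hW'; apply: measurable_funM; first exact: L01_meas (fd_L2 hl hP hW).
  exact: L01_meas (W2_L2 hW' (leq0n _)).
have m' W W' : W2 W -> W2 W' -> measurable_fun `[(0:R), 1] (fun t => W' 0%N t * fd W t).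
  move=> hW hW'; apply: measurable_funM; last exact: L01_meas (fd_L2 hl hP hW).
  exact: L01_meas (W2_L2 hW' (leq0n _)).
have gg' t : t < (1 + b) / 2 -> g' 0%N t = g 0%N t.
  by move=> tb; rewrite /g' mulc0 r3 ?mul1r //; lra.
have hh'e t : a / 2 < t -> h' 0%N t = h 0%N t.
  by move=> tb; rewrite /h' mulc0 r1 ?mul1r //; lra.
have E1 : int01 (fun t => fd g t * h 0%N t) = int01 (fun t => fd g' t * h' 0%N t).
  apply: int01_ae; [exact: m|exact: m|].
  have z1 := fd_zero hg g0.
  have z2 := @fd_zero 0 a g' hg' (fun t ta => etrans (gg' t ltac:(lra)) (g0 t ta)).
  have z3 := @fd_local 0 ((1 + b) / 2) g' g hg' hg (fun t ta => gg' t ltac:(lra)).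
  apply: ae01_oo_mono (ae01_and z1 (ae01_and z2 z3)) => t t01 [e1 [e2 e3]].
  have [ta|ta] := ltP t a; first by rewrite e1 ?e2 ?mul0r //; lra.
  rewrite hh'e; last by lra.
  have [tb|tb] := ltP b t; first by rewrite h0 ?mulr0 //; lra.
  by rewrite e3 //; lra.
have E2 : int01 (fun t => g 0%N t * fd h t) = int01 (fun t => g' 0%N t * fd h' t).
  apply: int01_ae; [exact: m'|exact: m'|].
  have z1 := fd_zero hh h0.
  have z2 := @fd_zero b 1 h' hh' (fun t ta => etrans (hh'e t ltac:(lra)) (h0 t ta)).
  have z3 := @fd_local (a / 2) 1 h' h hh' hh (fun t ta => hh'e t ltac:(lra)).
  apply: ae01_oo_mono (ae01_and z1 (ae01_and z2 z3)) => t t01 [e1 [e2 e3]].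
  have [ta|ta] := ltP b t; first by rewrite e1 ?e2 ?mulr0 //; lra.
  rewrite gg'; last by lra.
  have [tb|tb] := ltP t a; first by rewrite g0 ?mul0r //; lra.
  by rewrite e3 //; lra.
by rewrite E1 E2; exact: dom_sym.
Qed.

End locality.

(** * Green's formula *)

Section green.
Context {R : realType}.
Implicit Types (f u v : R -> R) (g h : nat -> R -> R).
Variables (l : nat) (p : nat -> R -> R) (P : nat -> nat -> R -> R).
Hypotheses (hl : (0 < l)%N) (hP : coef_chain l p P).
Variables (A C : 'M[R]_(l.*2)).
Hypothesis hsa : selfadjoint_op p A C.
Hypothesis hp0 : forall t, 0 <= t <= 1 -> p 0%N t = 0.
Variables (m : nat) (phi : 'I_m -> R -> R).
Hypothesis hphi : forall i, L01 2%:E (phi i).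
Variables (G : R -> R -> R) (s : R).
Hypotheses (s0 : 0 < s) (s1 : s < 1).
Hypothesis cG : {within `[0, 1], continuous (G ^~ s)}.
Variables (g0 g1 : nat -> R -> R).
Let q2 : exponent_ok (2%:E : \bar R). Proof. by left. Qed.
Local Notation W2 := (W2 l).
Local Notation fd := (fd l P).
Local Notation dom := (@dom R l A C).
Hypotheses (hg0 : W2 g0) (hg1 : W2 g1).
Hypothesis Gg0 : forall t, 0 <= t <= s -> G t s = g0 0%N t.
Hypothesis Gg1 : forall t, s <= t <= 1 -> G t s = g1 0%N t.
Hypothesis hbc : satisfies_bc A C (G ^~ s).
Hypothesis hgreen : green_equation l p phi G s.

Let rhs t := \sum_i phi i s * phi i t.

Let G2 : L01 2%:E (G ^~ s). Proof. exact: L01_continuous. Qed.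

Let rhs2 : L01 2%:E rhs.
Proof.
have H (I : seq 'I_m) : L01 2%:E (fun t => \sum_(i <- I) phi i s * phi i t).
  elim: I => [|i I ih]; first by under eq_fun do rewrite big_nil; exact: L01_cst.
  by under eq_fun do rewrite big_cons; apply: L01D => //; exact: L01Z.
exact: H.
Qed.

Lemma int01_rhs v : L01 2%:E v ->
  int01 (fun t => rhs t * v t) = \sum_i phi i s * int01 (fun t => phi i t * v t).
Proof.
move=> Lv; rewrite (eq_int01 (g := fun t => \sum_i phi i s * (phi i t * v t))); last first.
  by move=> t _; rewrite /rhs mulr_suml; apply: eq_bigr => i _; rewrite mulrA.
have H i : integrable01 (fun t => phi i t * v t) by exact: L2_mul.
rewrite int01_sum; last by move=> i; exact: integrable01Z.
by apply: eq_bigr => i _; rewrite int01Z.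
Qed.

Definition jets (eta : R -> R) : nat -> R -> R := fun j => derive1n j eta.

Lemma W2_jets eta : smooth eta -> W2 (jets eta).
Proof. exact: smooth_wder. Qed.

Lemma green_smooth eta (a b : R) : smooth eta -> 0 < a -> b < 1 ->
  (forall x, ~~ (a <= x <= b) -> eta x = 0) ->
  int01 (fun t => G t s * fd (jets eta) t) =
  eta s - \sum_i phi i s * int01 (fun t => phi i t * eta t).
Proof.
move=> se a0 b1 ez; apply: hgreen.
- by split; [exact: smooth_derivable|exists a, b].
- exact: (fd_L2 hl hP (W2_jets se)).
- exact: (Lop_fd hl hP (W2_jets se)).
Qed.

Lemma measM u v : L01 2%:E u -> L01 2%:E v ->
  measurable_fun `[(0:R), 1] (fun t => u t * v t).
Proof. by move=> hu hv; apply: measurable_funM; apply: L01_meas; [exact: hu|exact: hv]. Qed.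

Lemma dom_jets eta (a b : R) : smooth eta -> 0 < a -> b < 1 ->
  (forall x, ~~ (a <= x <= b) -> eta x = 0) -> dom (jets eta).
Proof.
move=> se a0 b1 ez.
apply: (@dom_compact R l A C (Num.min a 1) (Num.max b 0)).
- exact: W2_jets.
- by rewrite lt_min a0 ltr01.
- by rewrite ge_min lexx orbT.
- by rewrite le_max lexx orbT.
- by rewrite gt_max b1 ltr01.
- move=> t; rewrite lt_min => /andP[_ /andP[ta _]]; apply: ez.
  by rewrite negb_and -ltNge ta.
- move=> t; rewrite gt_max => /andP[/andP[tb _] _]; apply: ez.
  by rewrite negb_and -!ltNge tb orbT.
Qed.

(** Test functions supported in ]a, b[ do not see the point mass at s. For them the operator can be
    moved back onto v, made an element of the domain by a plateau equal to 1 on the support, and the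
    fundamental lemma concludes. *)
Lemma green_local (a b : R) (v : nat -> R -> R) : 0 <= a -> b <= 1 -> s <= a \/ b <= s ->
  W2 v -> (forall t, a < t < b -> G t s = v 0%N t) ->
  ae01 (fun t => a < t < b -> fd v t = - rhs t).
Proof.
move=> a0 b1 sab hv Gv.
have L1 : L01 2%:E (fun t => fd v t + rhs t) by apply: L01D => //; exact: (fd_L2 hl hP hv).
suff H : ae01 (fun t => a < t < b -> fd v t + rhs t = 0).
  by apply: ae01_mono H => t _ h /h /eqP; rewrite addr_eq0 => /eqP.
apply: fundamental_lemma => //; first exact: (L01_integrable q2).
move=> eta a' b' se aa' bb' ez.
(* The prescribed support may be empty; then eta = 0 and there is no plateau to build. *)
have [ba'|ab'] := ltP b' a'.
  rewrite -[RHS](int01_cst 0); apply: eq_int01 => t _; rewrite ez ?mulr0 //.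
  by apply/negP => /andP[? ?]; lra.
have [chi [sc _ c0 c1]] := @smooth_plateau R ((a + a') / 2) a' b' ((b + b') / 2) ltac:(lra) ltac:(lra).
pose w := mulc chi v.
have hw : W2 w by exact: W2_mulc.
have dw : dom w.
  apply: (@dom_compact R l A C ((a + a') / 2) ((b + b') / 2)) => //; try lra.
  - by move=> t tt; rewrite /w mulc0 c0 ?mul0r //; apply/negP => /andP[? ?]; lra.
  - by move=> t tt; rewrite /w mulc0 c0 ?mul0r //; apply/negP => /andP[? ?]; lra.
have wv t : a' <= t <= b' -> w 0%N t = v 0%N t by move=> tt; rewrite /w mulc0 c1 // mul1r.
have de : dom (jets eta) by apply: (dom_jets se _ _ ez); lra.
have Le : L01 2%:E eta := W2_L2 de.1 (leq0n _).
have es : eta s = 0 by apply: ez; apply/negP => /andP[? ?]; case: sab => ?; lra.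
have := @green_smooth eta a' b' se ltac:(lra) ltac:(lra) ez; rewrite es sub0r => E.
rewrite (eq_int01 (g := fun t => fd v t * eta t + rhs t * eta t)); last by move=> t _; rewrite mulrDl.
rewrite int01D; [|by apply: L2_mul => //; exact: (fd_L2 hl hP hv)|exact: L2_mul].
rewrite int01_rhs // -[X in _ + X]opprK -E.
have -> : int01 (fun t => G t s * fd (jets eta) t) = int01 (fun t => w 0%N t * fd (jets eta) t).
  apply: int01_ae.
  - by apply: measM => //; exact: (fd_L2 hl hP de.1).
  - by apply: measM; [exact: W2_L2 hw (leq0n _)|exact: (fd_L2 hl hP de.1)].
  have z1 := @fd_zero R l p P hl hP 0 a' _ de.1 (fun t tt => ez t ltac:(apply/negP => /andP[? ?]; lra)).
  have z2 := @fd_zero R l p P hl hP b' 1 _ de.1 (fun t tt => ez t ltac:(apply/negP => /andP[? ?]; lra)).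
  apply: ae01_oo_mono (ae01_and z1 z2) => t t01 [h1 h2].
  have [ta|ta] := ltP t a'; first by rewrite h1 ?mulr0 //; lra.
  have [tb|tb] := ltP b' t; first by rewrite h2 ?mulr0 //; lra.
  by rewrite wv ?Gv //; lra.
rewrite -(dom_sym hl hP hsa dw de).
have -> : int01 (fun t => fd v t * eta t) = int01 (fun t => fd w t * jets eta 0%N t).
  apply: int01_ae.
  - by apply: measM => //; exact: (fd_L2 hl hP hv).
  - by apply: measM => //; exact: (fd_L2 hl hP hw).
  have z1 := @fd_local R l p P hl hP a' b' _ _ hw hv (fun t tt => wv t ltac:(lra)).
  apply: ae01_mono (ae01_and z1 (ae01_and (ae01_neq a') (ae01_neq b'))) => t t01 [h1 [ta tb]].
  change (fd v t * eta t = fd w t * eta t).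
  have [ta'|ta'] := ltP t a'; first by rewrite ez ?mulr0 //; apply/negP => /andP[? ?]; lra.
  have [tb'|tb'] := ltP b' t; first by rewrite ez ?mulr0 //; apply/negP => /andP[? ?]; lra.
  by rewrite h1 // !lt_neqAle ta' tb' eq_sym ta tb.
by rewrite subrr.
Qed.

(* The boundary conditions only involve G(.,s) near 0 and near 1. *)
Lemma glue_ex : exists w (a b : R), [/\ dom w, 0 < a /\ a < s, s < b /\ b < 1,
  forall t, t <= a -> w 0%N t = g0 0%N t & forall t, b <= t -> w 0%N t = g1 0%N t].
Proof.
have [s0' s1'] := (s0, s1).
have [th [st _ t0 t1]] := @smooth_step R (s / 2) ((1 + s) / 2) ltac:(lra).
(* This interpolates (1 - th) g0 + th g1: it is g0 near 0 and g1 near 1, and it has no singularity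
   at s. *)
pose w := fun j t => mulc th g1 j t + (g0 j t + (-1) * mulc th g0 j t).
have hc1 : W2 (mulc th g1) by exact: W2_mulc.
have hc0 : W2 (mulc th g0) by exact: W2_mulc.
have hw : W2 w by apply: W2D => //; apply: W2D => //; exact: W2Z.
have w0 t : t <= s / 2 -> w 0%N t = g0 0%N t.
  by move=> ts; rewrite /w !mulc0 t0 // !mul0r mulr0 addr0 add0r.
have w1 t : (1 + s) / 2 <= t -> w 0%N t = g1 0%N t.
  by move=> ts; rewrite /w !mulc0 t1 // !mul1r mulN1r subrr addr0.
exists w, (s / 2), ((1 + s) / 2); split; [|by split; lra|by split; lra|exact: w0|exact: w1].
split => // nu; rewrite -(hbc nu); symmetry.
apply: (@bform_jform R l A C nu _ w w (s / 2) ((1 + s) / 2)) => //; try lra.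
- by move=> t tt; rewrite w0 ?Gg0 //; lra.
- by move=> t tt; rewrite w1 ?Gg1 //; lra.
Qed.

(** Cut r at s into r0 + r1, and write G(.,s) as w + k0 to the left of s and as w + k1 to the right.
    The pairs (k0, r0) and (r1, k1) have the supports that [dom_sym_support] requires, and (w, r)
    lies in the domain; so all three are symmetric, and [green_local] evaluates L on either side of
    s. *)
Lemma green_zero_jet r : dom r -> (forall j, (j < l.*2)%N -> r j s = 0) ->
  int01 (fun t => G t s * fd r t) = - \sum_i phi i s * int01 (fun t => phi i t * r 0%N t).
Proof.
move=> dr rs; have hr := dr.1; have [s0' s1'] := (s0, s1).
have [w [a [b [dw [a0 as_] [sb b1] wg0 wg1]]]] := glue_ex; have hw := dw.1.
pose r0 := lpart s r; pose r1 := fun j t => r j t + (-1) * r0 j t.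
have hr0 : W2 r0 by apply: W2_lpart => //; exact: ltW.
have hr1 : W2 r1 by apply: W2D => //; exact: W2Z.
pose k0 := fun j t => g0 j t + (-1) * w j t; pose k1 := fun j t => g1 j t + (-1) * w j t.
have hk0 : W2 k0 by apply: W2D => //; exact: W2Z.
have hk1 : W2 k1 by apply: W2D => //; exact: W2Z.
have r0z t : s < t -> r0 0%N t = 0.
  move=> st; rewrite /r0 /lpart restr_notin //= in_itv /= => /andP[_]; lra.
have r1z t : 0 <= t < s -> r1 0%N t = 0.
  by move=> /andP[t0 ts]; rewrite /r1 /r0 /lpart restr_in ?mulN1r ?subrr //= in_itv /= t0 ltW.
have fr1 t : fd r1 t = fd r t - fd r0 t by rewrite /r1 fdD fdZ mulN1r.
have fk0 t : fd k0 t = fd g0 t - fd w t by rewrite /k0 fdD fdZ mulN1r.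
have fk1 t : fd k1 t = fd g1 t - fd w t by rewrite /k1 fdD fdZ mulN1r.
have rE t : r 0%N t = r0 0%N t + r1 0%N t by rewrite /r1 mulN1r addrC subrK.
have L W : W2 W -> L01 2%:E (W 0%N) by move=> h; exact: W2_L2 h (leq0n _).
have Lf W : W2 W -> L01 2%:E (fd W) by move=> h; exact: (fd_L2 hl hP h).
have S0 : int01 (fun t => fd k0 t * r0 0%N t) = int01 (fun t => k0 0%N t * fd r0 t).
  apply: (@dom_sym_support R l p P hl hP A C hsa a s) => //; try lra.
  - by move=> t ta; rewrite /k0 wg0 ?mulN1r ?subrr //; lra.
  - by move=> t ta; rewrite r0z //; lra.
have S1 : int01 (fun t => fd r1 t * k1 0%N t) = int01 (fun t => r1 0%N t * fd k1 t).
  apply: (@dom_sym_support R l p P hl hP A C hsa s b) => //; try lra.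
  - by move=> t ta; rewrite r1z //; lra.
  - by move=> t ta; rewrite /k1 wg1 ?mulN1r ?subrr //; lra.
have S2 := dom_sym hl hP hsa dw dr.
have z0 := @fd_zero R l p P hl hP s 1 _ hr0 (fun t tt => r0z t ltac:(lra)).
have z1 := @fd_zero R l p P hl hP 0 s _ hr1 (fun t tt => r1z t ltac:(lra)).
have E1 : int01 (fun t => G t s * fd r t) =
    int01 (fun t => k0 0%N t * fd r0 t) + (int01 (fun t => fd r1 t * k1 0%N t)
      + int01 (fun t => w 0%N t * fd r t)).
  rewrite -int01D; [|by apply: L2_mul; auto|by apply: L2_mul; auto].
  rewrite -int01D; [|by apply: L2_mul; auto|by apply: integrable01D; apply: L2_mul; auto].
  apply: int01_ae.
  - by apply: measM; auto.
  - by do 2 (apply: measurable_funD; first by apply: measM; auto); apply: measM; auto.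
  apply: ae01_oo_mono (ae01_and (ae01_neq s) (ae01_and z0 z1)) => t t01 [ts [h0 h1]].
  have [tls|slt|/eqP] := ltgtP t s; last by rewrite (negbTE ts).
  - have e : fd r t = fd r0 t by have := fr1 t; rewrite h1; lra.
    rewrite h1 ?mul0r ?add0r; last by lra.
    rewrite Gg0; last by lra.
    by rewrite e /k0; ring.
  - have e : fd r t = fd r1 t by have := fr1 t; rewrite h0; lra.
    rewrite h0 ?mulr0 ?add0r; last by lra.
    rewrite Gg1; last by lra.
    by rewrite e /k1; ring.
rewrite E1 -S0 S1 -S2.
have c0 : ae01 (fun t => 0 < t < s -> fd g0 t = - rhs t).
  by apply: green_local => //; [exact: ltW|by right|move=> t /andP[? ?]; apply: Gg0; rewrite !ltW].
have c1 : ae01 (fun t => s < t < 1 -> fd g1 t = - rhs t).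
  by apply: green_local => //; [exact: ltW|by left|move=> t /andP[? ?]; apply: Gg1; rewrite !ltW].
rewrite -int01_rhs; last exact: L.
rewrite -int01D; [|by apply: L2_mul; auto|by apply: L2_mul; auto].
rewrite -int01D; [|by apply: L2_mul; auto|by apply: integrable01D; apply: L2_mul; auto].
rewrite -[RHS]mulN1r -int01Z; last by apply: L2_mul; auto.
apply: int01_ae.
- by do 2 (apply: measurable_funD; first by apply: measM; auto); apply: measM; auto.
- by apply: measurable_funM => //; apply: measM; auto.
apply: ae01_oo_mono (ae01_and (ae01_neq s) (ae01_and c0 c1)) => t t01 [ts [h0 h1]].
have [tls|slt|/eqP] := ltgtP t s; last by rewrite (negbTE ts).
- rewrite fk0 h0; last by lra.
  rewrite (rE t) (r1z t) ?mul0r; last by lra.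
  by rewrite mulN1r; ring.
- rewrite fk1 h1; last by lra.
  rewrite (rE t) (r0z t) ?mulr0; last by lra.
  by rewrite mulN1r; ring.
Qed.

(* A function of the domain is the sum of a test function and of a function whose
   jet vanishes at s, and the latter can be cut at s. *)
Lemma green_dom g : dom g ->
  int01 (fun t => G t s * fd g t) = g 0%N s - \sum_i phi i s * int01 (fun t => phi i t * g 0%N t).
Proof.
move=> dg; have hg := dg.1; have [s0' s1'] := (s0, s1).
have [q sq qj] := smooth_jet s (fun j => g j s) l.*2.
have s23 : s / 3 < s / 2 by lra.
have s13 : (1 + s) / 2 < (2 + s) / 3 by lra.
have [chi [sc _ c0 c1]] := smooth_plateau s23 s13.
pose eta x := chi x * q x.
have se : smooth eta by move=> n; apply: CnM; [exact: sc|exact: sq].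
have ez x : ~~ (s / 3 <= x <= (2 + s) / 3) -> eta x = 0.
  by move=> h; rewrite /eta c0 ?mul0r //; apply: contra h => /andP[? ?]; lra.
have de : dom (jets eta) by apply: (dom_jets se _ _ ez); lra.
have ej j : (j < l.*2)%N -> jets eta j s = g j s.
  move=> jl; rewrite -qj // /jets.
  apply: (@derive1n_eq_oo R (s / 2) ((1 + s) / 2)); last by lra.
  by move=> x hx; rewrite /eta c1 ?mul1r //; lra.
pose r := fun j t => g j t + (-1) * jets eta j t.
have dr : dom r by apply: domD => //; exact: domZ.

have rs j : (j < l.*2)%N -> r j s = 0 by move=> jl; rewrite /r ej // mulN1r subrr.
have Ee := @green_smooth eta (s / 3) ((2 + s) / 3) se ltac:(lra) ltac:(lra) ez.
have Lf W : W2 W -> L01 2%:E (fd W) by move=> h; exact: (fd_L2 hl hP h).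
have L W : W2 W -> L01 2%:E (W 0%N) by move=> h; exact: W2_L2 h (leq0n _).
have Le : L01 2%:E eta := W2_L2 de.1 (leq0n _).
have -> : int01 (fun t => G t s * fd g t) =
    int01 (fun t => G t s * fd r t) + int01 (fun t => G t s * fd (jets eta) t).
  rewrite -int01D; [|by apply: L2_mul => //; apply: Lf; case: dr|by apply: L2_mul => //; apply: Lf; case: de].
  by apply: eq_int01 => t _; rewrite /r fdD fdZ; ring.
rewrite (green_zero_jet dr rs) Ee.
have -> : eta s = g 0%N s by rewrite -(ej 0%N) // double_gt0.
rewrite addrCA -opprD; congr (_ - _); rewrite -big_split; apply: eq_bigr => i _ /=.
rewrite -mulrDr; congr (_ * _).
rewrite -int01D; [|by apply: L2_mul => //; apply: L; case: dr|by apply: L2_mul => //; exact: Le].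
by apply: eq_int01 => t _; rewrite /r /jets /=; ring.
Qed.

(** The integral of L w is the flux of G(.,s) through the two endpoints. It is computed by writing 1
    = chi + (1 - chi) with a plateau chi equal to 1 on [a, b]: the first part is the Green equation
    tested on chi, and on the second w is G(.,s), where L is known by [green_local]. *)
Lemma green_glue_int : exists w (a b : R), [/\ dom w, 0 < a /\ a < s, s < b /\ b < 1,
  forall t, 0 <= t <= 1 -> (t <= a) || (b <= t) -> G t s = w 0%N t
  & int01 (fd w) = 1 - \sum_i phi i s * int01 (phi i)].
Proof.
have [s0' s1'] := (s0, s1).
have [w [a [b [dw [a0 as_] [sb b1] wg0 wg1]]]] := glue_ex; have hw := dw.1.
have Gw t : 0 <= t <= 1 -> (t <= a) || (b <= t) -> G t s = w 0%N t.
  move=> t01 /orP[ta|tb]; first by rewrite wg0 // Gg0 //; lra.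
  by rewrite wg1 // Gg1 //; lra.
exists w, a, b; split => //.
have [chi [sc _ c0 c1]] := @smooth_plateau R (a / 2) a b ((1 + b) / 2) ltac:(lra) ltac:(lra).
have ez x : ~~ (a / 2 <= x <= (1 + b) / 2) -> chi x = 0.
  by move=> h; rewrite c0 //; apply: contra h => /andP[? ?]; lra.
have dc : dom (jets chi) by apply: (dom_jets sc _ _ ez); lra.
have Lc : L01 2%:E chi := W2_L2 dc.1 (leq0n _).
have Lfw : L01 2%:E (fd w) by exact: (fd_L2 hl hP hw).
have Lfc : L01 2%:E (fd (jets chi)) by exact: (fd_L2 hl hP dc.1).
have L1 : L01 2%:E (fun t => 1 - chi t).
  apply: (@eq_L01 _ _ (fun t => 1 + (-1) * chi t)) => //; first by move=> t _; rewrite mulN1r.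
  by apply: L01D => //; [exact: L01_cst|exact: L01Z].
rewrite (eq_int01 (g := fun t => fd w t * chi t + fd w t * (1 - chi t))); last by move=> t _; ring.
rewrite int01D; [|exact: L2_mul|exact: L2_mul].
rewrite (dom_sym hl hP hsa dw dc).
have -> : int01 (fun t => w 0%N t * fd (jets chi) t) = int01 (fun t => G t s * fd (jets chi) t).
  (* Between a and b, where w differs from G(.,s), chi is constant and L chi = 0 because p_0 = 0. *)
  have z := @fd_local R l p P hl hP a b _ _ dc.1 (W2_1 l) (fun t tt => c1 t ltac:(lra)).
  apply: int01_ae.
  - by apply: measM => //; exact: W2_L2 hw (leq0n _).
  - exact: measM.
  apply: ae01_mono (ae01_and z (ae01_and (ae01_neq a) (ae01_neq b))) => t t01 [h [ta tb]].
  have [ta'|ta'] := leP t a; first by rewrite Gw // ta'.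
  have [tb'|tb'] := leP b t; first by rewrite Gw // tb' orbT.
  have tab : a < t < b by rewrite ta' tb'.
  by rewrite (h tab) (fd1 hl hP hp0 t01) !mulr0.
rewrite (@green_smooth chi (a / 2) ((1 + b) / 2)) //; [|lra|lra].
rewrite c1; last by lra.
have -> : int01 (fun t => fd w t * (1 - chi t)) = - int01 (fun t => rhs t * (1 - chi t)).
  rewrite -[RHS]mulN1r -int01Z; last exact: L2_mul.
  have d0 : ae01 (fun t => 0 < t < a -> fd w t = - rhs t).
    apply: green_local => //; [lra|by right; lra|move=> t ta; apply: Gw; first lra].
    by apply/orP; left; lra.
  have d1 : ae01 (fun t => b < t < 1 -> fd w t = - rhs t).
    apply: green_local => //; [lra|by left; lra|move=> t ta; apply: Gw; first lra].
    by apply/orP; right; lra.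
  apply: int01_ae; [exact: measM|by apply: measurable_funM => //; exact: measM|].
  apply: ae01_oo_mono (ae01_and d0 d1) => t t01 [h0 h1].
  have [ta|ta] := ltP t a; first by rewrite h0 ?mulNr ?mulN1r //; lra.
  have [tb|tb] := ltP b t; first by rewrite h1 ?mulNr ?mulN1r //; lra.
  by rewrite c1 ?subrr ?mulr0 //; lra.
rewrite int01_rhs // -addrA -opprD; congr (_ - _).
rewrite -big_split; apply: eq_bigr => i _ /=; rewrite -mulrDr; congr (_ * _).
by rewrite -int01D; [apply: eq_int01 => t _; ring|exact: L2_mul|exact: L2_mul].
Qed.

End green.

(** * The mean of the Green function *)

Section grid.
Context {R : realType}.

Definition node (n k : nat) : R := k%:R / n.+1%:R.
Definition cell (n k : nat) (x : R) : R := \1_(`[node n k, node n k.+1[%classic) x.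

Lemma node01 n k : (k <= n.+1)%N -> 0 <= node n k <= 1.
Proof. by move=> kn; rewrite divr_ge0 //= ler_pdivrMr // mul1r ler_nat. Qed.

Lemma cellE n k x : cell n k x = (node n k <= x)%R%:R - (node n k.+1 <= x)%R%:R.
Proof.
have h : node n k < node n k.+1 by rewrite ltr_pM2r ?invr_gt0 // ltr_nat.
rewrite /cell indicE mem_setE in_itv /=.
have [h1|h1] := leP (node n k) x; have [h2|h2] := leP (node n k.+1) x => //=; rewrite ?subrr ?subr0 //.
by exfalso; lra.
Qed.

(** A telescoping sum. There are n + 2 cells because they are half-open: the cell of index n + 1
    starts at 1 and covers that endpoint. *)
Lemma cell_sum n x : 0 <= x <= 1 -> \sum_(k < n.+2) cell n k x = 1.
Proof.
move=> /andP[x0 x1]; under eq_bigr do rewrite cellE -opprB.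
rewrite -(big_mkord xpredT (fun k => - ((node n k.+1 <= x)%R%:R - (node n k <= x)%R%:R))) sumrN.
rewrite telescope_sumr // opprB /node mul0r x0.
have -> : (n.+2%:R / n.+1%:R <= x) = false; last by rewrite subr0.
apply/negbTE; rewrite -ltNge; apply: le_lt_trans x1 _.
by rewrite ltr_pdivlMr // mul1r ltr_nat.
Qed.

Lemma cell_ge0 n k x : 0 <= cell n k x. Proof. by rewrite /cell indicE. Qed.

Lemma cell_near n k x : cell n k x != 0 -> `|node n k - x| < n.+1%:R^-1 * 2.
Proof.
rewrite /cell indicE mem_setE in_itv /=.
case: (boolP (node n k <= x < node n k.+1)) => [/andP[h1 h2] _|_]; last by rewrite eqxx.
have E : node n k.+1 = node n k + n.+1%:R^-1 by rewrite /node -natr1 mulrDl mul1r.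
have p : 0 < (n.+1%:R : R)^-1 by rewrite invr_gt0.
rewrite E in h2; rewrite distrC ger0_norm; last by rewrite subr_ge0.
by move: p h1 h2; set i := _^-1; set a := node n k; move=> *; lra.
Qed.

(** At each x the cells are nonnegative weights of total 1 carried by nodes near x, so the sum is an
    average of values within e of a. *)
Lemma cell_approx n (f : nat -> R) (a e x : R) : 0 <= x <= 1 ->
  (forall k, (k <= n.+1)%N -> `|node n k - x| < n.+1%:R^-1 * 2 -> `|f k - a| <= e) ->
  `|\sum_(k < n.+2) cell n k x * f k - a| <= e.
Proof.
move=> x01 H; have -> : \sum_(k < n.+2) cell n k x * f k - a = \sum_(k < n.+2) cell n k x * (f k - a).
  under [RHS]eq_bigr do rewrite mulrBr.
  by rewrite sumrB -mulr_suml cell_sum // mul1r.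
apply: le_trans (ler_norm_sum _ _ _) _.
rewrite -[leRHS]mul1r -(cell_sum n x01) mulr_suml; apply: ler_sum => k _.
rewrite normrM ger0_norm ?cell_ge0 //.
have [->|c0] := eqVneq (cell n k x) 0; first by rewrite !mul0r.
by apply: ler_wpM2l; [exact: cell_ge0|apply: H; [exact: ltn_ord k|exact: cell_near]].
Qed.

Lemma measurable_cell n k : measurable_fun setT (cell n k).
Proof. exact: measurable_indic. Qed.

Lemma unif_continuous_within (f : R -> R) :
  (forall e, 0 < e -> exists2 d, 0 < d & forall x y, 0 <= x <= 1 -> 0 <= y <= 1 ->
     `|x - y| < d -> `|f x - f y| < e) -> {within `[0, 1], continuous f}.
Proof.
move=> H; apply/subspace_continuousP => x; rewrite /= in_itv /= => x01.
apply/cvgrPdist_lt => e e0; have [d d0 hd] := H _ e0.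
exists d => //= y xy; rewrite in_itv /= => y01.
exact: hd.
Qed.

End grid.

(** * Continuous kernels on the closed square *)

Section continuous_kernel.
Context {R : realType}.
Variable G : R -> R -> R.
Hypothesis cG : {within `[(0:R), 1] `*` `[(0:R), 1], continuous (fun z : R * R => G z.1 z.2)}.

(** Heine's theorem, read off from the covering form of compactness with d tending to 0 from the
    right as the parameter. *)
Lemma square_unif (e : R) : 0 < e -> exists2 d, 0 < d &
  forall x y x' y', 0 <= x <= 1 -> 0 <= y <= 1 -> 0 <= x' <= 1 -> 0 <= y' <= 1 ->
  `|x - x'| < d -> `|y - y'| < d -> `|G x y - G x' y'| < e.
Proof.
move=> e0; pose S := `[(0:R), 1] `*` `[(0:R), 1].
have cS : compact S by apply: compact_setX; exact: segment_compact.
have /near_covering_withinP /(_ R (0^'+)) := (compact_near_coveringP S).1 cS.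
pose Q (d : R) (z : R * R) := forall x' y', S (x', y') -> `|z.1 - x'| < d -> `|z.2 - y'| < d ->
  `|G z.1 z.2 - G x' y'| < e.
move=> /(_ Q _) H; have {}H : \forall d \near (0:R)^'+, S `<=` Q d.
  apply: H => -[x y] Sxy; have /subspace_continuousP /(_ _ Sxy) := cG.
  have e2 : 0 < e / 2 by lra.
  move=> /cvgrPdist_lt /(_ _ e2) [[U V] /= [[d1 /= d10 h1] [d2 /= d20 h2]] hUV].
  have key x' y' : S (x', y') -> `|x - x'| < d1 -> `|y - y'| < d2 -> `|G x y - G x' y'| < e / 2.
    by move=> S' hx hy; apply: (hUV (x', y')) => //; split; [exact: h1|exact: h2].
  (* Halving leaves room for two displacements: from (x, y) to a neighbouring (a, b), and from there
     to (x', y'). *)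
  pose d := Num.min d1 d2 / 2; have d0 : 0 < d by rewrite divr_gt0 // lt_min d10.
  have dd1 : d + d <= d1 by rewrite -splitr ge_min lexx.
  have dd2 : d + d <= d2 by rewrite -splitr ge_min lexx orbT.
  exists ([set z : R * R | `|x - z.1| < d /\ `|y - z.2| < d], [set r | 0 < r < d]); first split => /=.
  - exists (ball x d, ball y d); first by split; exact: nbhsx_ballx.
    by move=> [a b] /= [].
  - near=> r => /=; apply/andP; split; near: r; [exact: nbhs_right_gt|exact: nbhs_right_lt].
  move=> [[a b] r] /= [[ax by_] /andP[r0 rd]] Sab x' y' S' ha hb.
  have k1 := key a b Sab ltac:(lra) ltac:(lra).
  have k2 : `|G x y - G x' y'| < e / 2.
    apply: key => //.
      by have := ler_normD (x - a) (a - x'); rewrite addrA subrK; lra.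
    by have := ler_normD (y - b) (b - y'); rewrite addrA subrK; lra.
  have := ler_normB (G x y - G x' y') (G x y - G a b).
  by rewrite opprB addrCA addrAC subrr add0r; lra.
have [d d0 hd] : exists2 d, 0 < d & S `<=` Q d.
  near (0:R)^'+ => d; exists d; near: d => //; exact: nbhs_right_gt.
exists d => // x y x' y' hx hy hx' hy'.
by apply: (hd (x, y)) => //=; split; rewrite /= in_itv.
Unshelve. all: by end_near. Qed.

Lemma kernel_section s : 0 <= s <= 1 -> {within `[0, 1], continuous (G ^~ s)}.
Proof.
move=> s01; apply: unif_continuous_within => e /square_unif[d d0 hd].
by exists d => // x y hx hy hxy; apply: hd; rewrite ?subrr ?normr0.
Qed.

Lemma kernel_section2 s : 0 <= s <= 1 -> {within `[0, 1], continuous (G s)}.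
Proof.
move=> s01; apply: unif_continuous_within => e /square_unif[d d0 hd].
by exists d => // x y hx hy hxy; apply: hd; rewrite ?subrr ?normr0.
Qed.

Lemma kernel_bounded : exists2 M : R, 0 <= M &
  forall x y, 0 <= x <= 1 -> 0 <= y <= 1 -> `|G x y| <= M.
Proof.
have cS : compact (`[(0:R), 1] `*` `[(0:R), 1]) by apply: compact_setX; exact: segment_compact.
have [M [_ hM]] := compact_bounded (continuous_compact cG cS).
exists (`|M| + 1) => [|x y x01 y01]; first by rewrite addr_ge0.
apply: hM; first by rewrite (le_lt_trans (ler_norm _)) // ltrDl.
by exists (x, y) => //; split; rewrite /= in_itv.
Qed.

Lemma node_unif (e : R) : 0 < e -> exists N, forall n, (N <= n)%N ->
  forall k x y, (k <= n.+1)%N -> 0 <= x <= 1 -> 0 <= y <= 1 -> `|node n k - x| < n.+1%:R^-1 * 2 ->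
  `|G (node n k) y - G x y| < e.
Proof.
move=> /square_unif[d d0 hd]; exists (Num.truncn (2 / d)) => n Nn k x y kn x01 y01 hk.
apply: hd => //; [exact: node01|apply: lt_le_trans hk _|by rewrite subrr normr0].
rewrite mulrC ler_pdivrMr // mulrC -ler_pdivrMr //.
by apply: le_trans (ltW (real_truncnS_gt (num_real _))) _; rewrite ler_nat.
Qed.

(** G is the pointwise limit of sums of step functions of the first variable times continuous
    sections in the second, each measurable for the product structure. *)
Lemma kernel_measurable :
  measurable_fun (`[(0:R), 1] `*` `[(0:R), 1]) (fun z : R * R => G z.1 z.2).
Proof.
have mS : measurable (`[(0:R), 1] `*` `[(0:R), 1]) by exact: measurableX.
pose h n (z : R * R) := \sum_(k < n.+2) cell n k z.1 * G (node n k) z.2.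
apply: (measurable_fun_cvg (h := h)) => [n|[x y] /= [x01 y01]].
  rewrite /h; apply: measurable_sum => k.
  apply: measurable_funM.
    apply: measurable_funTS; apply: (measurableT_comp (measurable_cell n k)).
    exact: measurable_fst.
  apply: (measurable_comp (F := `[(0 : R), 1]) (f := G (node n k))) => //.
  - by move=> _ [[a b] [/= _ b01] <-].
  - apply: subspace_continuous_measurable_fun => //.
    by apply: kernel_section2; apply: node01; exact: ltn_ord k.
  - exact: measurable_funTS measurable_snd.
rewrite /= !in_itv /= in x01 y01.
apply/cvgrPdist_lt => e e0; have e2 : 0 < e / 2 by lra.
have [N hN] := node_unif e2; exists N => // n /= Nn.
apply: (@le_lt_trans _ _ (e / 2)); last lra.
rewrite distrC /h /=; apply: (cell_approx (f := fun k => G (node n k) y)) => // k kn hk.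
by apply: ltW; apply: hN.
Qed.

Lemma kernel_mean_continuous : {within `[0, 1], continuous (fun x => int01 (G x))}.
Proof.
apply: unif_continuous_within => e e0; have e2 : 0 < e / 2 by lra.
have [d d0 hd] := square_unif e2; exists d => // x y x01 y01 xy.
have iG z : 0 <= z <= 1 -> integrable01 (G z).
  move=> z01; apply: (L01_integrable (q := +oo%E)); first by right.
  by apply: L01_continuous; [right|exact: kernel_section2].
rewrite -int01B; [|exact: iG|exact: iG].
apply: le_lt_trans (le_normr_Rintegral _ _) _ => //; first by apply: integrable01B; exact: iG.
apply: (@le_lt_trans _ _ (int01 (fun=> e / 2))); last by rewrite int01_cst; lra.
apply: le_Rintegral => //.
- by apply: integrable_norm; apply: integrable01B; exact: iG.
- exact: integrable01_cst.
- by move=> t; rewrite /= in_itv /= => t01; apply: ltW; apply: hd; rewrite ?subrr ?normr0.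
Qed.


End continuous_kernel.

Section continuous_ae_eq.
Context {R : realType}.

(** Both functions are densities of the same primitive, which is differentiable at every interior
    point; the endpoints follow by one-sided limits. *)
Lemma continuous_ae_eq (u v : R -> R) : {within `[0, 1], continuous u} -> {within `[0, 1], continuous v} ->
  ae01 (fun t => u t = v t) -> forall t, 0 <= t <= 1 -> u t = v t.
Proof.
move=> cu cv uv; have hoo : exponent_ok (+oo%E : \bar R) by right.
have Lu := L01_continuous hoo cu; have Lv := L01_continuous hoo cv.
have iu := L01_integrable hoo Lu; have iv := L01_integrable hoo Lv.
have a1 : AC01 (prim u) u by move=> t _; rewrite prim0 add0r.
have a2 : AC01 (prim u) v.
  move=> t /andP[_ t1]; rewrite prim0 add0r; apply: prim_ae => //; [exact: (L01_meas Lu)|exact: (L01_meas Lv)].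
have oo t : 0 < t < 1 -> u t = v t.
  move=> t01; have [_ <-] := AC_derivable t01 iu a1 cu.
  by have [_ <-] := AC_derivable t01 iv a2 cv.
move=> t /andP[]; rewrite le_eqVlt => /predU1P[<- _|t0].
  rewrite -(tr0_cont (f := v) cu); last by apply: (near0_oo ltr01) => x /oo ->.
  by rewrite (tr0_cont cv) //; exact: nearW.
rewrite le_eqVlt => /predU1P[->|t1]; last by apply: oo; rewrite t0.
rewrite -(tr1_cont (f := v) cu); last by apply: (near1_oo ltr01) => x /oo ->.
by rewrite (tr1_cont cv) //; exact: nearW.
Qed.
End continuous_ae_eq.

(** * Green's formula on the domain and its average over s *)

Section green_bvp.
Context {R : realType}.
Variables (l : nat) (p : nat -> R -> R) (P : nat -> nat -> R -> R).
Hypotheses (hl : (0 < l)%N) (hP : coef_chain l p P).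
Hypothesis hp0 : forall t, 0 <= t <= 1 -> p 0%N t = 0.
Variables (A C : 'M[R]_(l.*2)).
Hypothesis hsa : selfadjoint_op p A C.
Variables (m : nat) (phi : 'I_m -> R -> R).
Hypothesis hbas : orthonormal_kernel_basis p A C phi.
Variable G : R -> R -> R.
Hypothesis cG : {within `[(0:R), 1] `*` `[(0:R), 1], continuous (fun z : R * R => G z.1 z.2)}.
Hypothesis symG : forall t s, 0 <= t <= 1 -> 0 <= s <= 1 -> G t s = G s t.
Hypothesis regG : forall s, 0 < s < 1 -> exists g0 g1 : R -> R,
        [/\ sobolev 2%:E l.*2 g0, sobolev 2%:E l.*2 g1,
            forall t, 0 <= t <= s -> G t s = g0 t
          & forall t, s <= t <= 1 -> G t s = g1 t].
Hypothesis bcG : forall s, 0 < s < 1 -> satisfies_bc A C (G ^~ s).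
Hypothesis eqG : forall s, 0 < s < 1 -> green_equation l p phi G s.
Hypothesis orthG : forall i s, 0 <= s <= 1 -> int01 (fun t => G t s * phi i t) = 0.
Let q2 : exponent_ok (2%:E : \bar R). Proof. by left. Qed.
Local Notation W2 := (W2 l).
Local Notation fd := (fd l P).
Local Notation dom := (@dom R l A C).

Lemma kernel_chain u : op_kernel p A C u <-> exists g, [/\ dom g,
  forall t, 0 <= t <= 1 -> u t = g 0%N t & ae01 (fun t => fd g t = 0)].
Proof.
split=> [/(op_graphP hl hP)[g [h1 h2 _ h4]]|[g [h1 h2 h3]]]; first by exists g.
by apply/(op_graphP hl hP); exists g; split => //; exact: L01_cst.
Qed.

Lemma kernel_L2 u : op_kernel p A C u -> L01 2%:E u.
Proof.
move=> /kernel_chain[g [h1 h2 _]]; apply: (eq_L01 q2 (f := g 0%N)); first by move=> t /h2 ->.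
exact: W2_L2 h1.1 (leq0n _).
Qed.

Lemma phi_L2 i : L01 2%:E (phi i).
Proof. by apply: kernel_L2; case: hbas => h _ _; exact: h. Qed.

Definition c_phi i : R := int01 (phi i).
(** The orthogonal projection of the constant 1 onto the kernel of the operator. *)
Definition proj1 (t : R) : R := \sum_i c_phi i * phi i t.

Lemma sum_L2 (c : 'I_m -> R) : L01 2%:E (fun t => \sum_i c i * phi i t).
Proof.
have H (I : seq 'I_m) : L01 2%:E (fun t => \sum_(i <- I) c i * phi i t).
  elim: I => [|i I ih]; first by under eq_fun do rewrite big_nil; exact: L01_cst.
  by under eq_fun do rewrite big_cons; apply: L01D => //; apply: L01Z => //; exact: phi_L2.
exact: H.
Qed.

Lemma sum_int v (c : 'I_m -> R) : L01 2%:E v ->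
  int01 (fun t => (\sum_i c i * phi i t) * v t) = \sum_i c i * int01 (fun t => phi i t * v t).
Proof.
move=> Lv; rewrite (eq_int01 (g := fun t => \sum_i c i * (phi i t * v t))); last first.
  by move=> t _; rewrite mulr_suml; apply: eq_bigr => i _; rewrite mulrA.
have H i : integrable01 (fun t => phi i t * v t) by apply: L2_mul => //; exact: phi_L2.
rewrite int01_sum; last by move=> i; exact: integrable01Z.
by apply: eq_bigr => i _; rewrite int01Z.
Qed.

Lemma dom_kernel (c : 'I_m -> R) : exists g, [/\ dom g,
  forall t, 0 <= t <= 1 -> \sum_i c i * phi i t = g 0%N t & ae01 (fun t => fd g t = 0)].
Proof.
have H (I : seq 'I_m) : exists g, [/\ dom g,
  forall t, 0 <= t <= 1 -> \sum_(i <- I) c i * phi i t = g 0%N t & ae01 (fun t => fd g t = 0)].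
  elim: I => [|i I [g [dg gE gz]]].
    exists zchain; split => [|t _|]; [|by rewrite big_nil|by apply: ae01W => t _; exact: fd0].
    by apply: (@dom_compact R l A C 1 0) => //; exact: W2_0.
  have /kernel_chain[h [dh hE hz]] : op_kernel p A C (phi i) by case: hbas => h _ _; exact: h.
  exists (fun j t => c i * h j t + g j t); split.
  - by apply: domD => //; exact: domZ.
  - by move=> t t01; rewrite big_cons gE // hE.
  - by apply: ae01_mono (ae01_and gz hz) => t _ [e1 e2]; rewrite fdD fdZ e1 e2 mulr0 addr0.
exact: H.
Qed.

Lemma green_formula g s : dom g -> 0 < s < 1 ->
  int01 (fun t => G t s * fd g t) = g 0%N s - \sum_i phi i s * int01 (fun t => phi i t * g 0%N t).
Proof.
move=> dg s01; have [g0 [g1 [/(sobolev_W2)[h0 w0 e0] /(sobolev_W2)[h1 w1 e1] G0 G1]]] := regG s01.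
have /andP[s0 s1] := s01.
apply: (green_dom hl hP hsa phi_L2 s0 s1 _ w0 w1 _ _ (bcG s01) (eqG s01) dg).
- by apply: kernel_section => //; rewrite !ltW.
- by move=> t /andP[t0 ts]; rewrite G0 ?t0 // e0 // t0 (le_trans ts) // ltW.
- by move=> t /andP[ts t1]; rewrite G1 ?ts // e1 // t1 andbT (le_trans (ltW s0)).
Qed.

Lemma green_glue s : 0 < s < 1 -> exists w (a b : R), [/\ dom w, 0 < a /\ a < s, s < b /\ b < 1,
  forall t, 0 <= t <= 1 -> (t <= a) || (b <= t) -> G t s = w 0%N t
  & int01 (fd w) = 1 - \sum_i phi i s * int01 (phi i)].
Proof.
move=> s01; have [g0 [g1 [/(sobolev_W2)[h0 w0 e0] /(sobolev_W2)[h1 w1 e1] G0 G1]]] := regG s01.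
have /andP[s0 s1] := s01.
apply: (green_glue_int hl hP hsa hp0 phi_L2 s0 s1 _ w0 w1 _ _ (bcG s01) (eqG s01)).
- by apply: kernel_section => //; rewrite !ltW.
- by move=> t /andP[t0 ts]; rewrite G0 ?t0 // e0 // t0 (le_trans ts) // ltW.
- by move=> t /andP[ts t1]; rewrite G1 ?ts // e1 // t1 andbT (le_trans (ltW s0)).
Qed.

Definition kmean (t : R) : R := int01 (fun y => G t y).

Lemma green_fubini v : L01 2%:E v ->
  [/\ integrable01 (fun t => v t * kmean t), integrable01 (fun y => int01 (fun t => G t y * v t)) &
  int01 (fun t => v t * kmean t) = int01 (fun y => int01 (fun t => G t y * v t))].
Proof.
move=> Lv; have iv := L01_integrable q2 Lv.
have [M M0 hM] := kernel_bounded cG.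
have mK : measurable_fun (`[(0 : R), 1] `*` `[(0 : R), 1]) (fun z : R * R => (fun x y => v x * G x y) z.1 z.2).
  apply: measurable_funM; last exact: kernel_measurable.
  apply: (measurable_comp (F := `[(0 : R), 1])) (L01_meas Lv) _ => //.
    by move=> _ [[x y] [/= x01 _] <-].
  exact: measurable_funTS measurable_fst.
have [|i1 i2 E] := @fubini01 R (fun x y => v x * G x y) (fun x => `|v x|) (fun=> M) mK
  (integrable_norm iv) (integrable01_cst M).
  by move=> x y x01 y01; rewrite normrM ler_wpM2l // hM.
have iG t : 0 <= t <= 1 -> integrable01 (G t).
  by move=> t01; apply: (L01_integrable q2); apply: L01_continuous => //; exact: kernel_section2.
have e1 t : 0 <= t <= 1 -> int01 ((fun x y => v x * G x y) t) = v t * kmean t.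
  by move=> t01; rewrite /kmean -int01Z //; exact: iG.
have e2 y : int01 ((fun x y => v x * G x y)^~ y) = int01 (fun t => G t y * v t).
  by apply: eq_int01 => t _; rewrite mulrC.
split.
- exact: eq_integrable01 e1 i1.
- by apply: eq_integrable01 i2 => y _; exact: e2.
- by rewrite -(eq_int01 e1) E; apply: eq_int01 => y _; exact: e2.
Qed.

Lemma kmean_L2 : L01 2%:E kmean.
Proof. by apply: L01_continuous => //; exact: kernel_mean_continuous. Qed.

(** The formula for G(.,s) integrated over s, with the order of integration exchanged; it is the
    adjoint relation for the pair (k, 1 - proj1). *)
Lemma green_formula_mean g : dom g ->
  int01 (fun t => fd g t * kmean t) = int01 (fun t => g 0%N t * (1 - proj1 t)).
Proof.
move=> dg; have [_ i E] := green_fubini (fd_L2 hl hP dg.1); rewrite E.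
have Lg : L01 2%:E (g 0%N) := W2_L2 dg.1 (leq0n _).
have L1 : L01 2%:E proj1 by exact: sum_L2.
pose d i := int01 (fun t => phi i t * g 0%N t).
transitivity (int01 (fun s => g 0%N s - \sum_i d i * phi i s)).
  apply: int01_ae; first exact: integrable01_meas.
    by apply: measurable_funB; apply: L01_meas; [exact: Lg|exact: sum_L2].
  apply: ae01_oo => s s01; rewrite green_formula //; congr (_ - _).
  by apply: eq_bigr => j _; rewrite mulrC.
have il (v : R -> R) : L01 2%:E v -> integrable01 v by exact: (L01_integrable q2).
rewrite int01B; [|exact: il|by apply: il; exact: sum_L2].
rewrite [RHS](eq_int01 (g := fun t => g 0%N t - proj1 t * g 0%N t)); last first.
  by move=> t _; rewrite mulrBr mulr1 [_ * proj1 _]mulrC.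
rewrite int01B; [|exact: il|exact: L2_mul]; congr (_ - _).
rewrite sum_int // int01_sum; last by move=> j; apply: integrable01Z; apply: il; exact: phi_L2.
apply: eq_bigr => j _; rewrite int01Z; first exact: mulrC.
by apply: il; exact: phi_L2.
Qed.

Lemma one_sub_proj1_L2 : L01 2%:E (fun t => 1 - proj1 t).
Proof.
apply: (@eq_L01 _ _ (fun t => 1 + (-1) * proj1 t)) => //; first by move=> t _; rewrite mulN1r.
by apply: L01D => //; [exact: L01_cst|apply: L01Z => //; exact: sum_L2].
Qed.

Lemma kmean_dom : exists h, [/\ dom h, forall t, 0 <= t <= 1 -> kmean t = h 0%N t
  & ae01 (fun t => fd h t = 1 - proj1 t)].
Proof.
have [h [dh kh hf]] := dom_adjoint hl hP hsa kmean_L2 one_sub_proj1_L2 green_formula_mean.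
(* The adjoint relation identifies k with an element of the domain only almost everywhere; both are
   continuous. *)
exists h; split => //; apply: continuous_ae_eq kh.
- exact: kernel_mean_continuous.
- by apply: (W2_continuous dh.1); rewrite double_gt0.
Qed.

End green_bvp.

(** * The demeaned boundary value problem *)

Section auxiliary.
Context {R : realType}.

Lemma onec0 (t : R) : onec 0%N t = 1. Proof. by []. Qed.

Lemma derivable_smooth (f : R -> R) : (forall n x, derivable (derive1n n f) x 1) -> smooth f.
Proof.
move=> df n; rewrite -(derive1n0 f); move: 0%N; elim: n => [//|n ih] j /=.
exists (derive1n j.+1 f); last exact: ih.
by move=> x; apply: DeriveDef; [exact: df|rewrite derive1nS derive1E].
Qed.

Lemma within_fst (u : R -> R) : {within `[0, 1], continuous u} ->
  {within `[(0:R), 1] `*` `[(0:R), 1], continuous (fun z : R * R => u z.1)}.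
Proof.
move=> /subspace_continuousP cu; apply/subspace_continuousP => -[x y] [/= x01 y01].
apply/cvgrPdist_lt => e e0; have /cvgrPdist_lt /(_ e e0) [d /= d0 hd] := cu x x01.
exists (ball x d, setT); first by split; [exact: nbhsx_ballx|exact: filterT].
by move=> [a b] [/= xa _] [a01 _]; exact: hd.
Qed.

Lemma within_snd (u : R -> R) : {within `[0, 1], continuous u} ->
  {within `[(0:R), 1] `*` `[(0:R), 1], continuous (fun z : R * R => u z.2)}.
Proof.
move=> /subspace_continuousP cu; apply/subspace_continuousP => -[x y] [/= x01 y01].
apply/cvgrPdist_lt => e e0; have /cvgrPdist_lt /(_ e e0) [d /= d0 hd] := cu y y01.
exists (setT, ball y d); first by split; [exact: filterT|exact: nbhsx_ballx].
by move=> [a b] [/= _ xb] [_ b01]; exact: hd.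
Qed.

End auxiliary.

Section extensionality.
Context {R : realType}.
Implicit Types (u v : R -> R) (G : R -> R -> R).

Lemma eq_bform l (A C : 'M[R]_(l.*2)) nu u v : (forall t, 0 < t < 1 -> u t = v t) ->
  bform A C nu u = bform A C nu v.
Proof.
move=> uv; apply: eq_bigr => j _; congr (_ * _ + _ * _).
- congr (lim _); apply/seteqP; split; apply: near_eq_cvg;
    by apply: (near0_oo ltr01) => t t01; rewrite (derive1n_eq_oo uv).
- congr (lim _); apply/seteqP; split; apply: near_eq_cvg;
    by apply: (near1_oo ltr01) => t t01; rewrite (derive1n_eq_oo uv).
Qed.

(** Only values on the closed square count. The demeaned kernel can thus be replaced by G itself
    when constants are admissible, and by an expression in the single function k otherwise. *)
Lemma eq_generalized_green l p (A C : 'M[R]_(l.*2)) G G' :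
  (forall t s, 0 <= t <= 1 -> 0 <= s <= 1 -> G t s = G' t s) ->
  generalized_green p A C G -> generalized_green p A C G'.
Proof.
move=> GG [cG sG rG bG [m [phi [bas gr orth]]]].
have lt (s : R) : 0 < s < 1 -> 0 <= s <= 1 by move=> /andP[? ?]; rewrite !ltW.
split.
- apply: (subspace_eq_continuous _ cG) => -[t s]; rewrite inE /= !in_itv /= => -[t01 s01].
  exact: GG.
- by move=> t s t01 s01; rewrite -!GG // sG.
- move=> s s01; have [g0 [g1 [h0 h1 e0 e1]]] := rG s s01; have /andP[s0 s1] := s01.
  exists g0, g1; split => // t /andP[ta tb].
  + have t01 : 0 <= t <= 1 by rewrite ta (le_trans tb) // ltW.
    by rewrite -(GG t s t01 (lt s s01)) e0 // ta.
  + have t01 : 0 <= t <= 1 by rewrite tb (le_trans (ltW s0)).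
    by rewrite -(GG t s t01 (lt s s01)) e1 // ta.
- move=> s s01 nu; rewrite -(bG s s01 nu); symmetry; apply: eq_bform => t t01.
  by rewrite GG ?(lt t) ?(lt s).
- exists m, phi; split => //.
  + move=> s s01 eta f teta Lf Lopf; rewrite -(gr s s01 eta f) //.
    by apply: eq_int01 => t t01; rewrite GG ?(lt s).
  + move=> i s s01; rewrite -(orth i s s01); apply: eq_int01 => t t01.
    by rewrite GG.
Qed.

End extensionality.

(** * Invertible row operations on the boundary conditions *)

Section change_of_forms.
Context {R : realType}.
Variables (l : nat) (p : nat -> R -> R) (A C M : 'M[R]_(l.*2)).
Hypothesis uM : M \in unitmx.

Lemma bform_mul (N B D : 'M[R]_(l.*2)) nu u : bform (N *m B) (N *m D) nu u = \sum_mu N nu mu * bform B D mu u.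
Proof.
rewrite /bform; under [RHS]eq_bigr do rewrite mulr_sumr.
rewrite exchange_big; apply: eq_bigr => j _ /=; rewrite !mxE !mulr_suml -big_split.
by apply: eq_bigr => k _ /=; ring.
Qed.

Lemma satisfies_bc_mul : satisfies_bc (M *m A) (M *m C) = satisfies_bc A C.
Proof.
apply/funext => u; apply/propext; split => H nu.
  rewrite -(mulKmx uM A) -(mulKmx uM C) bform_mul big1 // => mu _.
  by rewrite H mulr0.
by rewrite bform_mul big1 // => mu _; rewrite H mulr0.
Qed.

Lemma op_graph_mul : op_graph p (M *m A) (M *m C) = op_graph p A C.
Proof. by rewrite /op_graph satisfies_bc_mul. Qed.

Lemma op_kernel_mul : op_kernel p (M *m A) (M *m C) = op_kernel p A C.
Proof. by rewrite /op_kernel op_graph_mul. Qed.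

Lemma selfadjoint_bvp_mul : selfadjoint_bvp p A C -> selfadjoint_bvp p (M *m A) (M *m C).
Proof.
move=> [h1 h2 h3]; split => //.
  by rewrite -mul_mx_row -row_leq_rank eqmxMfull ?row_leq_rank // row_full_unit.
by rewrite /selfadjoint_op op_graph_mul.
Qed.

Lemma generalized_green_mul G : generalized_green p A C G -> generalized_green p (M *m A) (M *m C) G.
Proof.
by rewrite /generalized_green /orthonormal_kernel_basis op_kernel_mul satisfies_bc_mul.
Qed.

End change_of_forms.

(** * Normal forms of the value coefficients *)

Section normal_forms.
Context {R : realType}.
Variables (l : nat) (hl : (0 < l)%N) (A C : 'M[R]_(l.*2)).
Local Notation V := (value_coefs hl A C).

Lemma value_coefs_mul (M : 'M[R]_(l.*2)) :
  M *m V = row_mx (col (idx0 hl) (M *m A)) (col (idx0 hl) (M *m C)).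
Proof. by rewrite mul_mx_row !colE !mulmxA. Qed.

Lemma value_coefs_entries (M : 'M[R]_(l.*2)) nu :
  (M *m A) nu (idx0 hl) = (M *m V) nu (lshift 1 0) /\
  (M *m C) nu (idx0 hl) = (M *m V) nu (rshift 1 0).
Proof. by rewrite value_coefs_mul row_mxEl row_mxEr !mxE. Qed.

(** In the rank factorization of V, with outer factors [col_ebase] and [row_ebase], undoing the left
    factor leaves only the first row nonzero. *)
Lemma normalized1_ex : \rank V = 1%N ->
  exists2 M : 'M[R]_(l.*2), M \in unitmx & normalized1 hl (M *m A) (M *m C).
Proof.
move=> rV; exists (invmx (col_ebase V)); first by rewrite unitmx_inv col_ebase_unit.
have E : invmx (col_ebase V) *m V = pid_mx 1 *m row_ebase V.
  by rewrite -{2}(mulmx_ebase V) rV -mulmxA mulKmx // col_ebase_unit.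
move=> nu nu0; have [-> ->] := value_coefs_entries (invmx (col_ebase V)) nu.
rewrite E !mxE; split; apply: big1 => k _; rewrite mxE.
  by case: (_ && _) / andP => [[_]|]; rewrite ?mul0r // ltnNge nu0.
by case: (_ && _) / andP => [[_]|]; rewrite ?mul0r // ltnNge nu0.
Qed.

(** For rank 2 the right factor U of the rank factorization is an invertible 2 x 2 matrix and must
    be removed as well, although only row operations are allowed. Since the middle factor consists
    of an identity block over zeros, U can be moved to its left as a larger block matrix. *)
Lemma normalized2_ex : \rank V = 2%N ->
  exists2 M : 'M[R]_(l.*2), M \in unitmx & normalized2 hl (M *m A) (M *m C).
Proof.
move=> rV; have l2 : (2 <= l.*2)%N by rewrite -[2%N]/(1.*2) leq_double.
pose U := row_ebase V; have uU : U \in unitmx by exact: row_ebase_unit.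
(* The block diagonal matrix with blocks W and the identity of size 2l - 2. *)
pose emb (W : 'M[R]_(1 + 1)) : 'M[R]_(l.*2) :=
  (pid_mx 2 : 'M[R]_(l.*2, 1 + 1)) *m W *m (pid_mx 2 : 'M[R]_(1 + 1, l.*2)) + copid_mx 2.
have pp : (pid_mx 2 : 'M[R]_(1 + 1, l.*2)) *m (pid_mx 2 : 'M[R]_(l.*2, 1 + 1)) = 1%:M.
  by rewrite pid_mx_id // pid_mx_1.
have cp : copid_mx 2 *m (pid_mx 2 : 'M[R]_(l.*2, 1 + 1)) = 0 by rewrite mul_copid_mx_pid.
have embp W : emb W *m (pid_mx 2 : 'M[R]_(l.*2, 1 + 1)) = pid_mx 2 *m W.
  by rewrite mulmxDl cp addr0 -mulmxA pp mulmx1.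
have pc : (pid_mx 2 : 'M[R]_(1 + 1, l.*2)) *m copid_mx 2 = 0 by rewrite mul_pid_mx_copid.
have embM W W' : W *m W' = 1%:M -> emb W *m emb W' = 1%:M.
  move=> WW; rewrite {2}/emb mulmxDr !mulmxA embp -(mulmxA (pid_mx 2) W W') WW mulmx1.
  rewrite mulmxDl -!mulmxA pc !mulmx0 add0r copid_mx_id // pid_mx_id //.
  by rewrite /copid_mx addrC subrK.
exists (emb (invmx U) *m invmx (col_ebase V)).
  rewrite unitmx_mul unitmx_inv col_ebase_unit andbT.
  by have [] := mulmx1_unit (embM _ _ (mulVmx uU)).
have E : emb (invmx U) *m invmx (col_ebase V) *m V = pid_mx 2.
  rewrite -{2}(mulmx_ebase V) rV -!mulmxA mulKmx ?col_ebase_unit // mulmxA embp.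
  by rewrite -mulmxA mulVmx // mulmx1.
have ent nu := value_coefs_entries (emb (invmx U) *m invmx (col_ebase V)) nu.
split.
- by have [-> ->] := ent (idx0 hl); rewrite E !mxE.
- by have [-> ->] := ent (idx1 hl); rewrite E !mxE.
- move=> nu nu1; have [-> ->] := ent nu; rewrite E !mxE /=.
  by split; rewrite ltnNge nu1 andbF.
Qed.

End normal_forms.

(** * The flux condition as a boundary form *)

Section flux_form.
Context {R : realType}.
Variables (l : nat) (p : nat -> R -> R) (P : nat -> nat -> R -> R).
Hypotheses (hl : (0 < l)%N) (hP : coef_chain l p P).

(** The coefficient of u^(n) in the i-th derivative of p_j u^(j), zero for n < j. *)
Definition shifted_coef (i j : nat) (x : R) (n : nat) : R :=
  if (j <= n)%N then Lcoef (P j) i 0 x (n - j) else 0.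

Lemma Leib_shifted g i j x : (j + i < l.*2)%N ->
  Leib (P j) g i 0 j x = \sum_(n < l.*2) shifted_coef i j x n * g n x.
Proof.
move=> ji; rewrite (LeibE (P j) g 0 j x (N := l.*2 - j)); last by lia.
rewrite -[RHS](big_mkord xpredT (fun n => shifted_coef i j x n * g n x)).
rewrite [RHS](big_cat_nat (n := j)) //=; last by lia.
rewrite [X in _ = X + _]big_nat_cond [X in _ = X + _]big1 ?add0r; last first.
  by move=> n /andP[/andP[_ nj] _]; rewrite /shifted_coef leqNgt nj mul0r.
have := big_addn 0 l.*2 j xpredT (fun n => shifted_coef i j x n * g n x).
rewrite add0n => ->; rewrite big_mkord; apply: eq_bigr => k _.
by rewrite /shifted_coef leq_addl addnK addnC.
Qed.

(** The coefficient of u^(n) in L u' at x. Only orders n < 2l occur, so that the values of L u' at 0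
    and 1 are combinations of admissible boundary values. *)
Definition qcoef (x : R) (n : nat) : R :=
  (-1) ^+ l * shifted_coef l.-1 l x n + \sum_(j < l.-1) shifted_coef j j.+1 x n.

Lemma qdE g x : qd l P g x = \sum_(n < l.*2) qcoef x n * g n x.
Proof.
rewrite /qd Leib_shifted; last by lia.
rewrite [RHS](eq_bigr (fun n : 'I_(l.*2) => (-1) ^+ l * (shifted_coef l.-1 l x n * g n x) +
  \sum_(j < l.-1) shifted_coef j j.+1 x n * g n x)); last first.
  by move=> n _; rewrite /qcoef mulrDl mulr_suml mulrA.
rewrite big_split mulr_sumr; congr (_ + _).
rewrite [RHS]exchange_big; apply: eq_bigr => j _; apply: Leib_shifted.
by have := ltn_ord j; lia.
Qed.

Definition set_row0 (N : 'M[R]_(l.*2)) (r : nat -> R) : 'M[R]_(l.*2) :=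
  \matrix_(nu, j) if nu == idx0 hl then r j else N nu j.

Definition fluxA (N : 'M[R]_(l.*2)) := set_row0 N (qcoef 0).
Definition fluxC (N : 'M[R]_(l.*2)) := set_row0 N (fun n => - qcoef 1 n).

Lemma jform_flux0 N N' g : jform (fluxA N) (fluxC N') (idx0 hl) g g = qd l P g 0 - qd l P g 1.
Proof.
rewrite /jform !qdE -sumrB; apply: eq_bigr => j _; rewrite !mxE eqxx.
by rewrite mulNr.
Qed.

Lemma jform_flux N N' nu g : nu != idx0 hl ->
  jform (fluxA N) (fluxC N') nu g g = jform N N' nu g g.
Proof. by move=> /negbTE h; apply: eq_bigr => j _; rewrite !mxE h. Qed.

Lemma jform_onec A C nu : jform A C nu (onec (R := R)) (onec (R := R)) = A nu (idx0 hl) + C nu (idx0 hl).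
Proof.
rewrite /jform (bigD1 (idx0 hl)) //= big1 ?addr0; first by rewrite /onec /= !mulr1.
move=> j jn; rewrite /onec; have -> : (j == 0%N :> nat) = false.
  by apply/negbTE; apply: contra jn => /eqP j0; apply/eqP/val_inj.
by rewrite !mulr0 addr0.
Qed.

Lemma jformB1 A C nu g c :
  jform A C nu (fun j t => g j t + c * onec (R := R) j t) (fun j t => g j t + c * onec (R := R) j t) =
  jform A C nu g g + c * (A nu (idx0 hl) + C nu (idx0 hl)).
Proof. by rewrite jformD jformZ jform_onec. Qed.

End flux_form.

(** * Self-adjointness and Green function of the demeaned problem *)

Section demeaned_problem.
Context {R : realType}.
Variables (l : nat) (p : nat -> R -> R) (P : nat -> nat -> R -> R).
Hypotheses (hl : (0 < l)%N) (hP : coef_chain l p P).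
Hypothesis hp0 : forall t, 0 <= t <= 1 -> p 0%N t = 0.
Variables (A C : 'M[R]_(l.*2)).
Hypothesis hsa : selfadjoint_op p A C.
Let q2 : exponent_ok (2%:E : \bar R). Proof. by left. Qed.
Local Notation W2 := (W2 l).
Local Notation fd := (fd l P).
Variables (A' C' : 'M[R]_(l.*2)).
Local Notation dom' := (@dom R l A' C').
Local Notation dom := (@dom R l A C).
Local Notation one := (onec (R := R)).
Hypothesis no_cst : ~ satisfies_bc A C (fun=> 1).

(* the new domain consists of the constants plus the u in the old domain with
   <L u, 1> = 0 *)
Hypothesis dom'P : forall g, W2 g -> (forall nu, jform A' C' nu g g = 0) <->
  (exists c, dom (fun j t => g j t + c * one j t)) /\ int01 (fd g) = 0.

Let not_dom1 g : dom g -> ~ (forall t, 0 <= t <= 1 -> g 0%N t = 1).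
Proof.
move=> [hg bg] g1; apply: no_cst => nu.
by rewrite (bform_W2 _ _ nu hg) // => t /andP[? ?]; rewrite g1 // !ltW.
Qed.

Lemma fdc1 (g : nat -> R -> R) c t : 0 <= t <= 1 -> fd (fun j t => g j t + c * one j t) t = fd g t.
Proof. by move=> t01; rewrite fdD fdZ (fd1 hl hP hp0 t01) mulr0 addr0. Qed.

Lemma W2c1 (g : nat -> R -> R) c : W2 g -> W2 (fun j t => g j t + c * one j t).
Proof. by move=> hg; apply: W2D => //; apply: W2Z => //; exact: W2_1. Qed.

Lemma dom'_intro g c : W2 g -> dom (fun j t => g j t + c * one j t) -> int01 (fd g) = 0 -> dom' g.
Proof. by move=> hg dg g0; split => //; apply/dom'P => //; split => //; exists c. Qed.

Lemma dom'_dom g : dom g -> int01 (fd g) = 0 -> dom' g.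
Proof.
move=> dg g0; apply: (@dom'_intro _ 0) => //; first exact: dg.1.
apply: domD => //; split => [|nu]; first by apply: W2Z; exact: W2_1.
by rewrite jformZ mul0r.
Qed.

Lemma dom'_one : dom' one.
Proof.
apply: (@dom'_intro _ (-1)); first exact: W2_1.
  split => [|nu]; first by apply: W2c1; exact: W2_1.
  by rewrite jformD jformZ mulN1r subrr.
by rewrite (eq_int01 (g := fun=> 0)) ?int01_cst // => t t01; exact: (fd1 hl hP hp0 t01).
Qed.

Lemma fd_integrable (g : nat -> R -> R) : W2 g -> integrable01 (fd g).
Proof. by move=> hg; apply: (L01_integrable q2); exact: (fd_L2 hl hP hg). Qed.

Lemma W2_L2_0 (g : nat -> R -> R) : W2 g -> L01 2%:E (g 0%N).
Proof. by move=> hg; exact: W2_L2 hg (leq0n _). Qed.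

Lemma int01_fd_mulc v (c : R) g : W2 g -> L01 2%:E v ->
  int01 (fun t => fd g t * (v t + c)) = int01 (fun t => fd g t * v t) + c * int01 (fd g).
Proof.
move=> hg Lv; rewrite -int01Z; last exact: fd_integrable.
rewrite -int01D; [|by apply: L2_mul => //; exact: (fd_L2 hl hP hg)|by apply: integrable01Z; exact: fd_integrable].
by apply: eq_int01 => t _; ring.
Qed.

(** Shift g and h by constants into the old domain and use symmetry there; the shifts leave no
    trace, because L g and L h have mean zero. *)
Lemma dom'_sym g h : dom' g -> dom' h ->
  int01 (fun t => fd g t * h 0%N t) = int01 (fun t => g 0%N t * fd h t).
Proof.
move=> [hg bg] [hh bh].
have [[c dc] zg] := (dom'P hg).1 bg; have [[e de] zh] := (dom'P hh).1 bh.
have := dom_sym hl hP hsa dc de.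
rewrite (eq_int01 (g := fun t => fd g t * (h 0%N t + e))); last first.
  by move=> t t01; rewrite fdc1 // onec0 mulr1.
rewrite [RHS](eq_int01 (g := fun t => fd h t * (g 0%N t + c))); last first.
  by move=> t t01; rewrite fdc1 // onec0 mulr1 mulrC.
rewrite !int01_fd_mulc ?zg ?zh ?mulr0 ?addr0 //; try exact: W2_L2_0.
by move=> ->; apply: eq_int01 => t _; rewrite mulrC.
Qed.

(** If L g had mean zero throughout the old domain, the constant 1 would satisfy the adjoint
    relation with image 0 and hence belong to the domain, against [no_cst]. *)
Lemma dom_flux_ex : exists2 g, dom g & int01 (fd g) = 1.
Proof.
apply: contrapT => H; have Z g : dom g -> int01 (fd g) = 0.
  move=> dg; apply/eqP/negP => /negP nz; apply: H.
  exists (fun j t => (int01 (fd g))^-1 * g j t); first exact: domZ.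
  rewrite (eq_int01 (g := fun t => (int01 (fd g))^-1 * fd g t)); last by move=> t _; rewrite fdZ.
  by rewrite int01Z ?mulVf //; apply: fd_integrable; case: dg.
have [|h [dh h1 _]] := @dom_adjoint R l p P hl hP A C hsa (fun=> 1) (fun=> 0) (L01_cst 1 q2) (L01_cst 0 q2).
  move=> g dg; rewrite [RHS](eq_int01 (g := fun=> 0)) ?int01_cst; last by move=> t _; rewrite mulr0.
  by rewrite -(Z g dg); apply: eq_int01 => t _; rewrite mulr1.
apply: (not_dom1 dh) => t t01; symmetry.
apply: (continuous_ae_eq _ _ h1 t01); first by apply: continuous_subspaceT; exact: cst_continuous.
by apply: (W2_continuous dh.1); rewrite double_gt0.
Qed.

(** For a pair (v, f) in the adjoint graph, a constant c is found such that (v - c, f) satisfies the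
    adjoint relation of the old operator; self-adjointness of the latter then gives regularity and
    the old boundary conditions for v - c. *)
Lemma selfadjoint_demeaned : selfadjoint_op p A' C'.
Proof.
move=> v f Lv Lf; split; last first.
  move=> [u vu /(op_graphP hl hP)[h [dh uh _ hf]]] u' f' /(op_graphP hl hP)[g [dg ug Lf' gf]].
  transitivity (int01 (fun t => fd g t * h 0%N t)).
    apply: int01_ae.
    - exact: measM.
    - by apply: measM; [exact: (fd_L2 hl hP dg.1)|exact: W2_L2_0 dh.1].
    - by apply: ae01_mono (ae01_and vu gf) => t t01 [-> ->]; rewrite uh.
  rewrite dom'_sym //; apply: int01_ae.
  - by apply: measM; [exact: W2_L2_0 dg.1|exact: (fd_L2 hl hP dh.1)].
  - apply: measM => //; apply: (eq_L01 q2 (f := g 0%N)); first by move=> t /ug ->.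
    exact: W2_L2_0 dg.1.
  - by apply: ae01_mono hf => t t01 ->; rewrite ug.
move=> H.
have H' g : dom' g -> int01 (fun t => fd g t * v t) = int01 (fun t => g 0%N t * f t).
  by move=> dg; apply: H; exact: op_graph_dom.
(* Constants lie in the new domain and are killed by L, so testing against 1 gives the mean of f. *)
have f0 : int01 f = 0.
  have := H' _ dom'_one; rewrite (eq_int01 (g := fun=> 0)); last first.
    by move=> t t01; rewrite (fd1 hl hP hp0 t01) mul0r.
  by rewrite int01_cst => ->; apply: eq_int01 => t _; rewrite onec0 mul1r.
have [g1 d1 i1] := dom_flux_ex.
(* As L g1 has mean 1, this is the value of c for which the relation of v - c holds against g1. *)
pose c := int01 (fun t => fd g1 t * v t) - int01 (fun t => g1 0%N t * f t).
have Lc : L01 2%:E (fun t => v t + - c) by apply: L01D => //; exact: L01_cst.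
have [|h [dh vh hf]] := @dom_adjoint R l p P hl hP A C hsa _ f Lc Lf.
  move=> g dg; rewrite int01_fd_mulc //; last exact: dg.1.
  pose k := int01 (fd g).
  (* The old domain is its zero-flux part plus the line through g1. The zero-flux part lies in the
     new domain, where the relation is known and insensitive to c. *)
  pose g0 := fun j t => g j t + (- k) * g1 j t.
  have dg0 : dom g0 by apply: domD => //; exact: domZ.
  have i0 : int01 (fd g0) = 0.
    rewrite (eq_int01 (g := fun t => fd g t + (- k) * fd g1 t)); last by move=> t _; rewrite fdD fdZ.
    rewrite int01D ?int01Z ?i1 ?mulr1 ?subrr //; try by apply: fd_integrable; [case: dg|case: d1].
    - by apply: fd_integrable; case: d1.
    - by apply: fd_integrable; case: dg.
    - by apply: integrable01Z; apply: fd_integrable; case: d1.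
  have := H' _ (dom'_dom dg0 i0).
  rewrite (eq_int01 (g := fun t => fd g t * v t + (- k) * (fd g1 t * v t))); last first.
    by move=> t _; rewrite fdD fdZ; ring.
  rewrite [RHS](eq_int01 (g := fun t => g 0%N t * f t + (- k) * (g1 0%N t * f t))); last first.
    by move=> t _; rewrite /g0; ring.
  have j1 : integrable01 (fun t => fd g t * v t) by apply: L2_mul => //; exact: (fd_L2 hl hP dg.1).
  have j2 : integrable01 (fun t => fd g1 t * v t) by apply: L2_mul => //; exact: (fd_L2 hl hP d1.1).
  have j3 : integrable01 (fun t => g 0%N t * f t) by apply: L2_mul => //; exact: W2_L2_0 dg.1.
  have j4 : integrable01 (fun t => g1 0%N t * f t) by apply: L2_mul => //; exact: W2_L2_0 d1.1.
  rewrite -/k !int01D ?int01Z //; try exact: integrable01Z.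
  rewrite /c; set a := int01 _; set b := int01 _; set a' := int01 _; set b' := int01 _.
  by move=> e; have -> : a = (a + - k * b) + k * b; [ring|rewrite e; ring].
have dz : dom' (fun j t => h j t + c * one j t).
  apply: (@dom'_intro _ (- c)).
  - by apply: W2c1; case: dh.
  - have -> : (fun (j : nat) t => h j t + c * one j t + - c * one j t) = h; last by [].
    by apply/funext => j; apply/funext => t; ring.
  - rewrite -[RHS]f0; apply: int01_ae; last by apply: ae01_mono hf => t t01 <-; rewrite fdc1.
      by apply: L01_meas; apply: (fd_L2 hl hP); apply: W2c1; case: dh.
    exact: L01_meas Lf.
exists (fun t => h 0%N t + c * one 0%N t).
  by apply: ae01_mono vh => t _ <-; rewrite onec0 mulr1 subrK.
apply/(op_graphP hl hP); exists (fun j t => h j t + c * one j t); split => //.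
by apply: ae01_mono hf => t t01 <-; rewrite fdc1.
Qed.

Lemma dom'_shift g : dom' g -> exists c, [/\ dom (fun j t => g j t + c * one j t),
  int01 (fd g) = 0 & forall t, 0 <= t <= 1 -> g 0%N t = (fun j t => g j t + c * one j t) 0%N t + - c].
Proof.
move=> [hg bg]; have [[c dc] zg] := (dom'P hg).1 bg; exists c; split => // t _.
by rewrite onec0 mulr1 addrK.
Qed.

Variable G : R -> R -> R.
Hypothesis hG : generalized_green p A C G.
Hypothesis ho : kernel_orthogonal_to_constants p A C.
Local Notation kmean := (kmean G).

Lemma demean_kernelE t s : (forall t s, 0 <= t <= 1 -> 0 <= s <= 1 -> G t s = G s t) ->
  0 <= t <= 1 -> 0 <= s <= 1 ->
  demean_kernel G t s = G t s - kmean t - kmean s + int01 kmean.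
Proof.
move=> sG t01 s01; rewrite /demean_kernel; congr (_ - _ - _ + _).
by apply: eq_int01 => x x01; exact: sG.
Qed.

Lemma generalized_green_demeaned : generalized_green p A' C' (demean_kernel G).
Proof.
have [cG sG rG bG [m [phi [bas gr orth]]]] := hG.
pose K t s := G t s - kmean t - kmean s + int01 kmean.
suff : generalized_green p A' C' K.
  by apply: eq_generalized_green => t s t01 s01; rewrite demean_kernelE.
have inC (s : R) : 0 < s < 1 -> 0 <= s <= 1 by move=> /andP[? ?]; rewrite !ltW.
(* The orthogonality hypothesis enters here: the projection of 1 onto the kernel vanishes, so that L
   k = 1 and the glued function below has flux 1. *)
have phi0 i : int01 (phi i) = 0 by apply: ho; case: bas => h _ _; exact: h.
have p10 t : proj1 phi t = 0.
  by rewrite /proj1 big1 // => i _; rewrite /c_phi phi0 mul0r.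
have [h [dh kh hf]] := kmean_dom hl hP hsa bas cG rG bG gr.
have hf1 : ae01 (fun t => fd h t = 1) by apply: ae01_mono hf => t _ ->; rewrite p10 subr0.
have ckm : {within `[0, 1], continuous kmean} by exact: kernel_mean_continuous.
have Lkm : L01 2%:E kmean by exact: L01_continuous.
have ih : int01 (fd h) = 1.
  rewrite -[RHS](int01_cst 1); apply: int01_ae => //.
  by apply: integrable01_meas; apply: fd_integrable; case: dh.
have LG s : 0 <= s <= 1 -> L01 2%:E (G^~ s).
  by move=> s01; apply: L01_continuous => //; exact: kernel_section.
have Lphi i : L01 2%:E (phi i) := phi_L2 hl hP bas i.
split.
- have c1 : {within `[(0:R), 1] `*` `[(0:R), 1], continuous (fun z : R * R => kmean z.1)} by exact: within_fst.
  have c2 : {within `[(0:R), 1] `*` `[(0:R), 1], continuous (fun z : R * R => kmean z.2)} by exact: within_snd.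
  move=> z; rewrite /K; apply: cvgD; last exact: cvg_cst.
  by apply: cvgB; [apply: cvgB; [exact: cG|exact: c1]|exact: c2].
- by move=> t s t01 s01; rewrite /K (sG t s) //; ring.
- move=> s s01; have [g0 [g1 [/sobolev_W2[h0 w0 e0] /sobolev_W2[h1 w1 e1] G0 G1]]] := rG s s01.
  have /andP[s0 s1] := s01.
  pose k g := fun j (t : R) => g j t + ((-1) * h j t + (int01 kmean - kmean s) * one j t).
  have hk g : W2 g -> W2 (k g).
    move=> hg; apply: W2D => //; apply: W2D; first by apply: W2Z => //; exact: dh.1.
    by apply: W2Z => //; exact: W2_1.
  have kE g t : 0 <= t <= 1 -> k g 0%N t = g 0%N t - kmean t - kmean s + int01 kmean.
    by move=> t01; rewrite /k /= (kh t t01) mulr1; ring.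
  exists (k h0 0%N), (k h1 0%N); split.
  + by apply/sobolev_W2; exists (k h0) => //; exact: hk.
  + by apply/sobolev_W2; exists (k h1) => //; exact: hk.
  + move=> t /andP[ta tb]; have t01 : 0 <= t <= 1 by rewrite ta (le_trans tb) // ltW.
    by rewrite kE // /K G0 ?ta // e0.
  + move=> t /andP[ta tb]; have t01 : 0 <= t <= 1 by rewrite tb andbT (le_trans (ltW s0)).
    by rewrite kE // /K G1 ?ta // e1.
- move=> s s01; have [w [a [b [dw [a0 as_] [sb b1] Gw iw]]]] :=
    green_glue hl hP hp0 hsa bas cG rG bG gr s01.
  have {}iw : int01 (fd w) = 1.
    by rewrite iw big1 ?subr0 // => i _; rewrite phi0 mulr0.
  pose e := int01 kmean - kmean s.
  (* Near both endpoints the demeaned kernel is w - k plus a constant. Here w - k lies in the old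
     domain, and L(w - k) has mean 1 - 1 = 0, which is the new flux condition. *)
  pose z := fun j (t : R) => w j t + ((-1) * h j t + e * one j t).
  have hz : W2 z.
    apply: W2D; first exact: dw.1.
    by apply: W2c1; apply: W2Z => //; exact: dh.1.
  have zE t : 0 <= t <= 1 -> (t <= a) || (b <= t) -> K t s = z 0%N t.
    by move=> t01 tab; rewrite /K Gw // /z kh // onec0 /e; ring.
  have dz : dom' z.
    apply: (@dom'_intro _ (- e)) => //.
    + have -> : (fun (j : nat) t => z j t + - e * one j t) = (fun j t => w j t + (-1) * h j t).
        by apply/funext => j; apply/funext => t; rewrite /z; ring.
      by apply: domD => //; exact: domZ.
    + rewrite (eq_int01 (g := fun t => fd w t + (-1) * fd h t)); last first.
        by move=> t t01; rewrite /z fdD fdc1 // fdZ.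
      have iwi : integrable01 (fd w) by apply: fd_integrable; case: dw.
      have ihi : integrable01 (fd h) by apply: fd_integrable; case: dh.
      rewrite int01D ?int01Z //; last exact: integrable01Z.
      by rewrite iw ih mulr1 subrr.
  move=> nu; rewrite -(dz.2 nu); apply: (@bform_jform R l A' C' nu _ z z a b) => //; try lra.
  + by move=> t ta; apply: zE; lra.
  + by move=> t ta; apply: zE; [lra|apply/orP; right; lra].
(* The new basis is the constant 1, of norm one on [0,1], followed by the old basis, which is
   orthogonal to it. *)
exists m.+1, (fun i : 'I_m.+1 => if unlift ord0 i is Some j then phi j else fun=> 1).
split.
- split.
  + move=> i; case: unliftP => [j _|_].
      have /(op_graphP hl hP)[g [dg gE _ gz]] : op_kernel p A C (phi j) by case: bas => H _ _; exact: H.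
      apply/(op_graphP hl hP); exists g; split => //; last exact: L01_cst.
      apply: dom'_dom => //; rewrite -(int01_cst 0); apply: int01_ae => //.
      by apply: integrable01_meas; apply: fd_integrable; case: dg.
    apply/(op_graphP hl hP); exists one; split => //.
    * exact: dom'_one.
    * exact: L01_cst.
    * by apply: ae01W => t t01; exact: (fd1 hl hP hp0 t01).
  + move=> i j; case: bas => _ orth1 _.
    case: (unliftP ord0 i) => [i' ->|->]; case: (unliftP ord0 j) => [j' ->|->]; rewrite ?liftK ?unlift_none.
    * by rewrite orth1 (inj_eq (@lift_inj _ ord0)).
    * rewrite (eq_int01 (g := phi i')) ?phi0; first by rewrite lift_eqF.
      by move=> t _; rewrite mulr1.
    * rewrite (eq_int01 (g := phi j')) ?phi0; first by rewrite eq_liftF.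
      by move=> t _; rewrite mul1r.
    * by rewrite eqxx (eq_int01 (g := fun=> 1)) ?int01_cst // => t _; rewrite mulr1.
  + move=> u /(op_graphP hl hP)[g [dg uE _ gz]]; have [c [dc _ gE]] := dom'_shift dg.
    (* The shift by c brings a new kernel element back to the old kernel, and reappears as its
       coordinate - c along 1. *)
    case: bas => _ _ /(_ (fun t => g 0%N t + c)) [].
      apply/(op_graphP hl hP); exists (fun j t => g j t + c * one j t); split => //.
      * by move=> t _; rewrite onec0 mulr1.
      * exact: L01_cst.
      * by apply: ae01_mono gz => t t01; rewrite fdc1.
    move=> d dE; exists (fun i => if unlift ord0 i is Some j then d j else - c) => t t01.
    rewrite big_ord_recl unlift_none mulr1 uE //.
    under eq_bigr do rewrite liftK.
    by rewrite -dE //; ring.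
- move=> s s01 eta f [eta1 [a [b [a0 b1 ez]]]] Lf Lopf.
  have se : smooth eta by exact: derivable_smooth.
  have ez' x : ~~ (a <= x <= b) -> eta x = 0 := ez x.
  have de : dom (jets eta) := @dom_jets R l A C eta a b se a0 b1 ez'.
  have Le : L01 2%:E eta := W2_L2_0 de.1.
  have fe : ae01 (fun t => fd (jets eta) t = f t).
    have := Lop_fd hl hP de.1 (fun t _ => erefl (eta t)).
    by move=> /(ae01_and Lopf); apply: ae01_mono => t _ [<- ->].
  (* A test function lies in the new domain as well, so its image has mean zero and the part of the
     demeaned kernel that does not depend on t contributes nothing. *)
  have f0 : int01 f = 0.
    have de' : dom' (jets eta) := @dom_jets R l A' C' eta a b se a0 b1 ez'.
    have [_ <-] := (dom'P de'.1).1 de'.2.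
    apply: int01_ae; first exact: L01_meas Lf.
      by apply: integrable01_meas; apply: fd_integrable; case: de.
    by apply: ae01_mono fe => t _ ->.
  (* This is the additional term of the new projection, the coordinate of eta along the constant
     1. *)
  have kf : int01 (fun t => kmean t * f t) = int01 eta.
    have := green_formula_mean hl hP hsa bas cG rG bG gr de.
    rewrite [RHS](eq_int01 (g := eta)); last by move=> t _; rewrite p10 subr0 mulr1.
    move=> <-; apply: int01_ae; [exact: measM|by apply: measM => //; exact: (fd_L2 hl hP de.1)|].
    by apply: ae01_mono fe => t _ ->; rewrite mulrC.
  have H := gr s s01 eta f (conj eta1 (ex_intro _ a (ex_intro _ b (And3 a0 b1 ez)))) Lf Lopf.
  rewrite /K (eq_int01 (g := fun t => (G t s * f t - kmean t * f t) + (int01 kmean - kmean s) * f t)); last first.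
    by move=> t _; ring.
  have i1 : integrable01 (fun t => G t s * f t) by apply: L2_mul => //; apply: LG; exact: inC.
  have i2 : integrable01 (fun t => kmean t * f t) by exact: L2_mul.
  have i3 : integrable01 f by exact: (L01_integrable q2).
  rewrite int01D; [|exact: integrable01B|exact: integrable01Z].
  rewrite int01B // int01Z // f0 mulr0 addr0 H kf.
  rewrite big_ord_recl unlift_none /=.
  under [in RHS]eq_bigr do rewrite liftK.
  rewrite (eq_int01 (f := fun t => 1 * eta t) (g := eta)); last by move=> t _; rewrite mul1r.
  by ring.
- move=> i s s01; have Lh : L01 2%:E (h 0%N) := W2_L2_0 dh.1.
  have iG : integrable01 (G^~ s) by apply: (L01_integrable q2); exact: LG.
  have ik : integrable01 kmean by exact: (L01_integrable q2).
  case: (unliftP ord0 i) => [j _|_] /=.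
    have ig1 : integrable01 (fun t => G t s * phi j t) by apply: L2_mul => //; exact: LG.
    have ig2 : integrable01 (fun t => kmean t * phi j t) by exact: L2_mul.
    have ig3 : integrable01 (phi j) by exact: (L01_integrable q2).
    rewrite /K (eq_int01 (g := fun t => (G t s * phi j t - kmean t * phi j t)
      + (int01 kmean - kmean s) * phi j t)); last first.
      by move=> t _; ring.
    rewrite int01D; [|exact: integrable01B|exact: integrable01Z].
    rewrite int01B // int01Z // phi0 mulr0 addr0 orth // sub0r.
    (* The mean k inherits orthogonality to the kernel from all the G(.,y). *)
    have [_ _ E] := green_fubini cG (Lphi j).
    rewrite (eq_int01 (g := fun t => phi j t * kmean t)); last by move=> t _; rewrite mulrC.
    rewrite E (eq_int01 (g := fun=> 0)) ?int01_cst ?oppr0 // => y y01.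
    exact: orth.
  rewrite /K (eq_int01 (g := fun t => (G t s - kmean t) + (int01 kmean - kmean s))); last first.
    by move=> t _; ring.
  rewrite int01D; [|exact: integrable01B|exact: integrable01_cst].
  rewrite int01B // int01_cst.
  have -> : int01 (G^~ s) = kmean s by apply: eq_int01 => t t01; exact: sG.
  by ring.
Qed.

End demeaned_problem.

(** * The case where constants satisfy the boundary conditions *)

Section constants.
Context {R : realType}.
Variables (l : nat) (p : nat -> R -> R) (P : nat -> nat -> R -> R).
Hypotheses (hl : (0 < l)%N) (hP : coef_chain l p P).
Hypothesis hp0 : forall t, 0 <= t <= 1 -> p 0%N t = 0.
Variables (A C : 'M[R]_(l.*2)).
Hypothesis hsa : selfadjoint_op p A C.
Variable G : R -> R -> R.
Hypothesis hG : generalized_green p A C G.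
Let q2 : exponent_ok (2%:E : \bar R). Proof. by left. Qed.
Local Notation one := (onec (R := R)).

Lemma constant_kernel : satisfies_bc A C (fun=> 1) -> op_kernel p A C (fun=> 1).
Proof.
move=> bc; apply/(op_graphP hl hP); exists one; split => //.
- split; first exact: W2_1.
  by move=> nu; rewrite -(bc nu); symmetry; apply: bform_W2 => //; exact: W2_1.
- exact: L01_cst.
- by apply: ae01W => t t01; exact: (fd1 hl hP hp0 t01).
Qed.

Lemma kmean0 t : satisfies_bc A C (fun=> 1) -> 0 <= t <= 1 -> kmean G t = 0.
Proof.
move=> /constant_kernel k1 t01.
have [cG sG _ _ [m [phi [bas _ orth]]]] := hG.
case: (bas) => _ _ /(_ _ k1)[c cE].
transitivity (int01 (fun y => (\sum_i c i * phi i y) * G y t)).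
  by apply: eq_int01 => y y01; rewrite -cE // mul1r sG.
rewrite (sum_int hl hP bas); last by apply: L01_continuous => //; exact: kernel_section.
rewrite big1 // => i _; rewrite (eq_int01 (g := fun y => G y t * phi i y)) ?orth ?mulr0 //.
by move=> y _; rewrite mulrC.
Qed.

Lemma kmean_sym : forall s, 0 <= s <= 1 -> int01 (fun x => G x s) = kmean G s.
Proof. by move=> s s01; case: hG => _ sG _ _ _; apply: eq_int01 => x x01; exact: sG. Qed.

Lemma demean_kernel_id t s : satisfies_bc A C (fun=> 1) -> 0 <= t <= 1 -> 0 <= s <= 1 ->
  demean_kernel G t s = G t s.
Proof.
move=> bc t01 s01; rewrite /demean_kernel kmean_sym // -/(kmean G t) !kmean0 //.
rewrite (eq_int01 (g := fun=> 0)) ?int01_cst ?subr0 ?addr0 // => x x01.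
by rewrite -/(kmean G x) kmean0.
Qed.

Lemma cov_operator_cst c t : 0 <= t <= 1 -> cov_operator G (fun=> c) t = c * kmean G t.
Proof.
have [cG _ _ _ _] := hG.
move=> t01; rewrite -int01Z; first by apply: eq_int01 => s _; rewrite mulrC.
by apply: (L01_integrable q2); apply: L01_continuous => //; exact: kernel_section2.
Qed.

Lemma constant_null_vector : satisfies_bc A C (fun=> 1) <->
  exists2 c : R, c != 0 & ae01 (fun t => cov_operator G (fun=> c) t = 0).
Proof.
split=> [bc|[c c0 h0]].
  exists 1; first exact: oner_neq0.
  by apply: ae01W => t t01; rewrite cov_operator_cst // kmean0 // mulr0.
have [cG sG rG bG [m [phi [bas gr orth]]]] := hG.
have [h [dh kh hf]] := kmean_dom hl hP hsa bas cG rG bG gr.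
have l2 : (0 < l.*2)%N by rewrite double_gt0.
have c1 (x : R) : {within `[(0:R), 1], continuous (fun=> x : R)}.
  by apply: continuous_subspaceT; exact: cst_continuous.
have hz t : 0 <= t <= 1 -> h 0%N t = 0.
  apply: continuous_ae_eq => //; first exact: (W2_continuous dh.1).
  apply: ae01_mono h0 => s s01 /eqP; rewrite cov_operator_cst // mulf_eq0 (negbTE c0) /=.
  by rewrite kh // => /eqP.
(* Here g represents the projection of 1 onto the kernel. As k = 0 gives L k = 0, this projection is
   1 itself, which therefore inherits the boundary conditions. *)
have [g [dg gE _]] := dom_kernel hl hP bas (c_phi phi).
have fz : ae01 (fun t => 0 < t < 1 -> fd l P h t = 0).
  have hz' t : 0 < t < 1 -> h 0%N t = 0 by case/andP => ? ?; rewrite hz // !ltW.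
  exact: (fd_zero hl hP dh.1 hz').
have g1 t : 0 <= t <= 1 -> 1 = g 0%N t.
  apply: continuous_ae_eq => //; first exact: (W2_continuous dg.1).
  move: (ae01_and hf fz); apply: ae01_oo_mono => s s01 [fs /(_ s01) f0].
  have s01' : 0 <= s <= 1 by case/andP: s01 => ? ?; rewrite !ltW.
  by rewrite -gE // -/(proj1 phi s); apply/eqP; rewrite -subr_eq0 -fs f0.
move=> nu; rewrite -(dg.2 nu); apply: (bform_W2 _ _ _ dg.1) => t /andP[t0 t1].
by apply: g1; rewrite !ltW.
Qed.

Lemma generalized_green_constants : satisfies_bc A C (fun=> 1) ->
  generalized_green p A C (demean_kernel G).
Proof.
by move=> bc; apply: eq_generalized_green hG => t s t01 s01; rewrite demean_kernel_id.
Qed.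

End constants.

(** * Replacing the first boundary condition by the flux condition *)

Section flux_row.
Context {R : realType}.
Variables (l : nat) (p : nat -> R -> R) (P : nat -> nat -> R -> R).
Hypotheses (hl : (0 < l)%N) (hP : coef_chain l p P).
Hypothesis hp0 : forall t, 0 <= t <= 1 -> p 0%N t = 0.
Variables (A C : 'M[R]_(l.*2)).
Hypothesis hsa : selfadjoint_bvp p A C.
Hypothesis no_cst : ~ satisfies_bc A C (fun=> 1).
Local Notation i0 := (idx0 hl).
(** The common form of both rank cases: immediate for a normal form of rank 1, and for rank 2
    obtained by passing from U_2 to U_2 - U_1. *)
Hypothesis constants_row0 : forall nu, nu != i0 -> A nu i0 + C nu i0 = 0.
Local Notation one := (onec (R := R)).
Local Notation A' := (fluxA P hl A).
Local Notation C' := (fluxC P hl C).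

Let sa : selfadjoint_op p A C. Proof. by case: hsa. Qed.

Lemma bform_one nu : bform A C nu (fun=> 1) = A nu i0 + C nu i0.
Proof.
by rewrite -jform_onec; apply: bform_W2 => //; exact: W2_1.
Qed.

Lemma constants_coef_neq0 : A i0 i0 + C i0 i0 != 0.
Proof.
apply/negP => /eqP k0; apply: no_cst => nu; rewrite bform_one.
by have [->|] := eqVneq nu i0; [|exact: constants_row0].
Qed.

Lemma flux_fd g : W2 l g -> qd l P g 0 - qd l P g 1 = - int01 (fd l P g).
Proof.
move=> hg; rewrite [qd l P g 1](qd_AC hl hP hp0 hg) ?lexx ?ler01 //.
by rewrite prim1 opprD addNKr.
Qed.

Lemma flux_domP g : W2 l g -> (forall nu, jform A' C' nu g g = 0) <->
  (exists c, dom A C (fun j t => g j t + c * one j t)) /\ int01 (fd l P g) = 0.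
Proof.
move=> hg; split=> [H|[[c [_ dc]] z] nu].
  split; last first.
    by have /eqP := H i0; rewrite jform_flux0 // flux_fd // oppr_eq0 => /eqP.
  (* Only the first old condition sees a constant, and its value on 1 is nonzero; solving it
     determines the shift. *)
  exists (- (jform A C i0 g g / (A i0 i0 + C i0 i0))); split => [|nu]; first exact: W2c1.
  rewrite (jformB1 hl); have [->|n0] := eqVneq nu i0.
    by rewrite mulNr divfK ?subrr // constants_coef_neq0.
  by rewrite (constants_row0 n0) mulr0 addr0 -(H nu) jform_flux.
have [->|n0] := eqVneq nu i0; first by rewrite jform_flux0 // flux_fd // z oppr0.
by rewrite jform_flux // -(dc nu) (jformB1 hl) constants_row0 // mulr0 addr0.
Qed.

Lemma flux_coefs : coefs_of_forms
  (fun nu u => if nu == i0 then periodic_flux l p u else bform A C nu u) A' C'.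
Proof.
move=> u /sobolev_W2[g hg ug] nu.
have ug' t : 0 < t < 1 -> u t = g 0%N t by move=> /andP[t0 t1]; apply: ug; rewrite !ltW.
rewrite !(bform_W2 _ _ nu hg ug'); case: eqVneq => [->|n0]; last exact: jform_flux.
by rewrite jform_flux0 // (flux_qd hl hP hp0 hg ug').
Qed.

Lemma jform_row (v : 'rV[R]_(l.*2)) (N N' : 'M[R]_(l.*2)) g : v *m row_mx N N' = 0 ->
  \sum_nu v 0 nu * jform N N' nu g g = 0.
Proof.
rewrite mul_mx_row => /eqP; rewrite row_mx_eq0 => /andP[/eqP vN /eqP vN'].
under eq_bigr do rewrite /jform mulr_sumr.
rewrite exchange_big big1 // => j _ /=.
have /rowP/(_ j) := vN; have /rowP/(_ j) := vN'; rewrite !mxE => e' e.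
transitivity ((\sum_k v 0 k * N k j) * g j 0 + (\sum_k v 0 k * N' k j) * g j 1).
  by rewrite !mulr_suml -big_split; apply: eq_bigr => k _ /=; ring.
by rewrite e e' !mul0r addr0.
Qed.

(** Evaluate a vanishing combination of the rows on an element of the old domain with flux 1: all
    forms but the flux vanish there, so the coefficient of the flux is 0. What remains is a relation
    between rows of the original independent system. *)
Lemma flux_row_free : row_free (row_mx A' C').
Proof.
apply: inj_row_free => v v0; have [g dg g1] := dom_flux_ex hl hP sa no_cst.
have vi0 : v 0 i0 = 0.
  have := jform_row g v0; rewrite (bigD1 i0) //= big1 ?addr0; last first.
    by move=> nu n0; rewrite jform_flux // dg.2 mulr0.
  by rewrite jform_flux0 // (flux_fd dg.1) g1 mulrN1 => /eqP; rewrite oppr_eq0 => /eqP.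
have [_ + _] := hsa; rewrite -kermx_eq0 => /eqP k0.
suff : v *m row_mx A C = 0 by move/sub_kermxP; rewrite k0 submx0 => /eqP.
rewrite -v0; apply/rowP => j; rewrite !mxE; apply: eq_bigr => k _.
have [->|n0] := eqVneq k i0; first by rewrite vi0 !mul0r.
by congr (_ * _); rewrite !mxE; case: fintype.splitP => j' _; rewrite !mxE (negbTE n0).
Qed.

Lemma flux_selfadjoint : selfadjoint_bvp p A' C'.
Proof.
case: hsa => ad _ _; split => //; first exact: flux_row_free.
exact: (selfadjoint_demeaned hl hP hp0 sa no_cst flux_domP).
Qed.

Lemma flux_green G : generalized_green p A C G -> kernel_orthogonal_to_constants p A C ->
  generalized_green p A' C' (demean_kernel G).
Proof. exact: (generalized_green_demeaned hl hP hp0 sa flux_domP). Qed.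

End flux_row.

(** * The rank 1 and rank 2 boundary conditions *)

Section demeaned_forms.
Context {R : realType}.
Variables (l : nat) (hl : (0 < l)%N) (p : nat -> R -> R).
Hypothesis hp0 : forall t, 0 <= t <= 1 -> p 0%N t = 0.
Variables (A C : 'M[R]_(l.*2)).
Hypothesis hsa : selfadjoint_bvp p A C.
Hypothesis no_cst : ~ satisfies_bc A C (fun=> 1).

Lemma sobolev_Lred u : sobolev 2%:E l.*2 u ->
  ae01 (fun t => Lop l p u t = derive1 (Lred l p (derive1 u)) t).
Proof.
have [P hP] := coef_chain_ex (let: And3 h _ _ := hsa in h).
move=> /sobolev_W2[g hg ug]; apply: (Lop_Lred hl hP hp0 hg) => t /andP[t0 t1].
by apply: ug; rewrite !ltW.
Qed.

Lemma flux_problem_ex (M : 'M[R]_(l.*2)) : M \in unitmx ->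
  (forall nu, nu != idx0 hl -> (M *m A) nu (idx0 hl) + (M *m C) nu (idx0 hl) = 0) ->
  exists A' C' : 'M[R]_(l.*2), [/\ coefs_of_forms (fun nu u =>
      if nu == idx0 hl then periodic_flux l p u else bform (M *m A) (M *m C) nu u) A' C',
    selfadjoint_bvp p A' C'
  & forall G, generalized_green p A C G -> kernel_orthogonal_to_constants p A C ->
      generalized_green p A' C' (demean_kernel G)].
Proof.
move=> uM k0; have [P hP] := coef_chain_ex (let: And3 h _ _ := hsa in h).
have hsa' := selfadjoint_bvp_mul uM hsa.
have no' : ~ satisfies_bc (M *m A) (M *m C) (fun=> 1) by rewrite satisfies_bc_mul.
exists (fluxA P hl (M *m A)), (fluxC P hl (M *m C)); split.
- exact: flux_coefs.
- exact: flux_selfadjoint.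
- move=> G hG ho; apply: flux_green => //; first exact: generalized_green_mul.
  by rewrite /kernel_orthogonal_to_constants op_kernel_mul.
Qed.

Lemma demeaned_problem1 (M : 'M[R]_(l.*2)) : M \in unitmx -> normalized1 hl (M *m A) (M *m C) ->
  (M *m A) (idx0 hl) (idx0 hl) + (M *m C) (idx0 hl) (idx0 hl) != 0 /\
  exists A' C' : 'M[R]_(l.*2), [/\ coefs_of_forms (demeaned_forms1 hl p (M *m A) (M *m C)) A' C',
    selfadjoint_bvp p A' C'
  & forall G, generalized_green p A C G -> kernel_orthogonal_to_constants p A C ->
      generalized_green p A' C' (demean_kernel G)].
Proof.
move=> uM nM.
have k0 nu : nu != idx0 hl -> (M *m A) nu (idx0 hl) + (M *m C) nu (idx0 hl) = 0.
  move=> n0; have [|-> ->] := nM nu; last by rewrite addr0.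
  by rewrite lt0n; apply: contra n0 => /eqP e; apply/eqP/val_inj.
split; last exact: flux_problem_ex.
by apply: constants_coef_neq0 k0; rewrite satisfies_bc_mul.
Qed.

Lemma demeaned_problem2 (M : 'M[R]_(l.*2)) : M \in unitmx -> normalized2 hl (M *m A) (M *m C) ->
  exists A' C' : 'M[R]_(l.*2), [/\ coefs_of_forms (demeaned_forms2 hl p (M *m A) (M *m C)) A' C',
    selfadjoint_bvp p A' C'
  & forall G, generalized_green p A C G -> kernel_orthogonal_to_constants p A C ->
      generalized_green p A' C' (demean_kernel G)].
Proof.
move=> uM [[a00 c00] [a10 c10] rest].
(* E subtracts the first row from the second, whose value coefficients become -1 and 1 and cancel on
   constants. *)
pose E : 'M[R]_(l.*2) := 1%:M - delta_mx (idx1 hl) (idx0 hl).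
have i01 : (idx1 hl == idx0 hl) = false by [].
have EE : E *m (1%:M + delta_mx (idx1 hl) (idx0 hl)) = 1%:M.
  rewrite mulmxDr mulmx1 mulmxBl mul1mx mul_delta_mx_cond eq_sym i01 mulr0n subr0.
  by rewrite /E subrK.
have uE : E \in unitmx by have [] := mulmx1_unit EE.
have Esum nu (f : 'I_(l.*2) -> R) : \sum_mu E nu mu * f mu =
    f nu - (nu == idx1 hl)%:R * f (idx0 hl).
  under eq_bigr do rewrite !mxE mulrBl.
  rewrite sumrB (bigD1 nu) //= eqxx mul1r big1 ?addr0; last first.
    by move=> k kn; rewrite eq_sym (negbTE kn) mul0r.
  congr (_ - _); rewrite (bigD1 (idx0 hl)) //= eqxx andbT big1 ?addr0 // => k kn.
  by rewrite (negbTE kn) andbF mul0r.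
have k0 nu : nu != idx0 hl -> ((E *m M) *m A) nu (idx0 hl) + ((E *m M) *m C) nu (idx0 hl) = 0.
  move=> n0; rewrite -!mulmxA !mxE !Esum; have [->|n1] := eqVneq nu (idx1 hl).
    by rewrite -[true%:R]/(1 : R) a00 c00 a10 c10; ring.
  have [|-> ->] := rest nu; last by rewrite !mul0r !subr0 addr0.
  by move: n0 n1; rewrite -!val_eqE /=; lia.
have [A' [C' [co sa gr]]] := @flux_problem_ex (E *m M) (ltac:(by rewrite unitmx_mul uE)) k0.
exists A', C'; split => // u su nu; rewrite (co u su nu) /demeaned_forms2.
case: ifP => // n0; rewrite -!mulmxA bform_mul Esum.
by case: eqVneq => [->|_]; rewrite ?mul1r // mul0r subr0.
Qed.

End demeaned_forms.

(** * Limits of centered Gaussian variables *)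

Section mean.
Context d (T : measurableType d) (R : realType) (P : probability T R).
Implicit Types (f g : T -> R).

Definition integr f := P.-integrable setT (EFin \o f).
Definition mean f : R := \int[P]_(w in setT) f w.
Definition sqint f := measurable_fun setT f /\ integr (fun w => f w ^+ 2).

Lemma integr_meas f : integr f -> measurable_fun setT f.
Proof. by move=> /measurable_int /measurable_EFinP. Qed.

Lemma integr_dom f g : measurable_fun setT f -> integr g -> (forall w, `|f w| <= g w) -> integr f.
Proof.
move=> mf ig fg; apply: (le_integrable measurableT _ _ ig); first exact/measurable_EFinP.
by move=> w _; rewrite /= lee_fin (le_trans (fg w)) // ler_norm.
Qed.

Lemma integr_cst a : integr (fun=> a).
Proof. exact: finite_measure_integrable_cst. Qed.

Lemma integrD f g : integr f -> integr g -> integr (fun w => f w + g w).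
Proof. by move=> hf hg; apply: (integrableD measurableT hf hg). Qed.

Lemma integrZ a f : integr f -> integr (fun w => a * f w).
Proof. by move=> hf; apply: (integrableZl measurableT a hf). Qed.

Lemma meanD f g : integr f -> integr g -> mean (fun w => f w + g w) = mean f + mean g.
Proof. by move=> hf hg; apply: RintegralD. Qed.

Lemma meanZ a f : integr f -> mean (fun w => a * f w) = a * mean f.
Proof. by move=> hf; apply: RintegralZl. Qed.

Lemma mean_cst a : mean (fun=> a) = a.
Proof. by rewrite /mean Rintegral_cst //= probability_setT /= mulr1. Qed.

Lemma mean_ge0 f : (forall w, 0 <= f w) -> 0 <= mean f.
Proof. by move=> f0; apply: Rintegral_ge0. Qed.

Lemma mean_norm_le f g : integr f -> integr g -> (forall w, `|f w| <= g w) -> `|mean f| <= mean g.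
Proof.
move=> hf hg fg; apply: le_trans (le_normr_Rintegral measurableT hf) _.
by apply: le_Rintegral => //; exact: integrable_norm.
Qed.

Lemma sqint_mul f g : sqint f -> sqint g -> integr (fun w => f w * g w).
Proof.
move=> [mf f2] [mg g2]; apply: (integr_dom _ (integrD f2 g2)); first exact: measurable_funM.
by move=> w; rewrite ler_norml; nra.
Qed.

Lemma sqint_integr f : sqint f -> integr f.
Proof.
move=> [mf f2]; apply: (integr_dom mf (integrD f2 (integr_cst 1))) => w.
by rewrite ler_norml; nra.
Qed.

Lemma sqintZ a f : sqint f -> sqint (fun w => a * f w).
Proof.
move=> [mf f2]; split; first exact: measurable_funM.
have -> : (fun w => (a * f w) ^+ 2) = (fun w => a ^+ 2 * f w ^+ 2) by apply/funext => w; ring.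
exact: integrZ.
Qed.

Lemma sqintD f g : sqint f -> sqint g -> sqint (fun w => f w + g w).
Proof.
move=> hf hg; split; first by apply: measurable_funD; [case: hf|case: hg].
have -> : (fun w => (f w + g w) ^+ 2) = (fun w => (f w ^+ 2 + 2 * (f w * g w)) + g w ^+ 2).
  by apply/funext => w; ring.
by apply: integrD; [apply: integrD; [exact: hf.2|apply: integrZ; exact: sqint_mul]|exact: hg.2].
Qed.

Lemma sqint_cst a : sqint (fun=> a).
Proof. by split => //; exact: integr_cst. Qed.

Lemma sqint_sum n (f : 'I_n -> T -> R) : (forall i, sqint (f i)) -> sqint (fun w => \sum_i f i w).
Proof.
move=> hf; have H (I : seq 'I_n) : sqint (fun w => \sum_(i <- I) f i w).
  elim: I => [|i I ih]; first by under eq_fun do rewrite big_nil; exact: sqint_cst.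
  by under eq_fun do rewrite big_cons; exact: sqintD.
exact: H.
Qed.

Lemma mean_sum n (f : 'I_n -> T -> R) : (forall i, integr (f i)) ->
  mean (fun w => \sum_i f i w) = \sum_i mean (f i).
Proof.
move=> hf; have H (I : seq 'I_n) : integr (fun w => \sum_(i <- I) f i w) /\
    mean (fun w => \sum_(i <- I) f i w) = \sum_(i <- I) mean (f i).
  elim: I => [|i I [ih e]].
    rewrite big_nil; under [X in mean X]eq_fun do rewrite big_nil.
    by under eq_fun do rewrite big_nil; split; [exact: integr_cst|exact: mean_cst].
  rewrite big_cons; under [X in mean X]eq_fun do rewrite big_cons.
  under eq_fun do rewrite big_cons.
  by split; [exact: integrD|rewrite meanD // e].
exact: (H _).2.
Qed.

Lemma mean_eq f g : (forall w, f w = g w) -> mean f = mean g.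
Proof. by move=> fg; congr mean; apply/funext. Qed.

Definition dfun f (x : R) : R := fine (P (f @^-1` `]-oo, x])).

Lemma measurable_half f x : measurable_fun setT f -> measurable (f @^-1` `]-oo, x]).
Proof. by move=> mf; rewrite -[X in measurable X]setTI; exact: mf. Qed.

Lemma dfunE f x : measurable_fun setT f -> P (f @^-1` `]-oo, x]) = (dfun f x)%:E.
Proof. by move=> mf; rewrite fineK // fin_num_measure //; exact: measurable_half. Qed.

(* Chebyshev's inequality for [f - g] *)
Lemma dfun_le f g (x r : R) : measurable_fun setT f -> measurable_fun setT g ->
  integr (fun w => (f w - g w) ^+ 2) -> 0 < r ->
  dfun f x <= dfun g (x + r) + mean (fun w => (f w - g w) ^+ 2) / r ^+ 2.
Proof.
move=> mf mg i2 r0.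
have mi (u : T -> R) y : measurable_fun setT u -> integr (\1_(u @^-1` `]-oo, y]) : T -> R).
  move=> mu; apply: (@integr_dom _ (fun=> 1)).
  - by apply: measurable_indic; exact: measurable_half.
  - exact: integr_cst.
  - by move=> w; rewrite indicE; case: (_ \in _); rewrite ?normr1 ?normr0.
have dE (u : T -> R) y : measurable_fun setT u -> dfun u y = mean (\1_(u @^-1` `]-oo, y]) : T -> R).
  by move=> mu; rewrite /mean /Rintegral integral_indic // ?setIT //; exact: measurable_half.
rewrite !dE // mulrC -meanZ // -meanD //; last exact: integrZ.
apply: le_Rintegral => //; [exact: mi| |].
  by apply: integrD; [exact: mi|exact: integrZ].
move=> w _; have h0 : 0 <= (r ^+ 2)^-1 * (f w - g w) ^+ 2 by rewrite mulr_ge0 ?invr_ge0 ?sqr_ge0.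
have E (u : T -> R) y : (w \in u @^-1` `]-oo, y]) = (u w <= y).
  by apply/idP/idP; rewrite inE /= in_itv.
rewrite !indicE !E.
have [fx|fx] := leP (f w) x; last by rewrite addr_ge0.
have [gx|gx] := leP (g w) (x + r); first by rewrite lerDl.
rewrite add0r mulrC ler_pdivlMr ?mul1r; last by rewrite exprn_gt0.
by have : r < g w - f w; [lra|move=> ?; nra].
exact: mi.
Qed.

(** Right continuity of a distribution function, from continuity of P along the decreasing events f
    <= x + 1/(n+1); it absorbs the shift r in Chebyshev's comparison. *)
Lemma dfun_le_right f (c x : R) : measurable_fun setT f ->
  (forall r, 0 < r -> c <= dfun f (x + r)) -> c <= dfun f x.
Proof.
move=> mf H; rewrite -lee_fin -dfunE //.
pose F n := f @^-1` `]-oo, x + n.+1%:R^-1].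
have FE : f @^-1` `]-oo, x] = \bigcap_n F n.
  apply/seteqP; split => w /=; rewrite in_itv /= => h.
    by move=> n _; rewrite /F /= in_itv /= (le_trans h) // lerDl invr_ge0.
  rewrite leNgt; apply/negP => h'; have hp : 0 < f w - x by rewrite subr_gt0.
  have [n _ hn] := near_infty_natSinv_lt (PosNum hp).
  have := h n I; rewrite /F /= in_itv /= => h1.
  by move: (hn n (leqnn n)); move: h1; set a := n.+1%:R^-1 => h1 /= h2; lra.
have mF n : measurable (F n) by exact: measurable_half.
have := @nonincreasing_cvg_mu _ _ _ P F _ mF _ _.
rewrite -FE => /(_ _ _ _) C.
have {}C : P (F n) @[n --> \oo] --> P (f @^-1` `]-oo, x]).
  apply: C; first by rewrite ltey_eq fin_num_measure.
    exact: measurable_half.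
  apply/nonincreasing_seqP => n; apply/subsetPset => w; rewrite /F /= !in_itv /= => h.
  by rewrite (le_trans h) // lerD2l lef_pV2 ?posrE ?ltr0n // ler_nat.
rewrite -(cvg_lim _ C) //; apply: lime_ge; first by apply/cvg_ex; eexists; exact: C.
by near=> n; rewrite /F dfunE // lee_fin H // invr_gt0.
Unshelve. all: by end_near. Qed.

End mean.

(** * Laws determined by their distribution functions *)

Section same_law.
Context d1 (T1 : measurableType d1) d2 (T2 : measurableType d2) (R : realType).
Variables (P1 : probability T1 R) (P2 : probability T2 R).
Variables (Y1 : T1 -> R) (Y2 : T2 -> R).
Hypotheses (mY1 : measurable_fun setT Y1) (mY2 : measurable_fun setT Y2).

#[local] HB.instance Definition _ := isMeasurableFun.Build _ _ _ _ Y1 mY1.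
#[local] HB.instance Definition _ := isMeasurableFun.Build _ _ _ _ Y2 mY2.

(** The open upper rays are stable under intersection and generate the Borel sets, and the rays ]-n,
    +oo[ exhaust the line, so they determine a finite measure. *)
Lemma same_dfun : (forall x, dfun P1 Y1 x = dfun P2 Y2 x) ->
  forall B : set R, measurable B -> P1 (Y1 @^-1` B) = P2 (Y2 @^-1` B).
Proof.
move=> H B mB.
pose D1 := distribution P1 (Y1 : {mfun T1 >-> R}).
pose D2 := distribution P2 (Y2 : {mfun T2 >-> R}).
suff : D1 B = D2 B by [].
refine (@measure_unique _ R _ (@RGenOInfty.G R) (fun n => `]- n%:R, +oo[%classic) _ _ _ _ D1 D2 _ _ B mB) => //.
- exact: RGenOInfty.measurableE.
- move=> _ _ [x ->] [y ->]; exists (Num.max x y).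
  by apply/seteqP; split => z /=; rewrite !in_itv /= !andbT gt_max; [move=> [-> ->]|move/andP].
- by move=> n; exists (- n%:R).
- apply/seteqP; split => // x _; exists (Num.bound `|x|) => //=.
  rewrite in_itv /= andbT ltrNl; apply: le_lt_trans (archi_boundP (normr_ge0 x)).
  by rewrite -normrN ler_norm.
- move=> _ [x ->]; rewrite -[LHS]/(P1 (Y1 @^-1` `]x, +oo[)) -[RHS]/(P2 (Y2 @^-1` `]x, +oo[)).
  have C (U : Type) (Y : U -> R) : Y @^-1` `]x, +oo[ = ~` (Y @^-1` `]-oo, x]).
    by apply/seteqP; split => w /=; rewrite !in_itv /= andbT ltNge => /negP.
  by rewrite !C !probability_setC ?dfunE ?H //; exact: measurable_half.
- by move=> n; rewrite ltey_eq fin_num_measure.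
Qed.

Hypothesis law : forall B : set R, measurable B -> P1 (Y1 @^-1` B) = P2 (Y2 @^-1` B).

Lemma same_law_ge0 (h : R -> \bar R) : measurable_fun setT h -> (forall y, 0 <= h y)%E ->
  (\int[P1]_w h (Y1 w) = \int[P2]_w h (Y2 w))%E.
Proof.
move=> mh h0; rewrite -(@ge0_integral_distribution _ _ _ _ _ P1 (Y1 : {mfun T1 >-> R}) _ mh h0).
rewrite -(@ge0_integral_distribution _ _ _ _ _ P2 (Y2 : {mfun T2 >-> R}) _ mh h0).
by apply: eq_measure_integral => B mB _; exact: law.
Qed.

Lemma same_law_integr (h : R -> R) : measurable_fun setT h ->
  integr P1 (h \o Y1) -> integr P2 (h \o Y2).
Proof.
move=> mh /integrableP[_ i1]; apply/integrableP; split.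
  by apply/measurable_EFinP; exact: measurableT_comp.
rewrite -(@same_law_ge0 (fun y => `|h y|%:E)) //.
by apply/measurable_EFinP; exact: measurableT_comp.
Qed.

Lemma same_law_mean (h : R -> R) : measurable_fun setT h ->
  integr P1 (h \o Y1) -> mean P1 (h \o Y1) = mean P2 (h \o Y2).
Proof.
move=> mh i1; have i2 := same_law_integr mh i1; congr fine.
have mh' : measurable_fun setT (EFin \o h) by exact/measurable_EFinP.
rewrite -[LHS](@integral_distribution _ _ _ _ _ P1 (Y1 : {mfun T1 >-> R}) _ mh' i1).
rewrite -[RHS](@integral_distribution _ _ _ _ _ P2 (Y2 : {mfun T2 >-> R}) _ mh' i2).
by apply: eq_measure_integral => B mB _; exact: law.
Qed.

End same_law.

(** * Gaussian laws as affine images of the standard normal law *)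

Section affine_normal.
Context {R : realType}.

Local Notation N01 := (normal_prob (0 : R) 1).
Definition affine (m s y : R) : R := m + s * y.

Lemma measurable_affine m s : measurable_fun setT (affine m s).
Proof. by apply: measurable_funD => //; exact: measurable_funM. Qed.

Lemma derive1_affine m s : (affine m s)^`()%classic = cst s.
Proof.
apply/funext => y; rewrite derive1E /affine; have -> : (fun y => m + s * y) = (cst m \+ s \*: (@id R)).
  by apply/funext => z.
by rewrite deriveD // derive_cst add0r deriveZ // derive_id /GRing.scale /= mulr1.
Qed.

Lemma derivable_affine m s y : derivable (affine m s) y 1.
Proof.
have -> : affine m s = (cst m \+ s \*: (@id R)) by apply/funext.
by apply: derivableD => //; exact: derivableZ.
Qed.

Lemma affine_continuous m s : continuous (affine m s).
Proof. by move=> y; apply/differentiable_continuous/derivable1_diffP; exact: derivable_affine. Qed.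

Lemma normal_pdf_affine m s y : 0 < s -> normal_pdf m s (affine m s y) * s = normal_pdf 0 1 y.
Proof.
move=> s0; rewrite !normal_pdfE ?oner_neq0 ?gt_eqF // /normal_peak /normal_fun /affine.
rewrite mulrAC; congr (_ * _).
  rewrite -[s ^+ 2 * pi *+ 2]mulr_natr -mulrA sqrtrM ?sqr_ge0 // sqrtr_sqr gtr0_norm //.
  rewrite invfM mulrAC mulVf ?gt_eqF // mul1r expr1n mul1r mulr_natr.
  by [].
congr expR; rewrite expr1n; field.
by rewrite gt_eqF.
Qed.

Lemma normal_prob_affine (m s x : R) : 0 < s ->
  normal_prob m s `]-oo, x] = N01 (affine m s @^-1` `]-oo, x]).
Proof.
move=> s0; have bx : affine m s ((x - m) / s) = x.
  by rewrite /affine mulrC divfK ?gt_eqF // addrC subrK.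
have -> : affine m s @^-1` `]-oo, x] = `]-oo, ((x - m) / s)]%classic.
  apply/seteqP; split => y /=; rewrite !in_itv /= ler_pdivlMr // /affine => ?; lra.
rewrite /normal_prob -[in LHS]bx.
rewrite increasing_ge0_integration_by_substitutionNy.
- by apply: eq_integral => y _; rewrite derive1_affine; congr EFin; exact: normal_pdf_affine.
- by move=> y z _ _ yz; rewrite /affine ltrD2l ltr_pM2l.
- by rewrite derive1_affine => y _; exact: cst_continuous.
- by rewrite derive1_affine; exact: is_cvg_cst.
- by rewrite derive1_affine; exact: cvg_cst.
- split=> [y _|]; first exact: derivable_affine.
  exact/cvg_at_left_filter/affine_continuous.
- rewrite /affine; apply: cvg_comp (gt0_cvgMrNy s0 cvg_id) _.
  exact: cvg_addrl_Ny.
- by apply: continuous_subspaceT => y; apply: continuous_normal_pdf; rewrite gt_eqF.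
- by move=> y _; exact: normal_pdf_ge0.
Qed.

Lemma normal_probN (m s : R) : normal_prob m (- s) = normal_prob m s.
Proof.
apply/funext => B; apply: eq_integral => x _.
by rewrite /normal_pdf oppr_eq0 /normal_peak /normal_fun sqrrN.
Qed.

Lemma dfun_cst d (T : measurableType d) (P : probability T R) (a x : R) :
  dfun P (fun=> a) x = (a <= x)%R%:R.
Proof.
rewrite /dfun; case: (leP a x) => ax.
  have -> : (fun=> a) @^-1` `]-oo, x] = [set: T]; last by rewrite probability_setT.
  by apply/seteqP; split => // w _; rewrite /= in_itv.
have -> : (fun=> a) @^-1` `]-oo, x] = (set0 : set T); last by rewrite measure0.
by apply/seteqP; split => // w; rewrite /= in_itv /= leNgt ax.
Qed.

Context d (T : measurableType d) (P : probability T R).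

(** Degenerate and normal laws become the single family m + s xi with s >= 0, described by
    distribution functions, the form in which the limit is taken. *)
Lemma gaussian_rv_affine (Y : T -> R) : gaussian_rv P Y <->
  measurable_fun setT Y /\ exists m s : R, 0 <= s /\ forall x, dfun P Y x = dfun N01 (affine m s) x.
Proof.
split=> [[mY [m [s H]]]|[mY [m [s [s0 H]]]]]; split => //.
  have [s0|s0] := eqVneq s 0.
    exists m, 0; split => // x; have -> : affine m 0 = fun=> m.
      by apply/funext => y; rewrite /affine mul0r addr0.
    rewrite dfun_cst /dfun H // s0 eqxx diracE.
    by rewrite mem_setE in_itv.
  (* The normal law is unchanged when s is replaced by - s, so the scale can be taken positive. *)
  wlog s1 : s s0 H / 0 < s => [W|].
    have [sn|sp|/eqP] := ltgtP s 0; [|exact: (W s)|by rewrite (negbTE s0)].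
    apply: (W (- s)); rewrite ?oppr_eq0 ?oppr_gt0 // => B mB.
    by rewrite normal_probN H.
  exists m, s; split => [|x]; first exact: ltW.
  by rewrite /dfun H // (negbTE s0) normal_prob_affine.
have L := @same_dfun _ _ _ _ _ P N01 Y (affine m s) mY (measurable_affine m s) H.
exists m, s => B mB; rewrite L //; case: eqVneq => [->|sn].
  have -> : affine m 0 = fun=> m by apply/funext => y; rewrite /affine mul0r addr0.
  rewrite diracE; have [mB'|mB'] := pselect (B m).
    rewrite mem_set // -(@probability_setT _ _ _ N01); congr (N01 _).
    by apply/seteqP; split.
  rewrite memNset // -[RHS](measure0 N01); congr (N01 _).
  by apply/seteqP; split.
have {}s0 : 0 < s by rewrite lt_neqAle eq_sym sn.
symmetry; refine (@same_dfun _ _ _ _ _ (normal_prob m s) N01 id (affine m s)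
  (@measurable_id _ _ setT) (measurable_affine m s) _ B mB).
by move=> x; congr fine; exact: normal_prob_affine.
Qed.

End affine_normal.

(** * Convergence in quadratic mean *)

Section gaussian_limit.
Context {R : realType} d (T : measurableType d) (P : probability T R).
Local Notation N01 := (normal_prob (0 : R) 1).
Local Notation var U := (mean P (fun w => U w ^+ 2)).

Lemma sqintB (f g : T -> R) : sqint P f -> sqint P g -> sqint P (fun w => f w - g w).
Proof.
move=> hf hg; have -> : (fun w => f w - g w) = (fun w => f w + (-1) * g w).
  by apply/funext => w; rewrite mulN1r.
by apply: sqintD => //; exact: sqintZ.
Qed.

(** Since V^2 - U^2 = (U - V)^2 - 2 U (U - V), this is Young's inequality with weight a: 2 |U (U -
    V)| <= a U^2 + (U - V)^2 / a. *)
Lemma var_diff (U V : T -> R) (a : R) : sqint P U -> sqint P V -> 0 < a ->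
  `|var V - var U| <= a * var U + (1 + a^-1) * mean P (fun w => (U w - V w) ^+ 2).
Proof.
move=> hU hV a0; have hD := sqintB hU hV.
have iN := integrZ (-1) hU.2.
have -> : var V - var U = mean P (fun w => V w ^+ 2 + (-1) * U w ^+ 2).
  by rewrite meanD ?meanZ ?mulN1r //; [exact: hU.2|exact: hV.2].
rewrite -!meanZ; [|exact: hD.2|exact: hU.2].
rewrite -meanD; [|exact: integrZ hU.2|exact: integrZ hD.2].
apply: mean_norm_le.
- by apply: integrD iN; exact: hV.2.
- by apply: integrD; apply: integrZ; [exact: hU.2|exact: hD.2].
- move=> w; set u := U w; set v := V w.
  have aV : a * a^-1 = 1 by rewrite divff ?gt_eqF.
  have b0 : 0 < a^-1 by rewrite invr_gt0.
  move: aV b0; set b := a^-1 => ab b0.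
  have h1 : 0 <= a * (u + b * (u - v)) ^+ 2 by rewrite mulr_ge0 ?sqr_ge0 ?ltW.
  have h2 : 0 <= a * (u - b * (u - v)) ^+ 2 by rewrite mulr_ge0 ?sqr_ge0 ?ltW.
  have e1 : a * (u + b * (u - v)) ^+ 2 = a * u ^+ 2 + 2 * (a * b) * u * (u - v) + (a * b) * b * (u - v) ^+ 2 by ring.
  have e2 : a * (u - b * (u - v)) ^+ 2 = a * u ^+ 2 - 2 * (a * b) * u * (u - v) + (a * b) * b * (u - v) ^+ 2 by ring.
  rewrite e1 ab in h1; rewrite e2 ab in h2.
  by rewrite ler_norml; nra.
Qed.

(** A non-degenerate affine image determines xi as (Y - m) / s, so the second moment of the standard
    normal law is inherited from Y. *)
Lemma affine_sqint (Y : T -> R) m s : sqint P Y -> s != 0 ->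
  (forall x, dfun P Y x = dfun N01 (affine m s) x) -> sqint N01 id.
Proof.
move=> hY s0 H; split => //.
pose h (y : R) := ((y - m) / s) ^+ 2.
have mh : measurable_fun setT h.
  by apply: measurable_funX; apply: measurable_funM => //; exact: measurable_funB.
have -> : (fun w : R => id w ^+ 2) = h \o affine m s.
  by apply/funext => y; rewrite /h /affine /= addrC addKr mulrC mulKf.
have L := @same_dfun _ _ _ _ _ P N01 Y (affine m s) hY.1 (measurable_affine m s) H.
apply: (@same_law_integr _ _ _ _ _ P N01 Y (affine m s) hY.1 (measurable_affine m s) L _ mh).
have := (sqintZ s^-1 (sqintD hY (sqint_cst P (- m)))).2.
by congr integr; apply/funext => w; rewrite /h /= mulrC.
Qed.

(** The mean and variance of the standard normal law, kept as constants without computing their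
    values; positivity of v is deduced later from a non-degenerate approximant. *)
Let mu : R := mean N01 id.
Let v : R := mean N01 (fun y => (y - mu) ^+ 2).

Let centered : sqint N01 id -> sqint N01 (fun y => y - mu).
Proof. by move=> h; apply: sqintD h _; exact: sqint_cst. Qed.

(** Centering fixes m = - s mu, so centered Gaussian laws form a family with the single parameter s,
    read off from the variance. *)
Lemma affine_moments (Y : T -> R) : sqint N01 id -> sqint P Y -> mean P Y = 0 -> gaussian_rv P Y ->
  exists s, [/\ 0 <= s, forall x, dfun P Y x = dfun N01 (affine (- (s * mu)) s) x & var Y = s ^+ 2 * v].
Proof.
move=> hid hY Y0 /gaussian_rv_affine[mY [m [s [s0 H]]]].
have L := @same_dfun _ _ _ _ _ P N01 Y (affine m s) hY.1 (measurable_affine m s) H.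
have E (h : R -> R) mh := @same_law_mean _ _ _ _ _ P N01 Y (affine m s) hY.1 (measurable_affine m s) L h mh.
have mE : m = - (s * mu).
  have := E id (@measurable_id _ _ setT) (sqint_integr hY).
  rewrite [mean P _]Y0 => e0; have : mean N01 (id \o affine m s) = m + s * mu.
    have i1 := sqint_integr hid.
    rewrite -[LHS]/(mean N01 (fun y => m + s * y)).
    by rewrite (meanD (integr_cst N01 m) (integrZ s i1)) (meanZ s i1) mean_cst.
  by rewrite -e0; lra.
exists s; split => //; first by rewrite -mE.
have msq : measurable_fun setT (fun y : R => y ^+ 2) by exact: measurable_funX.
have -> := E (fun y => y ^+ 2) msq hY.2.
rewrite -meanZ; last exact: (centered hid).2.
by apply: mean_eq => y; rewrite /= /affine mE; ring.
Qed.

Lemma gaussian_limit (Z : T -> R) : sqint P Z ->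
  (forall e, 0 < e -> exists Y, [/\ gaussian_rv P Y, sqint P Y, mean P Y = 0
     & mean P (fun w => (Z w - Y w) ^+ 2) <= e]) ->
  gaussian_rv P Z.
Proof.
move=> hZ H; apply/gaussian_rv_affine; split; first exact: hZ.1.
have : 0 <= var Z by apply: mean_ge0 => w; exact: sqr_ge0.
(* With variance zero there may be no non-degenerate approximant; Chebyshev's comparison with the
   constant 0 identifies the law directly. *)
rewrite le_eqVlt => /orP[/eqP z0|z0].
  exists 0, 0; split => // x; have -> : affine (0 : R) 0 = fun=> 0.
    by apply/funext => y; rewrite /affine mul0r addr0.
  rewrite dfun_cst -(dfun_cst P); apply: le_anti; apply/andP; split.
  - apply: dfun_le_right => // r r0.
    have := dfun_le x hZ.1 (@measurable_cst _ _ _ _ setT (0 : R)) (sqintB hZ (sqint_cst P 0)).2 r0.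
    rewrite (@mean_eq _ _ _ P _ (fun w => Z w ^+ 2)) -?z0 ?mul0r ?addr0 //.
    by move=> w; rewrite subr0.
  - apply: dfun_le_right; first exact: hZ.1.
    move=> r r0; have := dfun_le x (@measurable_cst _ _ _ _ setT (0 : R)) hZ.1 (sqintB (sqint_cst P 0) hZ).2 r0.
    rewrite (@mean_eq _ _ _ P _ (fun w => Z w ^+ 2)) -?z0 ?mul0r ?addr0 //.
    by move=> w; rewrite sub0r sqrrN.
(* In [var_diff] with a = 1/2 the other factor is 3, so 1/12 gives a variance gap of at most 1/2 +
   3/12 = 3/4 of that of Z, and Y0 is not degenerate. *)
have [Y0 [gY0 hY0 mY0 dY0]] := H (var Z / 12) ltac:(lra).
have vY0 : 0 < var Y0.
  have := @var_diff Z Y0 2^-1 hZ hY0 ltac:(lra); rewrite invrK ler_norml => /andP[h _].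
  by move: h dY0 z0; set a := var Z; set b := mean P _; set c := mean P _; lra.
have hid : sqint N01 id.
  have /gaussian_rv_affine[_ [m [s [s0 HY]]]] := gY0.
  have [se|sn] := eqVneq s 0; last exact: affine_sqint hY0 sn HY.
  exfalso; have L := @same_dfun _ _ _ _ _ P N01 Y0 (affine m s) hY0.1 (measurable_affine m s) HY.
  have E (h : R -> R) mh := @same_law_mean _ _ _ _ _ P N01 Y0 (affine m s) hY0.1 (measurable_affine m s) L h mh.
  have aE : affine m s = fun=> m by apply/funext => y; rewrite /affine se mul0r addr0.
  have := E id (@measurable_id _ _ setT) (sqint_integr hY0).
  rewrite [mean P _]mY0 aE mean_cst => m0.
  have msq : measurable_fun setT (fun y : R => y ^+ 2) by exact: measurable_funX.
  have := E (fun y => y ^+ 2) msq hY0.2.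
  by rewrite aE mean_cst -m0 expr0n /= => e; rewrite [X in _ < X]e ltxx in vY0.
have v0 : 0 < v.
  have [s [s0 _ e]] := affine_moments hid hY0 mY0 gY0.
  have vge : 0 <= v by apply: mean_ge0 => w; exact: sqr_ge0.
  rewrite lt_neqAle vge andbT eq_sym; apply/negP => /eqP ve.
  by rewrite e ve mulr0 ltxx in vY0.
(* The scale of the limit law, forced by var Z = s^2 v. *)
pose s := Num.sqrt (var Z / v).
have s2 : s ^+ 2 * v = var Z by rewrite sqr_sqrtr ?divfK ?gt_eqF // divr_ge0 // ltW.
have s0 : 0 <= s by exact: sqrtr_ge0.
have close (e : R) : 0 < e -> exists (Y : T -> R) (s' : R), [/\ measurable_fun setT Y,
    integr P (fun w => (Z w - Y w) ^+ 2), mean P (fun w => (Z w - Y w) ^+ 2) <= e,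
    (s' - s) ^+ 2 * v <= e & forall x, dfun P Y x = dfun N01 (affine (- (s' * mu)) s') x].
  (* This a makes the first term of [var_diff] equal to e/2; the second entry of the minimum below
     bounds the other term by e/2. *)
  move=> e0; pose a := e / (2 * var Z); have a0 : 0 < a by rewrite divr_gt0 // mulr_gt0.
  have c0 : 0 < 1 + a^-1 by rewrite addr_gt0 // invr_gt0.
  have c1 : 0 < e / 2 / (1 + a^-1) by rewrite !divr_gt0.
  have [|Y [gY hY mY dY]] := H (Num.min e (e / 2 / (1 + a^-1))); first by rewrite lt_min e0 c1.
  move: dY; rewrite le_min => /andP[dY1 dY2].
  have [s' [s'0 HY e']] := affine_moments hid hY mY gY.
  exists Y, s'; split => //; [exact: hY.1|exact: (sqintB hZ hY).2|].
  have := var_diff hZ hY a0; rewrite e' -s2.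
  have -> : a * (s ^+ 2 * v) = e / 2 by rewrite s2 /a; field; rewrite gt_eqF.
  move: dY2; rewrite ler_pdivlMr // mulrC; set D := mean P _; set c := 1 + a^-1 => dY2 h.
  have {}h : `|(s' ^+ 2 - s ^+ 2) * v| <= e by rewrite mulrBl (le_trans h) //; lra.
  apply: le_trans h; rewrite normrM (gtr0_norm v0) ler_pM2r //.
  (* For nonnegative scales (s' - s)^2 is at most |s'^2 - s^2|, so closeness of the variances gives
     closeness of the scales. *)
  have [ss|ss] := leP s s'.
    by apply: le_trans (ler_norm _); nra.
  by rewrite -normrN; apply: le_trans (ler_norm _); nra.
exists (- (s * mu)), s; split => // x.
have iA (b1 b2 : R) : integr N01 (fun y => (affine (- (b1 * mu)) b1 y - affine (- (b2 * mu)) b2 y) ^+ 2).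
  have -> : (fun y => (affine (- (b1 * mu)) b1 y - affine (- (b2 * mu)) b2 y) ^+ 2) =
     (fun y => (b1 - b2) ^+ 2 * (y - mu) ^+ 2) by apply/funext => y; rewrite /affine; ring.
  by apply: integrZ; exact: (centered hid).2.
have mA (b1 b2 : R) : mean N01 (fun y => (affine (- (b1 * mu)) b1 y - affine (- (b2 * mu)) b2 y) ^+ 2) =
    (b1 - b2) ^+ 2 * v.
  rewrite -(meanZ ((b1 - b2) ^+ 2) (centered hid).2).
  by apply: mean_eq => y; rewrite /affine; ring.
have step (r e A B : R) : 0 < r -> 0 < e -> A <= e * r ^+ 2 / 2 -> B <= e * r ^+ 2 / 2 ->
    A / r ^+ 2 + B / r ^+ 2 <= e.
  move=> r0 e0 hA hB; rewrite -mulrDl ler_pdivrMr ?exprn_gt0 //.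
  by rewrite (splitr (e * r ^+ 2)) lerD.
apply: le_anti; apply/andP; split.
- apply: dfun_le_right; first exact: measurable_affine.
  (* Half of the shift r is spent on comparing Z with Y, the other half on comparing the affine
     images of scales s' and s. *)
  move=> r r0; apply/ler_addgt0Pr => e e0; pose q := r / 2; have q0 : 0 < q by rewrite divr_gt0.
  have [|Y [s' [mY iY dY ds HY]]] := close (e * q ^+ 2 / 2); first by rewrite divr_gt0 // mulr_gt0 // exprn_gt0.
  have h1 := dfun_le x hZ.1 mY iY q0.
  have h2 := @dfun_le _ _ _ N01 _ _ (x + q) q
    (measurable_affine (- (s' * mu)) s')
    (measurable_affine (- (s * mu)) s) (iA s' s) q0.
  rewrite HY in h1; rewrite mA in h2; have h3 := step _ _ _ _ q0 e0 dY ds.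
  have -> : x + r = x + q + q by rewrite /q; lra.
  by move: h1 h2 h3; set A := _ / _; set B := _ / _; lra.
- apply: dfun_le_right; first exact: hZ.1.
  move=> r r0; apply/ler_addgt0Pr => e e0; pose q := r / 2; have q0 : 0 < q by rewrite divr_gt0.
  have [|Y [s' [mY iY dY ds HY]]] := close (e * q ^+ 2 / 2); first by rewrite divr_gt0 // mulr_gt0 // exprn_gt0.
  have eY : (fun w => (Y w - Z w) ^+ 2) = (fun w => (Z w - Y w) ^+ 2) by apply/funext => w; ring.
  have h1 := dfun_le (x + q) mY hZ.1 (eq_rect_r (integr P) iY eY) q0.
  have h2 := @dfun_le _ _ _ N01 _ _ x q
    (measurable_affine (- (s * mu)) s)
    (measurable_affine (- (s' * mu)) s') (iA s s') q0.
  rewrite -HY mA -sqrrN opprB in h2; rewrite eY in h1; have h3 := step _ _ _ _ q0 e0 dY ds.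
  have -> : x + r = x + q + q by rewrite /q; lra.
  by move: h1 h2 h3; set A := _ / _; set B := _ / _; lra.
Qed.

End gaussian_limit.

(** * The demeaned process *)

Section path_integral.
Context {R : realType}.
Implicit Types f : R -> R.

Lemma int01_bound f e : integrable01 f -> (forall t, 0 <= t <= 1 -> `|f t| <= e) -> `|int01 f| <= e.
Proof.
move=> fi fe; apply: le_trans (le_normr_Rintegral _ fi) _ => //.
apply: (@le_trans _ _ (int01 (fun=> e))); last by rewrite int01_cst.
by apply: le_Rintegral => //; [exact: integrable_norm|exact: integrable01_cst].
Qed.

(* a divergent integral has the junk value 0 *)
Lemma int01_nonintegrable f : measurable_fun `[(0 : R), 1] f -> ~ integrable01 f -> int01 f = 0.
Proof.
move=> mf nf; rewrite /int01 /Rintegral integralE.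
have mp : measurable_fun `[(0 : R), 1] (EFin \o f) by exact/measurable_EFinP.
set a := (\int[_]_(_ in _) _^\+ _)%E; set b := (\int[_]_(_ in _) _^\- _)%E.
have a0 : (0 <= a)%E by apply: integral_ge0 => x _; exact: funepos_ge0.
have b0 : (0 <= b)%E by apply: integral_ge0 => x _; exact: funeneg_ge0.
have [afin|] := boolP (a \is a fin_num); last first.
  by rewrite ge0_fin_numE // -leNgt leye_eq => /eqP ->; case: b b0.
have [bfin|] := boolP (b \is a fin_num); last first.
  rewrite ge0_fin_numE // -leNgt leye_eq => /eqP ->.
  by rewrite -(fineK afin).
exfalso; apply: nf; apply/integrableP; split => //.
have -> : (\int[@leb R]_(x in `[0%R, 1%R]) `|(EFin \o f) x| = a + b)%E.
  transitivity (\int[@leb R]_(x in `[0%R, 1%R]) ((EFin \o f)^\+ \+ (EFin \o f)^\-) x)%E.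
    by rewrite -fune_abse.
  by rewrite ge0_integralD //; [exact: measurable_funepos|exact: measurable_funeneg].
by rewrite -(fineK afin) -(fineK bfin) -EFinD ltry.
Qed.

Lemma int01Zm a f : measurable_fun `[(0 : R), 1] f -> int01 (fun t => a * f t) = a * int01 f.
Proof.
move=> mf; have [fi|fi] := pselect (integrable01 f); first exact: int01Z.
have [->|a0] := eqVneq a 0.
  by rewrite mul0r (eq_int01 (g := fun=> 0)) ?int01_cst // => t _; rewrite mul0r.
rewrite (int01_nonintegrable mf fi) mulr0; apply: int01_nonintegrable.
  exact: measurable_funM.
move=> /(integrable01Z a^-1) h; apply: fi; apply: eq_integrable01 h => t _.
by rewrite mulKf.
Qed.

(** Jensen's inequality, by expanding the integral of (f - c)^2 with c the integral of f. Divergent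
    cases are included: a non-integrable f has integral 0 by convention, and a non-integrable square
    makes the right side infinite. *)
Lemma sqr_int01_le f : measurable_fun `[(0 : R), 1] f ->
  ((int01 f ^+ 2)%:E <= \int[@leb R]_(t in `[0%R, 1%R]) (f t ^+ 2)%:E)%E.
Proof.
move=> mf; have sq0 : (0 <= \int[@leb R]_(t in `[0%R, 1%R]) (f t ^+ 2)%:E)%E.
  by apply: integral_ge0 => t _; rewrite lee_fin sqr_ge0.
have [fi|fi] := pselect (integrable01 f); last by rewrite int01_nonintegrable // expr0n.
have [f2|f2] := pselect (integrable01 (fun t => f t ^+ 2)); last first.
  rewrite [X in (_ <= X)%E](_ : _ = +oo%E) ?leey //; apply/eqP; rewrite -leye_eq leNgt.
  apply/negP => h; apply: f2; apply/integrableP; split.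
    by apply/measurable_EFinP; exact: measurable_funX.
  apply: le_lt_trans h; rewrite le_eqVlt; apply/orP; left; apply/eqP.
  by apply: eq_integral => t _; rewrite /= ger0_norm // sqr_ge0.
rewrite -[leRHS]fineK; last by apply: integrable_fin_num => //; exact: f2.
rewrite lee_fin -/(Rintegral _ _ _) -/(int01 (fun t => f t ^+ 2)).
set c := int01 f; have h : 0 <= int01 (fun t => (f t - c) ^+ 2).
  by apply: Rintegral_ge0 => t _; exact: sqr_ge0.
move: h; rewrite (eq_int01 (g := fun t => f t ^+ 2 + ((- (2 * c)) * f t + c ^+ 2))); last first.
  by move=> t _; ring.
have i1 := integrable01Z (- (2 * c)) fi; have i2 := integrable01_cst (c ^+ 2).
rewrite (int01D f2 (integrable01D i1 i2)) (int01D i1 i2) int01Z // int01_cst -/c; nra.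
Qed.

End path_integral.

(** * Moments of the path integral and its Riemann sums *)

Section process.
Context {R : realType} d (T : measurableType d) (P : probability T R).
Variables (X : R -> T -> R) (G : R -> R -> R).
Hypotheses (gX : gaussian_process P X) (X0 : zero_mean P X) (cX : covariance_function P X G).
Hypothesis cG : {within `[(0:R), 1] `*` `[(0:R), 1], continuous (fun z : R * R => G z.1 z.2)}.
Let mX : measurable_fun (`[(0 : R), 1] `*` [set: T]) (fun z : R * T => X z.1 z.2) := gX.1.
Let q2 : exponent_ok (2%:E : \bar R). Proof. by left. Qed.

Lemma process_meas t : 0 <= t <= 1 -> measurable_fun setT (X t).
Proof.
move=> t01; apply: (@measurable_section1 _ _ _ _ _ _ _ (fun z : R * T => X z.1 z.2) _ _ mX) => //.
Qed.

Lemma path_meas w : measurable_fun `[(0 : R), 1] (fun t => X t w).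
Proof. exact: (@measurable_section2 _ _ _ _ _ _ _ (fun z : R * T => X z.1 z.2) _ _ mX). Qed.

Let covX t s : 0 <= t <= 1 -> 0 <= s <= 1 ->
  (\int[P]_w (X t w * X s w)%:E = (G t s)%:E)%E.
Proof.
move=> t01 s01; rewrite -(cX t01 s01) covariance.unlock !X0 //= expectation.unlock.
by apply: eq_integral => w _; rewrite -[RHS]/((X t w - 0) * (X s w - 0))%:E !subr0.
Qed.

Lemma process_sqint t : 0 <= t <= 1 -> sqint P (X t).
Proof.
move=> t01; split; first exact: process_meas.
apply/integrableP; split.
  by apply/measurable_EFinP; apply: measurable_funX; exact: process_meas.
apply: (@le_lt_trans _ _ (\int[P]_w (X t w * X t w)%:E)%E); last by rewrite covX // ltry.
rewrite le_eqVlt; apply/orP; left; apply/eqP.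
by apply: eq_integral => w _; rewrite /= ger0_norm ?sqr_ge0.
Qed.

Lemma process_mean t : 0 <= t <= 1 -> mean P (X t) = 0.
Proof. by move=> t01; have := X0 t01; rewrite expectation.unlock /mean /Rintegral => ->. Qed.

Lemma process_cov t s : 0 <= t <= 1 -> 0 <= s <= 1 -> mean P (fun w => X t w * X s w) = G t s.
Proof. by move=> t01 s01; rewrite /mean /Rintegral covX. Qed.

Lemma process_sym t s : 0 <= t <= 1 -> 0 <= s <= 1 -> G t s = G s t.
Proof.
by move=> t01 s01; rewrite -!process_cov //; apply: mean_eq => w; rewrite mulrC.
Qed.

Lemma product_finite (K : R * T -> R) (M : R) :
  measurable_fun (`[(0 : R), 1] `*` [set: T]) K ->
  (forall t : R, 0 <= t <= 1 -> (\int[P]_w `|K (t, w)|%:E <= M%:E)%E) ->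
  (\int[@leb R]_(t in `[0%R, 1%R]) \int[P]_w `|K (t, w)|%:E < +oo)%E.
Proof.
move=> mK KM; have M0 : 0 <= M.
  rewrite -lee_fin; apply: le_trans (KM 0 _); last by rewrite lexx ler01.
  by apply: integral_ge0.
apply: (@le_lt_trans _ _ (\int[@leb R]_(t in `[0%R, 1%R]) M%:E)%E).
  apply: ge0_le_integral => //.
  - by move=> t _; exact: integral_ge0.
  - exact: (@measurable_abs_fubini1 _ _ _ _ _ P _ _ K _ _ mK).
by have /integrableP[_] := integrable01_cst M; rewrite /= ger0_norm.
Qed.

Lemma mean_abs_product (W : T -> R) t M : sqint P W -> 0 <= t <= 1 -> `|G t t| <= M ->
  (\int[P]_w `|W w * X t w|%:E <= (mean P (fun w => (W w) ^+ 2) + M)%:E)%E.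
Proof.
move=> hW t01 GM; have iWX := sqint_mul hW (process_sqint t01).
have -> : (\int[P]_w `|W w * X t w|%:E = (mean P (fun w => `|W w * X t w|))%:E)%E.
  by rewrite fineK //; apply: integrable_fin_num => //; exact: integrable_norm.
rewrite lee_fin; apply: (@le_trans _ _ (mean P (fun w => W w ^+ 2 + X t w * X t w))).
  apply: le_trans (ler_norm _) _; apply: mean_norm_le; first exact: integrable_norm.
    by apply: integrD; [exact: hW.2|apply: sqint_mul; exact: process_sqint].
  by move=> w; rewrite normr_id ler_norml; nra.
rewrite meanD; [|exact: hW.2|by apply: sqint_mul; exact: process_sqint].
by rewrite process_cov // lerD2l (le_trans (ler_norm _)).
Qed.

Definition path_mean (w : T) : R := int01 (fun s => X s w).

(** Fubini on the product of [0,1] and the probability space. The free factor W is later 1, a value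
    X_t, the path integral itself, and the error of a Riemann sum. *)
Lemma mean_path_mean W : sqint P W -> integrable01 (fun s => mean P (fun w => W w * X s w)) /\
  integr P (fun w => W w * path_mean w) /\
  mean P (fun w => W w * path_mean w) = int01 (fun s => mean P (fun w => W w * X s w)).
Proof.
move=> hW; have [M _ hM] := kernel_bounded cG.
pose K (z : R * T) := W z.2 * X z.1 z.2.
have mS : measurable (`[(0 : R), 1] `*` [set: T]) by exact: measurableX.
have mK : measurable_fun (`[(0 : R), 1] `*` [set: T]) K.
  apply: measurable_funM => //; apply: (measurableT_comp hW.1).
  exact: measurable_funTS measurable_snd.
have fK : (\int[@leb R]_(t in `[0%R, 1%R]) \int[P]_w `|K (t, w)|%:E < +oo)%E.
  by apply: (product_finite mK) => t t01; apply: (mean_abs_product hW t01); exact: hM.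
(* This holds for every w, including those whose path is not integrable: both sides are then 0. *)
have E w : int01 (fun s => K (s, w)) = W w * path_mean w := int01Zm (W w) (path_meas w).
have := @Rintegral_integrable2 _ _ _ _ _ (@leb R) P _ _ K _ _ mK fK.
rewrite (_ : (fun y => \int[leb]_(x in `[0%R, 1%R]) K (x, y)) = (fun w => W w * path_mean w)); last exact/funext.
move=> i2; split; first exact: (@Rintegral_integrable1 _ _ _ _ _ (@leb R) P _ _ K _ _ mK fK).
split; first exact: i2.
rewrite [RHS](@Rintegral_fubini _ _ _ _ _ (@leb R) P _ _ K _ _ mK fK) //.
by apply: mean_eq => w; rewrite -E.
Qed.

(** Jensen on each path, then Tonelli: the second moment is at most the integral of G(t,t), and no
    integrability of individual paths is assumed. *)
Lemma path_mean_sqint : sqint P path_mean.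
Proof.
have h1 := sqint_cst P 1; have [_ [i1 _]] := mean_path_mean h1.
have mY : measurable_fun setT path_mean.
  by move: (integr_meas i1); congr measurable_fun; apply/funext => w; rewrite mul1r.
have mS : measurable (`[(0 : R), 1] `*` [set: T]) by exact: measurableX.
split => //; pose K (z : R * T) := X z.1 z.2 ^+ 2.
have mK : measurable_fun (`[(0 : R), 1] `*` [set: T]) K by exact: measurable_funX.
have [M _ hM] := kernel_bounded cG.
have aK z : `|K z| = X z.1 z.2 ^+ 2 by rewrite ger0_norm ?sqr_ge0.
apply/integrableP; split; first by apply/measurable_EFinP; exact: measurable_funX.
apply: (@le_lt_trans _ _ (\int[P]_w \int[@leb R]_(t in `[0%R, 1%R]) `|K (t, w)|%:E)%E).
  apply: ge0_le_integral => //.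
  - by apply/measurable_EFinP; apply: measurableT_comp => //; exact: measurable_funX.
  - exact: (@measurable_abs_fubini2 _ _ _ _ _ (@leb R) _ _ K _ _ mK).
  - move=> w _; rewrite /= ger0_norm ?sqr_ge0 //.
    apply: le_trans (sqr_int01_le (path_meas w)) _.
    by rewrite le_eqVlt; apply/orP; left; apply/eqP; apply: eq_integral => t _; rewrite aK.
rewrite -(@abs_fubini_tonelli _ _ _ _ _ (@leb R) P _ _ K _ _ mK) //.
apply: (product_finite (M := M) mK) => t t01.
apply: (@le_trans _ _ (\int[P]_w (X t w * X t w)%:E)%E).
  by rewrite le_eqVlt; apply/orP; left; apply/eqP; apply: eq_integral => w _; rewrite aK.
by rewrite covX // lee_fin (le_trans (ler_norm _)) // hM.
Qed.

Lemma mean_path_mean0 : mean P path_mean = 0.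
Proof.
have [_ [_ E]] := mean_path_mean (sqint_cst P 1).
rewrite (@mean_eq _ _ _ P _ (fun w => 1 * path_mean w)); last by move=> w; rewrite mul1r.
rewrite E (eq_int01 (g := fun=> 0)) ?int01_cst // => s s01.
by rewrite -[RHS](process_mean s01); apply: mean_eq => w; rewrite mul1r.
Qed.

Lemma mean_process_path t : 0 <= t <= 1 -> mean P (fun w => X t w * path_mean w) = kmean G t.
Proof.
move=> t01; have [_ [_ ->]] := mean_path_mean (process_sqint t01).
by apply: eq_int01 => s s01; exact: process_cov.
Qed.

Lemma mean_path_sqr : mean P (fun w => path_mean w * path_mean w) = int01 (kmean G).
Proof.
have [_ [_ ->]] := mean_path_mean path_mean_sqint.
apply: eq_int01 => s s01; rewrite -mean_process_path //.
by apply: mean_eq => w; rewrite mulrC.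
Qed.

Lemma demeanE t w : demean X t w = X t w + (-1) * path_mean w.
Proof. by rewrite mulN1r. Qed.

Lemma demean_sqint t : 0 <= t <= 1 -> sqint P (demean X t).
Proof.
move=> t01; have -> : demean X t = (fun w => X t w + (-1) * path_mean w).
  by apply/funext => w; exact: demeanE.
by apply: sqintD; [exact: process_sqint|apply: sqintZ; exact: path_mean_sqint].
Qed.

Lemma demean_mean t : 0 <= t <= 1 -> mean P (demean X t) = 0.
Proof.
move=> t01; rewrite (@mean_eq _ _ _ P _ (fun w => X t w + (-1) * path_mean w)); last exact: demeanE.
have iY := sqint_integr path_mean_sqint; have iX := sqint_integr (process_sqint t01).
by rewrite (meanD iX (integrZ (-1) iY)) meanZ // process_mean // mean_path_mean0 mulr0 addr0.
Qed.

Lemma demean_zero_mean : zero_mean P (demean X).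
Proof.
move=> t t01; rewrite expectation.unlock -[LHS]fineK.
  by rewrite -/(Rintegral _ _ _) -/(mean P (demean X t)) demean_mean.
apply: integrable_fin_num => //; exact: sqint_integr (demean_sqint t01).
Qed.

Lemma demean_covariance : covariance_function P (demean X) (demean_kernel G).
Proof.
move=> t s t01 s01; rewrite covariance.unlock !demean_zero_mean //= expectation.unlock.
rewrite (eq_integral (fun w => (demean X t w * demean X s w)%:E)); last first.
  by move=> w _; rewrite -[LHS]/((demean X t w - 0) * (demean X s w - 0))%:E !subr0.
have iD := sqint_mul (demean_sqint t01) (demean_sqint s01).
rewrite -[LHS]fineK; last by apply: integrable_fin_num.
congr EFin; rewrite -/(Rintegral _ _ _) -/(mean P (fun w => demean X t w * demean X s w)).
pose Y := path_mean; have hY : sqint P Y := path_mean_sqint.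
rewrite (@mean_eq _ _ _ P _ (fun w => (X t w * X s w + (-1) * (X t w * Y w)) +
   ((-1) * (X s w * Y w) + Y w * Y w))); last by move=> w; rewrite /demean -/(path_mean w) -/Y; ring.
have j1 := sqint_mul (process_sqint t01) (process_sqint s01).
have j2 := sqint_mul (process_sqint t01) hY; have j3 := sqint_mul (process_sqint s01) hY.
have j4 := sqint_mul hY hY.
have k2 := integrZ (-1) j2; have k3 := integrZ (-1) j3.
rewrite (meanD (integrD j1 k2) (integrD k3 j4)) (meanD j1 k2) (meanD k3 j4) !meanZ //.
rewrite process_cov // !mean_process_path // mean_path_sqr.
rewrite (demean_kernelE process_sym) //; ring.
Qed.

Definition weight (n k : nat) : R := int01 (cell n k).
(** The left Riemann sum: cells inside the interval have weight 1/(n+1), while the last one meets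
    [0,1] only in the point 1 and has weight 0. *)
Definition riemann (n : nat) (w : T) : R := \sum_(k < n.+2) weight n k * X (node n k) w.

Let nodeI n (k : 'I_n.+2) : 0 <= (node n k : R) <= 1.
Proof. by apply: node01; exact: ltn_ord k. Qed.

Lemma integrable_cell n k : integrable01 (cell n k : R -> R).
Proof.
apply: (@integrable01_dom _ _ (fun=> 1)); first exact: measurable_funTS (measurable_cell n k).
  exact: integrable01_cst.
by move=> t _; rewrite /cell indicE; case: (_ \in _); rewrite ?normr1 ?normr0.
Qed.

Lemma weight_ge0 n k : 0 <= weight n k.
Proof. by apply: Rintegral_ge0 => t _; exact: cell_ge0. Qed.

Lemma weight_sum n : \sum_(k < n.+2) weight n k = 1.
Proof.
rewrite -int01_sum; last by move=> k; exact: integrable_cell.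
by rewrite (eq_int01 (g := fun=> 1)) ?int01_cst // => t t01; exact: cell_sum.
Qed.

Lemma riemann_sqint n : sqint P (riemann n).
Proof. by apply: sqint_sum => k; apply: sqintZ; exact: process_sqint. Qed.

(** Tested against X_s, the random error becomes the integral of the deterministic error of a step
    approximation of G(.,s), which is small uniformly in s. *)
Lemma riemann_cov n s : 0 <= s <= 1 ->
  mean P (fun w => (riemann n w - path_mean w) * X s w) =
  int01 (fun x => \sum_(k < n.+2) cell n k x * G (node n k) s - G x s).
Proof.
move=> s01; have hX := process_sqint s01.
have iG : integrable01 (G^~ s).
  by apply: (L01_integrable q2); apply: L01_continuous => //; exact: kernel_section.
have ic (k : 'I_n.+2) : integrable01 (fun x => cell n k x * G (node n k) s).
  have := integrable01Z (G (node n k) s) (@integrable_cell n k).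
  by apply: eq_integrable01 => x _; rewrite mulrC.
rewrite int01B; [|exact: integrable01_sum|by []].
rewrite int01_sum //.
rewrite (@mean_eq _ _ _ P _ (fun w => (\sum_(k < n.+2) weight n k * (X (node n k) w * X s w)) +
   (-1) * (X s w * path_mean w))); last first.
  move=> w; rewrite /riemann mulrBl mulr_suml mulN1r [path_mean w * _]mulrC; congr (_ - _).
  by apply: eq_bigr => k _; rewrite mulrA.
have iX (k : 'I_n.+2) : integr P (fun w => X (node n k) w * X s w).
  by apply: sqint_mul => //; exact: process_sqint.
have iXs (k : 'I_n.+2) : integr P (fun w => weight n k * (X (node n k) w * X s w)) by exact: integrZ.
have iY := sqint_mul hX path_mean_sqint.
have iS : integr P (fun w => \sum_(k < n.+2) weight n k * (X (node n k) w * X s w)).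
  have := sqint_mul (riemann_sqint n) hX; congr integr; apply/funext => w.
  by rewrite /riemann mulr_suml; apply: eq_bigr => k _; rewrite mulrA.
rewrite (meanD iS (integrZ (-1) iY)) (meanZ (-1) iY) mean_sum // mean_process_path // mulN1r.
congr (_ - _).
  apply: eq_bigr => k _; rewrite meanZ // process_cov //.
  rewrite (eq_int01 (g := fun x => G (node n k) s * cell n k x)); last by move=> x _; rewrite mulrC.
  by rewrite (int01Z _ (@integrable_cell n k)); exact: mulrC.
by apply: eq_int01 => x x01; exact: process_sym.
Qed.

(** Expand only one factor of the squared error W: its mean is the weighted sum of E(W X_node) minus
    the integral of E(W X_s). Each such covariance is at most e/2 in absolute value, and the weights
    have total 1. *)
Lemma riemann_cvg e : 0 < e -> exists n, mean P (fun w => (riemann n w - path_mean w) ^+ 2) <= e.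
Proof.
move=> e0; have e2 : 0 < e / 2 by lra.
have [N hN] := node_unif cG e2; exists N.
pose W w := riemann N w - path_mean w.
have hW : sqint P W by apply: sqintB; [exact: riemann_sqint|exact: path_mean_sqint].
have bW s : 0 <= s <= 1 -> `|mean P (fun w => W w * X s w)| <= e / 2.
  move=> s01; rewrite riemann_cov //; apply: int01_bound.
    apply: integrable01B.
      apply: integrable01_sum => k; have := integrable01Z (G (node N k) s) (@integrable_cell N k).
      by apply: eq_integrable01 => x _; rewrite mulrC.
    by apply: (L01_integrable q2); apply: L01_continuous => //; exact: kernel_section.
  move=> x x01; apply: (cell_approx (f := fun k => G (node N k) s)) => // k kn hk.
  by apply: ltW; apply: hN.
have [iW [iWY EY]] := mean_path_mean hW.
have iX (k : 'I_N.+2) : integr P (fun w => W w * X (node N k) w).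
  by apply: sqint_mul => //; exact: process_sqint.
have iXs (k : 'I_N.+2) : integr P (fun w => weight N k * (W w * X (node N k) w)) by exact: integrZ.
have iS : integr P (fun w => \sum_(k < N.+2) weight N k * (W w * X (node N k) w)).
  have := sqint_mul hW (riemann_sqint N); congr integr; apply/funext => w.
  by rewrite /riemann mulr_sumr; apply: eq_bigr => k _; ring.
rewrite (@mean_eq _ _ _ P _ (fun w => (\sum_(k < N.+2) weight N k * (W w * X (node N k) w)) +
   (-1) * (W w * path_mean w))); last first.
  move=> w; rewrite expr2 -/(W w) {2}/W mulrBr mulN1r /riemann mulr_sumr; congr (_ - _).
  by apply: eq_bigr => k _; ring.
rewrite (meanD iS (integrZ (-1) iWY)) (meanZ (-1) iWY) mean_sum // EY mulN1r.
apply: le_trans (ler_norm _) _; apply: le_trans (ler_normB _ _) _.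
rewrite [leRHS]splitr lerD //; last exact: int01_bound.
apply: le_trans (ler_norm_sum _ _ _) _.
apply: (@le_trans _ _ (\sum_(k < N.+2) weight N k * (e / 2))); last first.
  by rewrite -mulr_suml weight_sum mul1r.
apply: ler_sum => k _.
by rewrite meanZ // normrM ger0_norm ?weight_ge0 // ler_wpM2l ?weight_ge0 // bW.
Qed.

Lemma process_comb n (t c : 'I_n -> R) : (forall i, 0 <= t i <= 1) ->
  let Z w := \sum_i c i * X (t i) w in [/\ gaussian_rv P Z, sqint P Z & mean P Z = 0].
Proof.
move=> t01; split; first exact: gX.2.
  by apply: sqint_sum => i; apply: sqintZ; exact: process_sqint.
have iX i : integr P (X (t i)) by apply: sqint_integr; exact: process_sqint.
rewrite mean_sum; last by move=> i; exact: integrZ.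
by rewrite big1 // => i _; rewrite meanZ // process_mean // mulr0.
Qed.

Lemma gaussian_demean : gaussian_process P (demean X).
Proof.
have mS : measurable (`[(0 : R), 1] `*` [set: T]) by exact: measurableX.
split.
  apply: measurable_funB => //; apply: (measurableT_comp (path_mean_sqint.1)).
  exact: measurable_funTS measurable_snd.
move=> n t c t01; pose a := \sum_i c i.
have ZE w : \sum_i c i * demean X (t i) w = \sum_i c i * X (t i) w - a * path_mean w.
  rewrite /a mulr_suml -sumrB; apply: eq_bigr => i _.
  by rewrite /demean -/(path_mean w); ring.
have hZ : sqint P (fun w => \sum_i c i * demean X (t i) w).
  by apply: sqint_sum => i; apply: sqintZ; exact: demean_sqint.
apply: gaussian_limit => // e e0.
(* The error is multiplied by a^2 below; dividing by a^2 + 1 also covers a = 0. *)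
have [N hN] := @riemann_cvg (e / (a ^+ 2 + 1)) ltac:(by rewrite divr_gt0 // ltr_wpDl ?sqr_ge0).
(* The approximant is again a finite combination of values of X, at the given points followed by the
   nodes, hence Gaussian by hypothesis. *)
pose t' (i : 'I_(n + N.+2)) := match fintype.split i with inl j => t j | inr k => node N k end.
pose c' (i : 'I_(n + N.+2)) := match fintype.split i with inl j => c j | inr k => - (a * weight N k) end.
have t'01 i : 0 <= t' i <= 1 by rewrite /t'; case: (fintype.split i) => j.
have YE w : \sum_i c' i * X (t' i) w = \sum_i c i * X (t i) w - a * riemann N w.
  rewrite big_split_ord /=; congr (_ + _).
    by apply: eq_bigr => i _; rewrite /c' /t' (unsplitK (inl i)).
  rewrite /riemann mulr_sumr -sumrN; apply: eq_bigr => k _.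
  by rewrite /c' /t' (unsplitK (inr k)); ring.
have [gY hY mY] := process_comb c' t'01.
exists (fun w => \sum_i c' i * X (t' i) w); split => //.
have iD : integr P (fun w => (riemann N w - path_mean w) ^+ 2).
  exact: (sqintB (riemann_sqint N) path_mean_sqint).2.
rewrite (@mean_eq _ _ _ P _ (fun w => a ^+ 2 * (riemann N w - path_mean w) ^+ 2)); last first.
  by move=> w; rewrite ZE YE; ring.
rewrite meanZ //; apply: le_trans (_ : (a ^+ 2 + 1) * (e / (a ^+ 2 + 1)) <= e).
  by apply: ler_pM; rewrite ?sqr_ge0 ?lerDl //; apply: mean_ge0 => w; exact: sqr_ge0.
by rewrite mulrC divfK // gt_eqF // ltr_wpDl ?sqr_ge0.
Qed.

End process.

Theorem theorem1 (R : realType) (d : measure_display) (T : measurableType d)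
    (P : probability T R) (l : nat) (hl : (0 < l)%N) (p : nat -> R -> R)
    (A C : 'M[R]_(l.*2)) (X : R -> T -> R) (G : R -> R -> R)
    (hX : green_gaussian_process P X p A C G) (hX0 : zero_mean P X)
    (hp0 : forall t, 0 <= t <= 1 -> p 0%N t = 0) :
  [/\
    (* the demeaned process is a centered Gaussian process with covariance Gbar *)
    [/\ gaussian_process P (demean X), zero_mean P (demean X)
      & covariance_function P (demean X) (demean_kernel G)],
    (* the expression is (L u')' *)
    forall u, sobolev 2%:E l.*2 u ->
      ae01 (fun t => Lop l p u t = derive1 (Lred l p (derive1 u)) t),
    (* (i) *)
    (satisfies_bc A C (fun=> 1) <->
      exists2 c : R, c != 0 & ae01 (fun t => cov_operator G (fun=> c) t = 0)) /\
    (satisfies_bc A C (fun=> 1) ->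
      (forall t s, 0 <= t <= 1 -> 0 <= s <= 1 -> demean_kernel G t s = G t s) /\
      green_gaussian_process P (demean X) p A C (demean_kernel G)),
    (* (ii) *)
    ~ satisfies_bc A C (fun=> 1) -> \rank (value_coefs hl A C) = 2%N ->
      (exists2 M : 'M[R]_(l.*2), M \in unitmx
         & normalized2 hl (M *m A) (M *m C)) /\
      (forall M : 'M[R]_(l.*2), M \in unitmx ->
         normalized2 hl (M *m A) (M *m C) ->
         exists A' C' : 'M[R]_(l.*2),
           [/\ coefs_of_forms
                 (demeaned_forms2 hl p (M *m A) (M *m C)) A' C',
               selfadjoint_bvp p A' C'
             & kernel_orthogonal_to_constants p A C ->
               green_gaussian_process P (demean X) p A' C' (demean_kernel G)])
    (* (iii) *)
    & ~ satisfies_bc A C (fun=> 1) -> \rank (value_coefs hl A C) = 1%N ->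
      (exists2 M : 'M[R]_(l.*2), M \in unitmx
         & normalized1 hl (M *m A) (M *m C)) /\
      (forall M : 'M[R]_(l.*2), M \in unitmx ->
         normalized1 hl (M *m A) (M *m C) ->
         (M *m A) (idx0 hl) (idx0 hl) + (M *m C) (idx0 hl) (idx0 hl) != 0 /\
         exists A' C' : 'M[R]_(l.*2),
           [/\ coefs_of_forms
                 (demeaned_forms1 hl p (M *m A) (M *m C)) A' C',
               selfadjoint_bvp p A' C'
             & kernel_orthogonal_to_constants p A C ->
               green_gaussian_process P (demean X) p A' C' (demean_kernel G)])
  ].
Proof.
have [gX cX hsa hG] := hX; have [ad _ sa] := hsa; have [P' hP] := coef_chain_ex ad.
have cG : {within `[0, 1] `*` `[0, 1], continuous (fun z : R * R => G z.1 z.2)} by case: hG.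
have gD := gaussian_demean gX hX0 cX cG; have cD := demean_covariance gX hX0 cX cG.
split.
- by split => //; exact: demean_zero_mean gX hX0 cX cG.
- by move=> u; exact: sobolev_Lred hsa u.
- split; first exact: (constant_null_vector hl hP hp0 sa hG).
  move=> bc; split; first by move=> t s; exact: (demean_kernel_id hl hP hp0 hG bc).
  by split => //; exact: (generalized_green_constants hl hP hp0 hG bc).
- move=> nc rk; split; first exact: normalized2_ex.
  move=> M uM nM; have [A' [C' [co sa' gr]]] := demeaned_problem2 hp0 hsa nc uM nM.
  by exists A', C'; split => // ko; split => //; exact: gr.
- move=> nc rk; split; first exact: normalized1_ex.
  move=> M uM nM; have [k0 [A' [C' [co sa' gr]]]] := demeaned_problem1 hp0 hsa nc uM nM.
  by split => //; exists A', C'; split => // ko; split => //; exact: gr.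
Qed.
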